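(* Let $f\in M_{2,2}(\mathsf{O})$ be a hermitian positive definite matrix inducing a polarization $\eta=\mu\circ\gamma(f)$ on $E^2$ with kernel $E^2[F]$. Consider the hermitian lattice $L=(\mathsf{O}^2,f)$, i.e. the right $\mathsf{O}$-module $\mathsf{O}^2$ of column vectors with the form $(v,w)\mapsto v^\dagger fw$. To write $f=f_1+f_2$ with $f_1,f_2\in M_{2,2}(\mathsf{O})$ hermitian of rank 1 is equivalent to giving two sublattices (right $\mathsf{O}$-submodules) $I_1,I_2\subseteq L$ such that: (i) $I_1,I_2$ are invertible right $\mathsf{O}$-modules; (ii) $I_1\perp I_2$ with respect to $f$; (iii) $L/(I_1\oplus I_2)\cong\mathsf{O}/F$. If $I_1,I_2$ satisfy (i) and (ii), then (iii) is equivalent to (iii') $I_2$ is primitive and for every nonzero $v\in I_1$ one has $v^\dagger fv=p\,[I_1:v\mathsf{O}]$. The bijection is as follows. Given $f_1,f_2$, put $I_i=\ker(f_i)\subseteq\mathsf{O}^2$ for $i=1,2$. Conversely, given $I_1,I_2$, there is a direct sum decomposition $L\otimes_{\mathsf{O}}B=(I_1\otimes_{\mathsf{O}}B)\oplus(I_2\otimes_{\mathsf{O}}B)$; let $P_1,P_2\in M_{2,2}(B)$ be the matrices of the projections onto the first and second factor, and put $f_1=P_2^\dagger fP_2$, $f_2=P_1^\dagger fP_1$.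
   Context: Let $p>2$ be a prime, $k$ an algebraically closed field of characteristic $p$, and $E/k$ a supersingular elliptic curve defined over $\mathbb{F}_p$ whose relative Frobenius $F\in\operatorname{End}(E)$ satisfies $F^2+p=0$. Let $\mathsf{O}=\operatorname{End}(E)$ and $B=\mathsf{O}\otimes\mathbb{Q}$; $\mathsf{O}$ is a maximal order in the quaternion algebra $B$ over $\mathbb{Q}$ ramified exactly at $p$ and $\infty$. For a matrix $M$ over $B$, $M^\dagger$ is the conjugate transpose with respect to the standard involution of $B$; $M$ is hermitian if $M^\dagger=M$; rank means rank over $B$. Write $\gamma:M_{2,2}(\mathsf{O})\to\operatorname{End}(E^2)$ for the natural identification, $\mu$ for the product principal polarization on $E^2$; positive definite hermitian matrices $f$ correspond bijectively to polarizations $\mu\circ\gamma(f)$. $E^2[F]$ is the kernel of the Frobenius of $E^2$. $\mathsf{O}/F$ denotes $\mathsf{O}/F\mathsf{O}$ as a right $\mathsf{O}$-module ($F\mathsf{O}=\mathsf{O}F$). A submodule $I\subseteq L$ is primitive if $L/I$ is torsion-free. For invertible right $\mathsf{O}$-modules $J\subseteq I$ of the same rank, $[I:J]$ denotes the reduced index, i.e. the positive square root of the cardinality of $I/J$ (so $[\mathsf{O}:a\mathsf{O}]=N(a)=a\bar a$ for $0\ne a\in\mathsf{O}$). *)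

(* Defs.v *)
From HB Require Import structures.
From mathcomp Require Import all_boot all_order all_algebra ring separable.
From mathcomp Require Import all_classical reals.

Set Implicit Arguments.
Unset Strict Implicit.
Unset Printing Implicit Defensive.

Import Order.TTheory GRing.Theory Num.Theory.
Local Open Scope classical_set_scope.
Local Open Scope ring_scope.

(** * Quaternion algebras *)

(* [quat a b] is the algebra (a, b | K): [Quat x y z t] stands for
   x + y i + z j + t ij, with i^2 = a, j^2 = b and ji = - ij. *)
Record quat (K : fieldType) (a b : K) :=
  Quat { qre : K; qi : K; qj : K; qk : K }.
Arguments Quat {K a b}.

Section QuatRing.
Context {K : fieldType} {a b : K}.
Notation Q := (quat a b).

Definition quat_tuple (x : Q) := (qre x, qi x, qj x, qk x).
Definition tuple_quat (t : K * K * K * K) : Q :=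
  Quat t.1.1.1 t.1.1.2 t.1.2 t.2.
Lemma quat_tupleK : cancel quat_tuple tuple_quat. Proof. by case. Qed.

HB.instance Definition _ := Choice.copy Q (can_type quat_tupleK).

Definition quat0 : Q := Quat 0 0 0 0.
Definition quat1 : Q := Quat 1 0 0 0.
Definition quat_opp (x : Q) : Q := Quat (- qre x) (- qi x) (- qj x) (- qk x).
Definition quat_add (x y : Q) : Q :=
  Quat (qre x + qre y) (qi x + qi y) (qj x + qj y) (qk x + qk y).
Definition quat_mul (x y : Q) : Q :=
  Quat (qre x * qre y + a * (qi x * qi y) + b * (qj x * qj y)
          - a * b * (qk x * qk y))
       (qre x * qi y + qi x * qre y - b * (qj x * qk y) + b * (qk x * qj y))
       (qre x * qj y + qj x * qre y + a * (qi x * qk y) - a * (qk x * qi y))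
       (qre x * qk y + qk x * qre y + qi x * qj y - qj x * qi y).

Lemma quat_addA : associative quat_add.
Proof. by move=> x y z; rewrite /quat_add /= !addrA. Qed.
Lemma quat_addC : commutative quat_add.
Proof. by move=> x y; rewrite /quat_add; congr Quat; apply: addrC. Qed.
Lemma quat_add0 : left_id quat0 quat_add.
Proof. by case=> *; rewrite /quat_add /= !add0r. Qed.
Lemma quat_addN : left_inverse quat0 quat_opp quat_add.
Proof. by case=> *; rewrite /quat_add /= !addNr. Qed.
HB.instance Definition _ :=
  GRing.isZmodule.Build Q quat_addA quat_addC quat_add0 quat_addN.

Lemma quat_mulA : associative quat_mul.
Proof. by move=> x y z; rewrite /quat_mul /=; congr Quat; ring. Qed.
Lemma quat_mul1 : left_id quat1 quat_mul.
Proof. by case=> *; rewrite /quat_mul /=; congr Quat; ring. Qed.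
Lemma quat_mulr1 : right_id quat1 quat_mul.
Proof. by case=> *; rewrite /quat_mul /=; congr Quat; ring. Qed.
Lemma quat_mulDl : left_distributive quat_mul quat_add.
Proof. by move=> x y z; rewrite /quat_mul /=; congr Quat => /=; ring. Qed.
Lemma quat_mulDr : right_distributive quat_mul quat_add.
Proof. by move=> x y z; rewrite /quat_mul /=; congr Quat => /=; ring. Qed.
Lemma quat1_neq0 : quat1 != 0.
Proof. by apply/eqP=> -[] /eqP; rewrite oner_eq0. Qed.
HB.instance Definition _ := GRing.Zmodule_isNzRing.Build Q
  quat_mulA quat_mul1 quat_mulr1 quat_mulDl quat_mulDr quat1_neq0.

Definition quat_scalar (c : K) : Q := Quat c 0 0 0.

Definition qconj (x : Q) : Q := Quat (qre x) (- qi x) (- qj x) (- qk x).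

Definition adjmx m n (M : 'M[Q]_(m, n)) : 'M[Q]_(n, m) :=
  \matrix_(i, j) qconj (M j i).

Definition hermitian_mx n (M : 'M[Q]_n) := adjmx M = M.

End QuatRing.

Definition division_ring (B : nzRingType) :=
  forall x : B, x != 0 -> exists2 y : B, x * y = 1 & y * x = 1.

(** * Ramification *)

Definition padic_norm (l : nat) (q : rat) : rat :=
  if q == 0 then 0 else l%:R ^+ logn l `|denq q| / l%:R ^+ logn l `|numq q|.

(* [v] makes [K] the completion of the rationals at the prime [l]; as in every
   nonarchimedean field, (u_n) is Cauchy iff u_(n+1) - u_n tends to 0. *)
Record padic_completion (l : nat) (K : fieldType) (v : K -> rat) : Prop := {
  padic_eq0 : forall x, v x = 0 <-> x = 0;
  padicM : forall x y, v (x * y) = v x * v y;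
  padicD : forall x y, v (x + y) <= Num.max (v x) (v y);
  padic_rat : forall q : rat, v (ratr q) = padic_norm l q;
  padic_dense : forall x (e : rat), 0 < e ->
    exists q : rat, v (x - ratr q) < e;
  padic_complete : forall u : nat -> K,
    (forall e : rat, 0 < e ->
       exists N, forall n, (N <= n)%N -> v (u n.+1 - u n) < e) ->
    exists x, forall e : rat, 0 < e ->
      exists N, forall n, (N <= n)%N -> v (u n - x) < e }.

Definition ramified_at (a b : rat) (l : nat) :=
  exists (K : fieldType) (v : K -> rat),
    padic_completion l v /\ division_ring (quat (ratr a : K) (ratr b)).

Definition ramified_at_infinity (a b : rat) :=
  exists R : realType, division_ring (quat (ratr a : R) (ratr b)).

Definition ramified_exactly_at_p_infinity (a b : rat) (p : nat) :=
  [/\ ramified_at a b p, ramified_at_infinity a b &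
      forall l, prime l -> l <> p -> ~ ramified_at a b l].

(** * Orders *)

Section Orders.
Context {B : nzRingType}.
Implicit Types O I J : set B.

Definition subring O :=
  [/\ O 1, forall x y, O x -> O y -> O (x - y)
    & forall x y, O x -> O y -> O (x * y)].

Definition is_order O :=
  [/\ subring O,
      exists n (e : 'I_n -> B), forall x,
        O x <-> exists z : 'I_n -> int, x = \sum_i e i *~ z i
    & forall x : B, exists2 m : nat, (0 < m)%N & O (x *+ m)].

Definition maximal_order O :=
  is_order O /\ forall O', is_order O' -> O `<=` O' -> O' `<=` O.

Definition additive_span (X : set B) : set B :=
  [set x | exists n (y : 'I_n -> B), (forall i, X (y i)) /\ x = \sum_i y i].

Definition set_prod I J : set B :=
  additive_span [set x | exists y z, [/\ I y, J z & x = y * z]].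

Definition left_order J : set B := [set x | forall y, J y -> J (x * y)].

Definition right_ideal O J :=
  [/\ J 0, forall x y, J x -> J y -> J (x + y)
    & forall x c, J x -> O c -> J (x * c)].

(* Existence of an inverse J' forces J to be nonzero and finitely generated
   over O. *)
Definition invertible_ideal O J :=
  right_ideal O J /\
  exists J' : set B, set_prod J J' = left_order J /\ set_prod J' J = O.

Definition integral_mx O m n (M : 'M[B]_(m, n)) := forall i j, O (M i j).

(* The image of M is a right B-vector space of dimension r. *)
Definition has_rank m n (M : 'M[B]_(m, n)) (r : nat) :=
  exists C : 'M[B]_(m, r),
    (forall x : 'cV_r, C *m x = 0 -> x = 0) /\
    (forall w : 'cV_m,
       (exists v : 'cV_n, w = M *m v) <-> (exists x : 'cV_r, w = C *m x)).

(** * Right submodules of column vectors *)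

Section Columns.
Context {n : nat}.
Implicit Types X Y L : set 'cV[B]_n.

(* The right action; [*:] is the left one. *)
Definition colZ (v : 'cV[B]_n) (c : B) : 'cV[B]_n := \col_i (v i 0 * c).

Definition std_lattice O : set 'cV[B]_n := [set v | integral_mx O v].

Definition right_submodule O X :=
  [/\ X 0, forall v w, X v -> X w -> X (v + w)
    & forall v c, X v -> O c -> X (colZ v c)].

Definition sublattice O X := X `<=` std_lattice O /\ right_submodule O X.

Definition principal O (v : 'cV[B]_n) : set 'cV[B]_n :=
  [set w | exists2 c, O c & w = colZ v c].

Definition add_set X Y : set 'cV[B]_n :=
  [set w | exists v1 v2, [/\ X v1, Y v2 & w = v1 + v2]].

(* A right O-module is invertible if it is isomorphic to an invertible
   fractional right O-ideal J of B; in particular it has rank 1. *)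
Definition invertible O X :=
  exists2 c : 'cV[B]_n, c != 0 &
  exists2 J : set B, invertible_ideal O J &
    X = [set w | exists2 x, J x & w = colZ c x].

Definition primitive O X :=
  forall v c, std_lattice O v -> O c -> c != 0 -> X (colZ v c) -> X v.

(* X / Y is finite of cardinality N. *)
Definition quotient_card X Y (N : nat) :=
  exists t : 'I_N -> 'cV[B]_n, (forall i, X (t i)) /\
    forall v, X v -> exists! i, Y (v - t i).

Definition reduced_index X Y (r : nat) := quotient_card X Y (r ^ 2).

(* X / Y and I / J are isomorphic as right O-modules; [phi] chooses
   representatives of the values of an isomorphism. *)
Definition quotient_iso O X Y I J :=
  exists phi : 'cV[B]_n -> B,
    [/\ forall v, X v -> I (phi v),
        forall v w, X v -> X w -> J (phi (v + w) - (phi v + phi w)),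
        forall v c, X v -> O c -> J (phi (colZ v c) - phi v * c),
        forall v, X v -> (J (phi v) <-> Y v)
      & forall x, I x -> exists2 v, X v & J (x - phi v)].

(* The right B-subspace spanned by X, i.e. X (x)_O B inside B^n. *)
Definition spanB X : set 'cV[B]_n :=
  [set w | exists m (v : 'I_m -> 'cV[B]_n) (c : 'I_m -> B),
     (forall i, X (v i)) /\ w = \sum_i colZ (v i) (c i)].

Definition direct_sum X Y :=
  (forall w, add_set X Y w) /\ (forall w, X w -> Y w -> w = 0).

Definition projections X1 X2 (P1 P2 : 'M[B]_n) :=
  (forall v, X1 v -> P1 *m v = v /\ P2 *m v = 0) /\
  (forall v, X2 v -> P1 *m v = 0 /\ P2 *m v = v).

Definition ker_lattice O (M : 'M[B]_n) : set 'cV[B]_n :=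
  [set v | std_lattice O v /\ M *m v = 0].

End Columns.
End Orders.

Section Hermitian.
Context {a b : rat}.
Notation B := (quat a b).
Context {n : nat}.
Implicit Types (f : 'M[B]_n) (v w : 'cV[B]_n) (X Y : set 'cV[B]_n).

Definition hform f v w : B := (adjmx v *m f *m w) 0 0.

Definition positive_definite f :=
  forall v, v != 0 -> exists2 c : rat, 0 < c & hform f v v = quat_scalar c.

Definition orthogonal f X Y := forall v w, X v -> Y w -> hform f v w = 0.

End Hermitian.

(** * Commutative group functors over a field *)

(* A scheme is determined by its points in local rings, as are its closed
   subschemes and the morphisms from an integral scheme to a separated one;
   so group functors are only considered on local algebras. *)
Record localAlg (k : fieldType) := LocalAlg {
  lalg :> comUnitAlgType k;
  lalgP : forall x : lalg, x \is a GRing.unit \/ 1 - x \is a GRing.unit }.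

Lemma field_local (k : fieldType) (x : k^o) :
  x \is a GRing.unit \/ 1 - x \is a GRing.unit.
Proof.
rewrite !unitfE; have [->|] := eqVneq x 0; last by left.
by right; rewrite subr0 oner_neq0.
Qed.
Definition localField (k : fieldType) : localAlg k :=
  @LocalAlg k (k^o : comUnitAlgType k) (@field_local k).

Record groupFunctor (k : fieldType) := GroupFunctor {
  gpt :> localAlg k -> Type;
  gmap : forall R S : localAlg k, {lrmorphism R -> S} -> gpt R -> gpt S;
  gzero : forall R, gpt R;
  gopp : forall R, gpt R -> gpt R;
  gadd : forall R, gpt R -> gpt R -> gpt R }.
Arguments gzero {k} g R.

Section GroupFunctors.
Context {k : fieldType}.
Implicit Types G H : groupFunctor k.

Record commutative_group G : Prop := {
  gaddA : forall R : localAlg k, associative (@gadd k G R);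
  gaddC : forall R : localAlg k, commutative (@gadd k G R);
  gadd0 : forall R : localAlg k, left_id (gzero G R) (@gadd k G R);
  gaddN : forall R : localAlg k,
    left_inverse (gzero G R) (@gopp k G R) (@gadd k G R);
  gmapD : forall (R S : localAlg k) (h : {lrmorphism R -> S}) (P Q : G R),
    gmap h (gadd P Q) = gadd (gmap h P) (gmap h Q) }.

Definition gtrans G H := forall R : localAlg k, G R -> H R.

Record is_hom G H (u : gtrans G H) : Prop := {
  hom_add : forall (R : localAlg k) (P Q : G R),
    u R (gadd P Q) = gadd (u R P) (u R Q);
  hom_nat : forall (R S : localAlg k) (h : {lrmorphism R -> S}) (P : G R),
    u S (gmap h P) = gmap h (u R P) }.

Definition in_kernel G H (u : gtrans G H) (R : localAlg k) (P : G R) :=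
  u R P = gzero H R.

Definition power G (n : nat) : groupFunctor k := {|
  gpt := fun R => 'I_n -> G R;
  gmap := fun R S h P i => gmap h (P i);
  gzero := fun R i => gzero G R;
  gopp := fun R P i => gopp (P i);
  gadd := fun R P Q i => gadd (P i) (Q i) |}.

(* The endomorphism u is an isogeny: its target is the quotient of G by the
   group subscheme ker u. *)
Definition isogeny G (u : gtrans G G) :=
  is_hom u /\
  forall w : gtrans G G, is_hom w ->
    (forall R (P : G R), in_kernel u P -> in_kernel w P) ->
    exists t : gtrans G G,
      [/\ is_hom t, forall R (P : G R), w R P = t R (u R P)
        & forall t' : gtrans G G, is_hom t' ->
            (forall R (P : G R), w R P = t' R (u R P)) ->
            forall R (P : G R), t' R P = t R P].

Definition mulpt G (m : nat) (R : localAlg k) (P : G R) : G R :=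
  iter m (gadd P) (gzero G R).

End GroupFunctors.

(** * Elliptic curves *)

(* Homogeneous coordinates over a local ring: some coordinate is a unit. *)
Definition unimodular (k : fieldType) (R : localAlg k) (v : 'rV[R]_3) :=
  [exists i, v 0 i \is a GRing.unit].

Definition unit_line (k : fieldType) (R : localAlg k) (v : 'rV[R]_3) :
    set 'rV[R]_3 :=
  [set w | exists2 c : R, c \is a GRing.unit & w = c *: v].

(* y^2 z = x^3 + a2 x^2 z + a4 x z^2 + a6 z^3 *)
Record weierstrass (k : fieldType) := Weierstrass { wa2 : k; wa4 : k; wa6 : k }.

Section WeierstrassPoints.
Context {k : fieldType} (W : weierstrass k).

(* In characteristic different from 2 the curve is smooth iff this cubic is
   separable. *)
Definition smooth_weierstrass :=
  separable_poly ('X^3 + wa2 W *: 'X^2 + wa4 W *: 'X + (wa6 W)%:P).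

Definition on_curve (R : localAlg k) (v : 'rV[R]_3) :=
  let x := v 0 0 in let y := v 0 1 in let z := v 0 2 in
  y ^+ 2 * z =
    x ^+ 3 + wa2 W *: (x ^+ 2 * z) + wa4 W *: (x * z ^+ 2) + wa6 W *: z ^+ 3.

Record wpoint (R : localAlg k) := WPoint {
  wcoord : set 'rV[R]_3;
  wpointP : exists v, [/\ unimodular v, on_curve v & wcoord = unit_line v] }.

Definition wmap_coord (R S : localAlg k) (h : {lrmorphism R -> S})
    (P : set 'rV[R]_3) : set 'rV[S]_3 :=
  [set w | exists2 v, P v & unit_line (map_mx h v) w].

Lemma wmap_subproof (R S : localAlg k) (h : {lrmorphism R -> S})
    (P : wpoint R) :
  exists v, [/\ unimodular v, on_curve v & wmap_coord h (wcoord P) = unit_line v].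
Proof.
have [v [/existsP[i ui] ev defP]] := wpointP P; exists (map_mx h v); split.
- by apply/existsP; exists i; rewrite mxE rmorph_unit.
- have := congr1 h ev; rewrite /on_curve /= !mxE.
  have hZ c x : h (c *: x) = c *: h x by exact: linearZ.
  have hM x y : h (x * y) = h x * h y by exact: rmorphM.
  have hX x m : h (x ^+ m) = h x ^+ m by exact: rmorphXn.
  by rewrite !rmorphD /= !(hZ, hM, hX) => ->.
- apply/seteqP; split=> w /=; rewrite /wmap_coord /= defP.
    case=> _ [c uc ->] [d ud ->]; exists (d * h c).
      by rewrite unitrM ud rmorph_unit.
    by rewrite map_mxZ scalerA.
  by move=> uw; exists v => //; exists 1; rewrite ?unitr1 ?scale1r.
Qed.
Definition wmap R S h (P : wpoint R) : wpoint S := WPoint (wmap_subproof h P).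

Definition row3 (R : localAlg k) (x y z : R) : 'rV[R]_3 :=
  \row_(i < 3) [tuple x; y; z]`_i.

Lemma wzero_subproof (R : localAlg k) :
  exists v : 'rV[R]_3,
    [/\ unimodular v, on_curve v & unit_line (row3 0 1 0) = unit_line v].
Proof.
exists (row3 0 1 0); split=> //.
  by apply/existsP; exists 1; rewrite mxE /= unitr1.
by rewrite /on_curve !mxE /= !expr0n /= !mulr0 !scaler0 !addr0.
Qed.
Definition wzero R : wpoint R := WPoint (wzero_subproof R).

End WeierstrassPoints.
Arguments wzero {k} W R.

(* The group law of an elliptic curve is the only one with neutral element
   [0 : 1 : 0]. *)
Record ellCurve (k : fieldType) := EllCurve {
  ell_weierstrass : weierstrass k;
  ell_smooth : smooth_weierstrass ell_weierstrass;
  ell_opp : forall R, wpoint ell_weierstrass R -> wpoint ell_weierstrass R;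
  ell_add : forall R, wpoint ell_weierstrass R -> wpoint ell_weierstrass R ->
    wpoint ell_weierstrass R;
  ell_group : commutative_group {|
    gpt := wpoint ell_weierstrass;
    gmap := @wmap k ell_weierstrass;
    gzero := wzero ell_weierstrass;
    gopp := ell_opp;
    gadd := ell_add |} }.

Definition ell_functor (k : fieldType) (E : ellCurve k) : groupFunctor k := {|
  gpt := wpoint (ell_weierstrass E);
  gmap := @wmap k (ell_weierstrass E);
  gzero := wzero (ell_weierstrass E);
  gopp := @ell_opp k E;
  gadd := @ell_add k E |}.
Coercion ell_functor : ellCurve >-> groupFunctor.

Section EllipticCurves.
Context {k : fieldType} (E : ellCurve k) (p : nat).

Definition defined_over_Fp :=
  let W := ell_weierstrass E in
  [/\ wa2 W ^+ p = wa2 W, wa4 W ^+ p = wa4 W & wa6 W ^+ p = wa6 W].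

Definition supersingular :=
  forall P : E (localField k), mulpt p P = gzero E (localField k) ->
    P = gzero E (localField k).

Definition is_frobenius (u : gtrans E E) :=
  forall (R : localAlg k) (P : E R) (v : 'rV[R]_3),
    wcoord P v -> wcoord (u R P) (map_mx (fun x => x ^+ p) v).

(* [act] identifies the ring O with End(E). *)
Record endomorphism_ring (B : nzRingType) (O : set B)
    (act : B -> gtrans E E) : Prop := {
  act_hom : forall x, O x -> is_hom (act x);
  act_inj : forall x y, O x -> O y ->
    (forall R (P : E R), act x R P = act y R P) -> x = y;
  act_surj : forall u : gtrans E E, is_hom u ->
    exists2 x, O x & forall R (P : E R), act x R P = u R P;
  act1 : forall R (P : E R), act 1 R P = P;
  actD : forall x y, O x -> O y -> forall R (P : E R),
    act (x + y) R P = gadd (act x R P) (act y R P);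
  actM : forall x y, O x -> O y -> forall R (P : E R),
    act (x * y) R P = act x R (act y R P) }.

Definition gamma (B : nzRingType) (act : B -> gtrans E E) (f : 'M[B]_2) :
    gtrans (power E 2) (power E 2) :=
  fun R P i => gadd (act (f i 0) R (P 0)) (act (f i 1) R (P 1)).

Definition frobenius2 (u : gtrans E E) : gtrans (power E 2) (power E 2) :=
  fun R P i => u R (P i).

(* The product polarization of E^2 is an isomorphism, so its composite with
   gamma f is an isogeny iff gamma f is, and has the same kernel. *)
Definition induces_polarization (a b : rat)
    (act : quat a b -> gtrans E E) (f : 'M[quat a b]_2) :=
  [/\ hermitian_mx f, positive_definite f & isogeny (gamma act f)].

Definition polarization_kernel (B : nzRingType) (act : B -> gtrans E E)
    (f : 'M[B]_2) (frob : gtrans E E) :=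
  forall R (P : power E 2 R),
    in_kernel (gamma act f) P <-> in_kernel (frobenius2 frob) P.

End EllipticCurves.

(** * Splittings and pairs of sublattices *)

Section Splittings.
Context {a b : rat} (p : nat).
Notation B := (quat a b).
Implicit Types (O : set B) (F : B) (f : 'M[B]_2) (I : set 'cV[B]_2).

Definition rank1_splitting O f f1 f2 :=
  [/\ integral_mx O f1 /\ integral_mx O f2, hermitian_mx f1 /\ hermitian_mx f2,
      has_rank f1 1 /\ has_rank f2 1 & f = f1 + f2].

Definition orthogonal_pair O f (I1 I2 : set 'cV[B]_2) :=
  [/\ sublattice O I1 /\ sublattice O I2,
      invertible O I1 /\ invertible O I2 & orthogonal f I1 I2].

(* The sum I1 + I2 is direct as soon as I1 and I2 are orthogonal with respect
   to a positive definite form. *)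
Definition quotient_condition O F (I1 I2 : set 'cV[B]_2) :=
  quotient_iso O (std_lattice O) (add_set I1 I2)
    O [set x | exists2 y, O y & x = F * y].

Definition norm_condition O f (I1 I2 : set 'cV[B]_2) :=
  primitive O I2 /\
  forall v, I1 v -> v != 0 ->
    exists2 r : nat, reduced_index I1 (principal O v) r &
      hform f v v = (p * r)%:R.

End Splittings.

(* Main.v *)
(* The algebra B is definite, so B is a division ring, and reduced norms decide
   membership in O: if x has integral norm and all traces of x O are integral,
   then O + x O is an order, so x lies in O by maximality.  This makes every
   right O-lattice J principal at each prime l, generated by any element whose
   norm has minimal l-adic valuation; in particular J is invertible.  As B is
   ramified at p, the norm is a valuation at p, so that F normalizes O and FO
   consists of the elements of norm divisible by p.

   An endomorphism of E^2 with the same kernel as Frobenius differs from F by a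
   unit: T f = F with T integral because f is an isogeny whose kernel is killed
   by F, and the entries of f lie in FO because E[F] has the nonzero point
   [eps : 1 : 0] over the dual numbers.  Hence f = F S with S in GL_2(O).

   Let I1 = c1 J1 and I2 = c2 J2 be orthogonal, with projections P1 and P2.
   Rank 1 splittings correspond to the integrality of f P1, which says that
   u |-> P1 u F maps L to I1.  Comparing f (v, -) on L with its restriction to
   I1, for v a local generator of I1, shows that L never equals the sum of I1
   and I2, and that h (v) = f (v, v) / p is a unit at l for every local generator
   v at l.  Since the index of x O in J1 is a constant times nrd(x)^2 and is prime
   to l at local generators, it equals h^2, which is the norm condition. *)

Require Import Defs.
From mathcomp Require Import all_boot all_order all_algebra ring lra zify.
From mathcomp Require Import all_classical reals.

Local Set Implicit Arguments.
Local Unset Strict Implicit.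
Import Order.TTheory GRing.Theory Num.Theory.
Local Open Scope ring_scope.

(** * Quaternions *)

(** Local arguments use no completed lattices: a local statement at [l] means that some multiple
    prime to [l] satisfies it, and [loc_global] glues these multipliers. The completion at [p]
    serves only to bound traces. If an element had [p]-integral norm but not [p]-integral trace, its
    reduced characteristic polynomial would have a root in the completion; in a division algebra the
    element would then be a scalar, for which the claim is clear. With maximality, the norm alone
    thus decides membership in [O] at [p].

    Dual numbers are forced: [E[F]] is infinitesimal, so its points over fields are trivial and say
    nothing about [f].

    Indices are computed without bases: multiplication by [k] has index [k ^ 4] on any lattice by
    comparison with the coordinate lattice, and [z O] and [qconj z O] have the same index because
    [z] and [qconj z] are conjugate in [B].

    Condition (iii) is symmetric in the two lines, (iii') is not: saturation of the first line has
    to be recovered from the norm identity, away from [p] through [F ^ 2 = - p] and at [p] by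
    comparing norms. *)

Section Quaternions.
Context {K : fieldType} {a b : K}.
Notation B := (quat a b).
Implicit Types x y z : B.

Definition sc (c : K) : B := quat_scalar c.
Definition nrd x : K :=
  qre x ^+ 2 - a * qi x ^+ 2 - b * qj x ^+ 2 + a * b * qk x ^+ 2.
Definition trd x : K := qre x *+ 2.
(* Locked, since rewriting with ring lemmas would otherwise unfold it. *)
Definition qinv x : B := locked (sc (nrd x)^-1 * qconj x).
Lemma qinvE x : qinv x = sc (nrd x)^-1 * qconj x.
Proof. by rewrite /qinv -lock. Qed.

Lemma quat_eq x y :
  qre x = qre y -> qi x = qi y -> qj x = qj y -> qk x = qk y -> x = y.
Proof. by case: x y => ? ? ? ? [? ? ? ?] /= -> -> -> ->. Qed.

Lemma qre0 : qre (0 : B) = 0. Proof. by []. Qed.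
Lemma qi0 : qi (0 : B) = 0. Proof. by []. Qed.
Lemma qj0 : qj (0 : B) = 0. Proof. by []. Qed.
Lemma qk0 : qk (0 : B) = 0. Proof. by []. Qed.
Lemma qre1 : qre (1 : B) = 1. Proof. by []. Qed.
Lemma qi1 : qi (1 : B) = 0. Proof. by []. Qed.
Lemma qj1 : qj (1 : B) = 0. Proof. by []. Qed.
Lemma qk1 : qk (1 : B) = 0. Proof. by []. Qed.
Lemma qreN x : qre (- x) = - qre x. Proof. by []. Qed.
Lemma qiN x : qi (- x) = - qi x. Proof. by []. Qed.
Lemma qjN x : qj (- x) = - qj x. Proof. by []. Qed.
Lemma qkN x : qk (- x) = - qk x. Proof. by []. Qed.
Lemma qreD x y : qre (x + y) = qre x + qre y. Proof. by []. Qed.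
Lemma qiD x y : qi (x + y) = qi x + qi y. Proof. by []. Qed.
Lemma qjD x y : qj (x + y) = qj x + qj y. Proof. by []. Qed.
Lemma qkD x y : qk (x + y) = qk x + qk y. Proof. by []. Qed.
Lemma qreM x y : qre (x * y) =
  qre x * qre y + a * (qi x * qi y) + b * (qj x * qj y)
          - a * b * (qk x * qk y).
Proof. by []. Qed.
Lemma qiM x y : qi (x * y) =
  qre x * qi y + qi x * qre y - b * (qj x * qk y) + b * (qk x * qj y).
Proof. by []. Qed.
Lemma qjM x y : qj (x * y) =
  qre x * qj y + qj x * qre y + a * (qi x * qk y) - a * (qk x * qi y).
Proof. by []. Qed.
Lemma qkM x y : qk (x * y) =
  qre x * qk y + qk x * qre y + qi x * qj y - qj x * qi y.
Proof. by []. Qed.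
Definition qE := (qre0, qi0, qj0, qk0, qre1, qi1, qj1, qk1,
  qreN, qiN, qjN, qkN, qreD, qiD, qjD, qkD, qreM, qiM, qjM, qkM).

Local Ltac qtac := apply: quat_eq; rewrite ?qE /=; ring.

Lemma scD c d : sc (c + d) = sc c + sc d. Proof. by qtac. Qed.
Lemma scN c : sc (- c) = - sc c. Proof. by qtac. Qed.
Lemma scM c d : sc (c * d) = sc c * sc d. Proof. by qtac. Qed.
Lemma sc0 : sc 0 = 0. Proof. by []. Qed.
Lemma sc1 : sc 1 = 1. Proof. by []. Qed.
Lemma scC c x : sc c * x = x * sc c. Proof. by qtac. Qed.
Lemma scn n : sc n%:R = n%:R.
Proof. by elim: n => // n IHn; rewrite -!natr1 scD IHn. Qed.
Lemma scMn n x : sc n%:R * x = x *+ n.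
Proof. by rewrite scn mulr_natl. Qed.
Lemma sc_inj : injective sc. Proof. by move=> c d []. Qed.
Lemma sc_eq0 c : (sc c == 0) = (c == 0).
Proof. by rewrite -(inj_eq sc_inj). Qed.

Lemma qconjD x y : qconj (x + y) = qconj x + qconj y. Proof. by qtac. Qed.
Lemma qconjN x : qconj (- x) = - qconj x. Proof. by qtac. Qed.
Lemma qconjB x y : qconj (x - y) = qconj x - qconj y. Proof. by qtac. Qed.
Lemma qconjM x y : qconj (x * y) = qconj y * qconj x. Proof. by qtac. Qed.
Lemma qconjK : involutive (@qconj K a b). Proof. by move=> x; qtac. Qed.
Lemma qconj_sc c : qconj (sc c) = sc c. Proof. by qtac. Qed.
Lemma qconj0 : qconj 0 = 0 :> B. Proof. by qtac. Qed.
Lemma qconj1 : qconj 1 = 1 :> B. Proof. by qtac. Qed.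
Lemma qconj_eq0 x : (qconj x == 0) = (x == 0).
Proof. by rewrite -{1}qconj0 (inj_eq (inv_inj qconjK)). Qed.
Lemma qconjMn x n : qconj (x *+ n) = qconj x *+ n.
Proof. by rewrite -!scMn qconjM qconj_sc scC. Qed.
Lemma qconj_sum (I : Type) (r : seq I) (P : pred I) (E : I -> B) :
  qconj (\sum_(i <- r | P i) E i) = \sum_(i <- r | P i) qconj (E i).
Proof. by elim/big_rec2: _ => [|i y z _ <-]; rewrite ?qconj0 ?qconjD. Qed.

Lemma mul_conj x : x * qconj x = sc (nrd x).
Proof. by rewrite /nrd; qtac. Qed.
Lemma conj_mul x : qconj x * x = sc (nrd x).
Proof. by rewrite /nrd; qtac. Qed.
Lemma addr_conj x : x + qconj x = sc (trd x).
Proof. by rewrite /trd; qtac. Qed.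
Lemma qconjE x : qconj x = sc (trd x) - x.
Proof. by rewrite -addr_conj addrC addKr. Qed.
Lemma quat_sqr x : x * x = sc (trd x) * x - sc (nrd x).
Proof. by rewrite -addr_conj -conj_mul mulrDl addrK. Qed.

Lemma nrd0 : nrd 0 = 0. Proof. by rewrite /nrd /=; ring. Qed.
Lemma nrd1 : nrd 1 = 1. Proof. by rewrite /nrd /=; ring. Qed.
Lemma nrdM x y : nrd (x * y) = nrd x * nrd y.
Proof. by rewrite /nrd !qE; ring. Qed.
Lemma nrd_sc c : nrd (sc c) = c ^+ 2.
Proof. by rewrite /nrd /=; ring. Qed.
Lemma nrd_conj x : nrd (qconj x) = nrd x.
Proof. by rewrite /nrd /=; ring. Qed.
Lemma nrdMn x n : nrd (x *+ n) = n%:R ^+ 2 * nrd x.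
Proof. by rewrite -scMn nrdM nrd_sc. Qed.
Lemma nrdD x y : nrd (x + y) = nrd x + nrd y + trd (x * qconj y).
Proof. by rewrite /nrd /trd !qE /=; ring. Qed.
Lemma trdMn x n : trd (x *+ n) = trd x *+ n.
Proof. by rewrite -scMn /trd !qE /=; ring. Qed.
(** A root [s] in [K] of the reduced characteristic polynomial splits it, and this factorization
    persists in the commutative ring [K[x]]. In a division ring it forces [x] to be a scalar. *)
Lemma quat_factor x s : s ^+ 2 - trd x * s + nrd x = 0 ->
  (x - sc s) * (x - sc (trd x - s)) = 0.
Proof.
move=> hs; have -> : (x - sc s) * (x - sc (trd x - s)) =
    x * x - sc (trd x) * x + sc (s * (trd x - s)).
  by move: (trd x) => t; apply: quat_eq; rewrite ?qE /sc /=; ring.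
have -> : s * (trd x - s) = nrd x.
  by apply/eqP; rewrite -subr_eq0 -oppr_eq0; apply/eqP; rewrite -[RHS]hs; ring.
by rewrite quat_sqr [sc _ * x - _]addrC addrK addNr.
Qed.

End Quaternions.

(** * Definite algebras are division rings *)

Section Definite.
Context {a b : rat} (an : a < 0) (bn : b < 0).
Notation B := (quat a b).
Implicit Types x y z : B.

Lemma nrd_ge0 x : 0 <= nrd x.
Proof.
rewrite /nrd !addr_ge0 ?sqr_ge0 //.
- by rewrite oppr_ge0 mulr_le0_ge0 ?sqr_ge0 ?ltW.
- by rewrite oppr_ge0 mulr_le0_ge0 ?sqr_ge0 ?ltW.
- by rewrite mulr_ge0 ?sqr_ge0 // ltW // nmulr_rgt0.
Qed.

Lemma nrd_gt0 x : x != 0 -> 0 < nrd x.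
Proof.
move=> xn0; rewrite lt_neqAle nrd_ge0 andbT eq_sym; apply: contra xn0.
have h1 : 0 <= qre x ^+ 2 by exact: sqr_ge0.
have h2 : 0 <= - a * qi x ^+ 2 by rewrite mulr_ge0 ?sqr_ge0 // oppr_ge0 ltW.
have h3 : 0 <= - b * qj x ^+ 2 by rewrite mulr_ge0 ?sqr_ge0 // oppr_ge0 ltW.
have h4 : 0 <= a * b * qk x ^+ 2
  by rewrite mulr_ge0 ?sqr_ge0 // ltW // nmulr_rgt0.
rewrite /nrd => /eqP h.
have e1 : qre x ^+ 2 = 0 by lra.
have e2 : - a * qi x ^+ 2 = 0 by lra.
have e3 : - b * qj x ^+ 2 = 0 by lra.
have e4 : a * b * qk x ^+ 2 = 0 by lra.
move/eqP: e1; rewrite sqrf_eq0 => /eqP e1.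
move/eqP: e2; rewrite mulf_eq0 oppr_eq0 (lt_eqF an) sqrf_eq0 => /eqP e2.
move/eqP: e3; rewrite mulf_eq0 oppr_eq0 (lt_eqF bn) sqrf_eq0 => /eqP e3.
move/eqP: e4; rewrite !mulf_eq0 (lt_eqF an) (lt_eqF bn) /= orbb => /eqP e4.
by apply/eqP; apply: quat_eq; rewrite qE ?(e1, e2, e3, e4).
Qed.

Lemma nrd_eq0 x : (nrd x == 0) = (x == 0).
Proof.
apply/idP/eqP => [|->]; last by rewrite nrd0.
by move=> /eqP h; apply/eqP; apply: contraT => /nrd_gt0; rewrite h ltxx.
Qed.

Lemma qmulV x : x != 0 -> x * qinv x = 1.
Proof.
move=> xn0; rewrite qinvE mulrA -scC -mulrA mul_conj -scM mulVf ?sc1 //.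
by rewrite nrd_eq0.
Qed.
Lemma qmulVr x : x != 0 -> qinv x * x = 1.
Proof.
move=> xn0; rewrite qinvE -mulrA conj_mul -scM mulVf ?sc1 //.
by rewrite nrd_eq0.
Qed.
Lemma qmulKV x y : x != 0 -> x * (qinv x * y) = y.
Proof. by move=> h; rewrite mulrA qmulV ?mul1r. Qed.
Lemma qmulVK x y : x != 0 -> qinv x * (x * y) = y.
Proof. by move=> h; rewrite mulrA qmulVr ?mul1r. Qed.
Lemma qmul_eq0 x y : (x * y == 0) = (x == 0) || (y == 0).
Proof. by rewrite -!nrd_eq0 nrdM mulf_eq0. Qed.
Lemma qinv_eq0 x : (qinv x == 0) = (x == 0).
Proof.
by rewrite qinvE qmul_eq0 qconj_eq0 sc_eq0 invr_eq0 nrd_eq0 orbb.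
Qed.
Lemma nrdV x : nrd (qinv x) = (nrd x)^-1.
Proof.
have [->|xn0] := eqVneq x 0.
  by rewrite qinvE qconj0 mulr0 nrd0 invr0.
rewrite qinvE nrdM nrd_sc nrd_conj expr2 -mulrA mulVf ?mulr1 //.
by rewrite nrd_eq0.
Qed.
Lemma qmulI x y z : x != 0 -> x * y = x * z -> y = z.
Proof. by move=> h e; rewrite -(qmulVK y h) e qmulVK. Qed.

(* The commutator of x with y anticommutes with the imaginary part of x. *)
Lemma conj_conjugate x : exists2 u : B, u != 0 & u * x = qconj x * u.
Proof.
pose comm y := x * y - y * x.
have commP y : comm y * x = qconj x * comm y.
  by apply: quat_eq; rewrite /comm !qE /=; ring.
case: (eqVneq (comm (Quat 0 1 0 0)) 0) => [ci|ci]; last by exists (comm (Quat 0 1 0 0)).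
case: (eqVneq (comm (Quat 0 0 1 0)) 0) => [cj|cj]; last by exists (comm (Quat 0 0 1 0)).
(* Commuting with both [i] and [j] makes [x] a scalar, which is its own conjugate. *)
exists 1; first exact: oner_neq0.
rewrite mul1r mulr1; move: ci cj; case: x @comm commP => x0 x1 x2 x3 comm _.
have a0 : a != 0 by rewrite lt_eqF.
have b0 : b != 0 by rewrite lt_eqF.
move=> h h'.
have e3 := congr1 (@qj _ _ _) h; have e2 := congr1 (@qk _ _ _) h.
have e1 := congr1 (@qk _ _ _) h'.
move: e1 e2 e3; rewrite !qE /= => e1 e2 e3.
apply: quat_eq => //=.
- lra.
- lra.
- have : a * x3 = 0 by lra.
  by move/eqP; rewrite mulf_eq0 (negbTE a0) => /eqP ->; rewrite oppr0.
Qed.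
End Definite.

(** * Localization of abelian groups at a prime *)

Section LocalGlobal.
Context {V : zmodType}.
Implicit Types (A : V -> Prop) (x y : V).

Definition zmod_set A := A 0 /\ forall x y, A x -> A y -> A (x - y).

(* The localization of A at the prime l. *)
Definition loc (l : nat) A x := exists2 m : nat, ~~ (l %| m)%N & A (x *+ m).

Section ZmodSet.
Context (A : V -> Prop) (hA : zmod_set A).

Lemma zs0 : A 0. Proof. by case: hA. Qed.
Lemma zsB x y : A x -> A y -> A (x - y). Proof. by case: hA => _; apply. Qed.
Lemma zsN x : A x -> A (- x).
Proof. by rewrite -sub0r; apply: zsB; exact: zs0. Qed.
Lemma zsD x y : A x -> A y -> A (x + y).
Proof. by move=> hx /zsN hy; rewrite -[y]opprK; exact: zsB. Qed.
Lemma zsMn x n : A x -> A (x *+ n).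
Proof.
move=> hx; elim: n => [|n IHn]; first by rewrite mulr0n; exact: zs0.
by rewrite mulrSr; exact: zsD.
Qed.
Lemma zsMz x (z : int) : A x -> A (x *~ z).
Proof.
by move=> hx; case: z => n; [exact: zsMn | rewrite NegzE mulrNz; apply/zsN/zsMn].
Qed.
Lemma zs_sum (I : Type) (r : seq I) (P : pred I) (E : I -> V) :
  (forall i, P i -> A (E i)) -> A (\sum_(i <- r | P i) E i).
Proof. by move=> h; elim/big_rec: _ => [|i x Pi Ax]; [exact: zs0 | apply: zsD; auto]. Qed.

Lemma zs_gcd x m n : A (x *+ m) -> A (x *+ n) -> A (x *+ gcdn m n).
Proof.
move=> hm hn; have [->|m_gt0] := posnP m; first by rewrite gcd0n.
case: (egcdnP n m_gt0) => km kn e _.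
have -> : x *+ gcdn m n = x *+ m *+ km - x *+ n *+ kn.
  by rewrite -!mulrnA (mulnC m) (mulnC n) e mulrnDr addrC addKr.
by apply: zsB; exact: zsMn.
Qed.

(** The multipliers sending [x] into [A] are closed under gcd. As long as one of them exceeds 1, a
    multiplier prime to its least prime divisor yields a strictly smaller gcd. *)
Lemma loc_global x : (forall l, prime l -> loc l A x) -> A x.
Proof.
(* The prime 2 only supplies a positive multiplier from which the descent starts. *)
move=> h; have [m0 m0P Am0] := h 2 isT.
have m0_gt0 : (0 < m0)%N by case: m0 m0P {Am0}.
have [n] := ubnP m0; elim: n => // n IHn in m0 m0P m0_gt0 Am0 *.
move=> ltm; case: (ltnP 1 m0) => [m0_gt1|]; last first.
  by move: m0_gt0 Am0; case: m0 {m0P ltm} => [|[|?]].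
have [m mP Am] := h _ (pdiv_prime m0_gt1).
pose g := gcdn m0 m.
have gm : (g %| m0)%N by exact: dvdn_gcdl.
have g_gt0 : (0 < g)%N by rewrite gcdn_gt0 m0_gt0.
apply: (IHn g) => //.
- by apply: contra m0P => /dvdn_trans; apply.
- exact: zs_gcd.
- have : g != m0.
    apply: contra mP => /eqP e; apply: dvdn_trans (pdiv_dvd m0) _.
    by rewrite -e; exact: dvdn_gcdr.
  by move: (dvdn_leq m0_gt0 gm); lia.
Qed.

Lemma loc_zmod l : prime l -> zmod_set (loc l A).
Proof.
move=> lP; split=> [|x y [m mP hm] [n nP hn]].
  by exists 1; [rewrite dvdn1 neq_ltn prime_gt1 ?orbT | exact: zs0].
exists (m * n)%N; first by rewrite Euclid_dvdM // negb_or mP.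
by rewrite mulrnBl; apply: zsB; [|rewrite mulnC]; rewrite mulrnA; exact: zsMn.
Qed.

Lemma loc_sub l x : prime l -> A x -> loc l A x.
Proof.
by move=> lP hx; exists 1 => //; rewrite dvdn1 neq_ltn prime_gt1 ?orbT.
Qed.

Lemma common_multiple n (x : 'I_n -> V) :
    (forall i, exists2 m : nat, (0 < m)%N & A (x i *+ m)) ->
  exists2 m : nat, (0 < m)%N & forall i, A (x i *+ m).
Proof.
move=> /(_ _)/cid2-/all_sig2[m m_gt0 hm]; exists (\prod_i m i)%N.
  by rewrite prodn_gt0.
by move=> i; rewrite (bigD1 i) //= mulrnA; exact: zsMn.
Qed.

End ZmodSet.

Lemma split_multiple (l N : nat) : prime l -> (0 < N)%N ->
  exists2 m, ~~ (l %| m)%N & N = (m * l ^ logn l N)%N.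
Proof.
move=> lP N_gt0; exists (N`_l^')%N.
  by rewrite -prime_coprime // (@pnat_coprime l) ?part_pnat ?pnat_id.
by rewrite mulnC -p_part partnC.
Qed.

Lemma loc_both A (hA : zmod_set A) l k x :
  prime l -> A (x *+ l ^ k) -> loc l A x -> A x.
Proof.
move=> lP h1 [m mP h2].
have := zs_gcd hA h1 h2; suff -> : gcdn (l ^ k) m = 1 by [].
by apply/eqP; rewrite -/(coprime _ _) coprimeXl // prime_coprime.
Qed.

End LocalGlobal.

(** * Integral and [l]-integral rationals *)

Section RationalIntegers.
Implicit Types q r : rat.

Definition isint q : Prop := q \is a Num.int.

Lemma isint_zmod : zmod_set isint.
Proof. by split=> [|x y]; rewrite /isint ?rpred0 //; exact: rpredB. Qed.

Lemma isint_pow q (C : nat) : (0 < C)%N ->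
  (forall k, isint (q ^+ k *+ C)) -> isint q.
Proof.
(* The exponent [C] suffices: [denq q ^ C] is then a divisor of [C], whereas [d ^ C > C] for every
   [d > 1]. *)
move=> C_gt0 h; have /intrP[z ez] := h C.
have d_neq0 : (denq q)%:~R != 0 :> rat by rewrite intr_eq0 denq_neq0.
have e : numq q ^+ C * C%:Z = z * denq q ^+ C.
  apply/eqP; rewrite -(eqr_int rat) !rmorphM !rmorphXn /= -ez -mulr_natr.
  by rewrite mulrAC -exprMn -numqE.
have : (denq q ^+ C %| numq q ^+ C * C%:Z)%Z by rewrite e dvdz_mull.
rewrite Gauss_dvdzr; last first.
  rewrite coprimezXl // coprimezXr // coprimez_sym.
  exact: coprime_num_den.
rewrite dvdzE abszX /= => /(dvdn_leq C_gt0) h2.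
have : (`|denq q| <= 1)%N.
  rewrite leqNgt; apply/negP => d_gt1.
  have := leq_trans (ltn_expl C d_gt1) h2; lia.
move=> d_le1; have d1 : denq q = 1.
  by have := denq_gt0 q; move: d_le1; lia.
by rewrite /isint -[q]divq_num_den d1 divr1 rpred_int.
Qed.

Lemma isint_den q : exists2 m : nat, (0 < m)%N & isint (q *+ m).
Proof.
exists `|denq q|%N; first by rewrite absz_gt0 denq_neq0.
rewrite -mulr_natr natr_absz gtr0_norm ?denq_gt0 // -numqE.
exact: rpred_int.
Qed.

Lemma isint_natr n : isint n%:R.
Proof. by rewrite /isint rpred_nat. Qed.

Lemma isint_nat q : isint q -> 0 <= q -> exists n : nat, q = n%:R.
Proof. by move=> h1 h2; apply/natrP; rewrite natrEint h2 andbT. Qed.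

Lemma isint_dvd (l k : nat) q : prime l -> isint q ->
  k%:R = q * l%:R -> (l %| k)%N.
Proof.
move=> lP /intrP[z ->] /eqP; rewrite -[l%:R]/(l%:Z%:~R) -[k%:R]/(k%:Z%:~R).
rewrite -rmorphM /= eqr_int => /eqP e.
by have : (l%:Z %| k%:Z)%Z by rewrite e dvdz_mull.
Qed.

Lemma loc_isintM l q r : prime l -> loc l isint q -> loc l isint r ->
  loc l isint (q * r).
Proof.
move=> lP [m mP hm] [n nP hn]; exists (m * n)%N.
  by rewrite Euclid_dvdM // negb_or mP.
by rewrite mulrnA -mulrnAl -mulrnAr; exact: rpredM.
Qed.

Lemma loc_isint_sqr l q : prime l -> loc l isint (q ^+ 2) -> loc l isint q.
Proof.
move=> lP [m mP hm]; exists m => //.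
have {hm} h : isint ((q *+ m) ^+ 2).
  by rewrite exprMn_n mulrnA; apply: (zsMn isint_zmod); exact: hm.
have [d d_gt0 hd] := isint_den (q *+ m).
(* Every power of [q *+ m] is an integer times at most one factor [q *+ m], so [d] clears its
   denominator. *)
apply: (isint_pow d_gt0) => k; rewrite -(odd_double_half k) exprD -mul2n exprM.
rewrite -mulrnAl; apply: rpredM; last exact: rpredX.
case: (odd k); first by rewrite expr1.
by rewrite expr0; exact: rpred_nat.
Qed.

End RationalIntegers.

(** * Orders *)

Section Orders.
Context {a b : rat} {O : set (quat a b)}.
Notation B := (quat a b).
Implicit Types x y z : B.

Section IsOrder.
Context (hO : is_order O).

Lemma order_zmod : zmod_set O.
Proof.
case: hO => -[O1 OB OM] _ _; split=> [|x y]; last exact: OB.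
by rewrite -(subrr 1); exact: OB.
Qed.
Lemma order1 : O 1. Proof. by case: hO => -[]. Qed.
Lemma orderM x y : O x -> O y -> O (x * y).
Proof. by case: hO => -[_ _ h] _ _; exact: h. Qed.
Lemma order_nat n : O n%:R.
Proof. by apply: (zsMn order_zmod n); exact: order1. Qed.
Lemma order_int (z : int) : O (sc z%:~R).
Proof.
rewrite (_ : sc _ = 1 *~ z); first by apply: (zsMz order_zmod z); exact: order1.
by case: z => n; rewrite ?NegzE ?mulrNz ?scN scn.
Qed.
Lemma order_scint q : isint q -> O (sc q).
Proof. by move=> /intrP[z ->]; exact: order_int. Qed.
Lemma order_multiple x : exists2 m : nat, (0 < m)%N & O (x *+ m).
Proof. by case: hO => _ _; exact. Qed.

Definition coord_int x : Prop :=
  [/\ isint (qre x), isint (qi x), isint (qj x) & isint (qk x)].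

Lemma coord_int_zmod : zmod_set coord_int.
Proof.
split; first by split; exact: zs0 isint_zmod.
by move=> x y [? ? ? ?] [? ? ? ?]; split; exact: (zsB isint_zmod).
Qed.

Lemma coord_int_multiple x : exists2 m : nat, (0 < m)%N & coord_int (x *+ m).
Proof.
have [m1 p1 h1] := isint_den (qre x); have [m2 p2 h2] := isint_den (qi x).
have [m3 p3 h3] := isint_den (qj x); have [m4 p4 h4] := isint_den (qk x).
exists (m1 * m2 * m3 * m4)%N; first by rewrite !muln_gt0 p1 p2 p3.
have e (q : rat) m n : isint (q *+ m) -> isint (n%:R * q *+ m).
  by rewrite -mulrnAr mulr_natl => h; exact: (zsMn isint_zmod).
have c m : [/\ qre (x *+ m) = m%:R * qre x, qi (x *+ m) = m%:R * qi x,
               qj (x *+ m) = m%:R * qj x & qk (x *+ m) = m%:R * qk x].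
  by rewrite -scMn; split; rewrite !qE /=; ring.
case: (c (m1 * m2 * m3 * m4)%N) => e1 e2 e3 e4; split.
- rewrite e1 (_ : _%:R * _ = (m2 * m3 * m4)%:R * qre x *+ m1); first exact: e.
  by rewrite -mulrnAl -mulrnA; congr (1 *+ _ * _); lia.
- rewrite e2 (_ : _%:R * _ = (m1 * m3 * m4)%:R * qi x *+ m2); first exact: e.
  by rewrite -mulrnAl -mulrnA; congr (1 *+ _ * _); lia.
- rewrite e3 (_ : _%:R * _ = (m1 * m2 * m4)%:R * qj x *+ m3); first exact: e.
  by rewrite -mulrnAl -mulrnA; congr (1 *+ _ * _); lia.
- rewrite e4 (_ : _%:R * _ = (m1 * m2 * m3)%:R * qk x *+ m4); first exact: e.
  by rewrite -mulrnAl -mulrnA; congr (1 *+ _ * _); lia.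
Qed.

Lemma order_coord_bounded :
  exists2 N : nat, (0 < N)%N & forall x, O x -> coord_int (x *+ N).
Proof.
case: hO => _ [n [e he]] _.
have [N N_gt0 hN] := common_multiple coord_int_zmod (fun i => coord_int_multiple (e i)).
exists N => // x /he[z ->]; rewrite -sumrMnl.
apply: (zs_sum coord_int_zmod) => i _; rewrite pmulrn mulrzAC -pmulrn.
exact: (zsMz coord_int_zmod).
Qed.

(* The powers of x have bounded denominators, hence so do those of its norm. *)
Lemma order_nrd x : O x -> isint (nrd x).
Proof.
have [N N_gt0 hN] := order_coord_bounded.
(* The norm form has coefficients [a], [b] and [a * b]; [da * db] clears them, and [N ^ 2] clears
   the squared coordinates. *)
have [da da_gt0 hda] := isint_den a; have [db db_gt0 hdb] := isint_den b.
have hC y : O y -> isint (nrd y *+ (da * db * N ^ 2)).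
  move=> /hN[h0 h1 h2 h3]; rewrite mulnC mulrnA -[nrd y *+ _]mulr_natl natrX -nrdMn.
  rewrite -[_ *+ (da * db)]mulr_natr natrM /nrd.
  set u := y *+ N in h0 h1 h2 h3 *.
  rewrite (_ : _ * _ = qre u ^+ 2 *+ da *+ db - (a *+ da) * qi u ^+ 2 *+ db
     - (b *+ db) * qj u ^+ 2 *+ da + (a *+ da) * (b *+ db) * qk u ^+ 2); last by ring.
  have X (q : rat) : isint q -> isint (q ^+ 2) by move=> ?; exact: rpredX.
  apply: (zsD isint_zmod); last by apply: rpredM; [exact: rpredM | exact: X].
  apply: (zsB isint_zmod); last first.
    by apply: (zsMn isint_zmod); apply: rpredM => //; exact: X.
  apply: (zsB isint_zmod); last first.
    by apply: (zsMn isint_zmod); apply: rpredM => //; exact: X.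
  by do 2![apply: (zsMn isint_zmod)]; exact: X.
move=> Ox; apply: (@isint_pow _ (da * db * N ^ 2)%N).
  by rewrite !muln_gt0 da_gt0 db_gt0 ?N_gt0.
move=> k; have -> : nrd x ^+ k = nrd (x ^+ k).
  by elim: k => [|k IHk]; rewrite ?expr0 ?nrd1 // !exprS nrdM IHk.
apply: hC; elim: k => [|k IHk]; first exact: order1.
by rewrite exprS; exact: orderM.
Qed.

Lemma order_trd x : O x -> isint (trd x).
Proof.
move=> Ox; have : isint (nrd (x + 1) - nrd x - 1).
  have h : O (x + 1) by apply: (zsD order_zmod) => //; exact: order1.
  by rewrite /isint !rpredB ?rpred1 //; exact: order_nrd.
by rewrite nrdD nrd1 qconj1 mulr1 (_ : _ - _ - _ = trd x) //; ring.
Qed.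

Lemma order_conj x : O x -> O (qconj x).
Proof.
move=> Ox; rewrite qconjE; apply: (zsB order_zmod) => //.
exact/order_scint/order_trd.
Qed.

Lemma order_sc q : O (sc q) -> isint q.
Proof.
move=> /order_nrd; rewrite nrd_sc => h; have [d d_gt0 hd] := isint_den q.
apply: (isint_pow d_gt0) => k; rewrite -(odd_double_half k) exprD -mul2n exprM.
rewrite -mulrnAl; apply: rpredM; last exact: rpredX.
case: (odd k); first by rewrite expr1.
by rewrite expr0; exact: rpred_nat.
Qed.

End IsOrder.

(* The hypotheses make O + x O an order. *)
Lemma maximal_order_mem x : maximal_order O ->
  isint (nrd x) -> (forall c, O c -> isint (trd (x * c))) -> O x.
Proof.
move=> [hO maxO] nx tx; have Oz := order_zmod hO; have O1 := order1 hO.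
pose X : set B := [set y | exists c d, [/\ O c, O d & y = c + x * d]]%classic.
(* Expand [trd (x * qconj c) = x * qconj c + c * qconj x] with [qconj x = trd x - x]: this moves [x]
   from the right of [c] to the left of [qconj c], up to elements of [O]. *)
have left_mul c : O c -> X (c * x).
  move=> Oc; exists (sc (trd x) * c - sc (trd (x * qconj c))), (qconj c).
  split; last first.
  - by apply: quat_eq; rewrite /trd /sc !qE /=; ring.
  - exact: order_conj.
  apply: (zsB Oz); last by apply: order_scint => //; apply: tx; exact: order_conj.
  apply: orderM => //; apply: order_scint => //; rewrite -[x]mulr1; exact: tx.
have XM y c : X y -> O c -> X (y * c).
  move=> [u [v [Ou Ov ->]]] Oc; exists (u * c), (v * c).
  by rewrite mulrDl mulrA; split=> //; exact: orderM.
have XD y z : X y -> X z -> X (y + z).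
  move=> [u [v [Ou Ov ->]]] [u' [v' [Ou' Ov' ->]]].
  exists (u + u'), (v + v'); split; try exact: (zsD Oz).
  by rewrite mulrDr addrACA.
have XN y : X y -> X (- y).
  move=> [u [v [Ou Ov ->]]]; exists (- u), (- v); split; try exact: (zsN Oz).
  by rewrite mulrN opprD.
have OX c : O c -> X c.
  by move=> Oc; exists c, 0; rewrite mulr0 addr0; split=> //; exact: zs0.
have xX y : X y -> X (x * y).
  move=> [u [v [Ou Ov ->]]]; rewrite mulrDr; apply: XD.
    by exists 0, u; rewrite add0r; split=> //; exact: zs0.
  rewrite mulrA quat_sqr; apply: (XM) => //.
  exists (- sc (nrd x)), (sc (trd x)); split; last by rewrite addrC scC.
    by apply: (zsN Oz); exact: order_scint.
  by apply: order_scint => //; rewrite -[x]mulr1; exact: tx.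
have cX c y : O c -> X y -> X (c * y).
  move=> Oc [u [v [Ou Ov ->]]]; rewrite mulrDr; apply: XD.
    by apply: OX; exact: orderM.
  by rewrite mulrA; apply: XM => //; exact: left_mul.
suff oX : is_order X.
  by apply: (maxO X) => //; exists 0, 1; rewrite mulr1 add0r; split=> //; exact: zs0.
split.
- split; first exact: OX.
  + by move=> y z Xy /XN; exact: XD.
  + move=> y z [u [v [Ou Ov ->]]] Xz; rewrite mulrDl; apply: XD; first exact: cX.
    by rewrite -mulrA; apply: xX; exact: cX.
- case: hO => _ [n [e he]] _.
  exists (n + n)%N, (fun i : 'I_(n + n) =>
    match fintype.split i with inl j => e j | inr j => x * e j end).
  move=> y; split=> [[u [v [/he[z1 ->] /he[z2 ->] ->]]]|[z ->]].
    exists (fun i : 'I_(n + n) => match fintype.split i with inl j => z1 j | inr j => z2 j end).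
    rewrite big_split_ord /= mulr_sumr; congr (_ + _); apply: eq_bigr => i _.
      by rewrite (unsplitK (inl i)).
    by rewrite (unsplitK (inr i)) mulrzAr.
  rewrite big_split_ord /=; apply: XD.
    apply: OX; apply/he; exists (fun i => z (lshift n i)).
    by apply: eq_bigr => i _; rewrite (unsplitK (inl i)).
  exists 0, (\sum_i e i *~ z (rshift n i)); split; first exact: zs0.
    by apply/he; exists (fun i => z (rshift n i)).
  rewrite add0r mulr_sumr; apply: eq_bigr => i _.
  by rewrite (unsplitK (inr i)) mulrzAr.
- move=> y; have [m m_gt0 hm] := order_multiple hO y.
  by exists m => //; exact: OX.
Qed.

End Orders.

(** * Ramification and reduced traces *)

Section Ramification.

Lemma division_ring_mul_eq0 (B : nzRingType) (x y : B) :
  division_ring B -> x * y = 0 -> x = 0 \/ y = 0.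
Proof.
move=> dB xy0; have [|xn0] := eqVneq x 0; [by left | right].
by have [z _ zx] := dB _ xn0; rewrite -[y]mul1r -zx -mulrA xy0 mulr0.
Qed.

(** A nonnegative [a] has a real square root [r], and then [(i - r) * (i + r) = 0]; likewise with
    [j] for [b]. *)
Lemma ramified_at_infinity_neg (a b : rat) :
  ramified_at_infinity a b -> a < 0 /\ b < 0.
Proof.
case=> R; set A := ratr a; set C := ratr b => dR.
have sqr_root (x : rat) : 0 <= x -> Num.sqrt (ratr x : R) * Num.sqrt (ratr x) = ratr x.
  by move=> h; rewrite -expr2 sqr_sqrtr // ler0q.
split; rewrite ltNge; apply/negP => /sqr_root; set r := Num.sqrt _ => hr.
- have xy : (Quat (- r) 1 0 0 : quat A C) * Quat r 1 0 0 = 0.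
    by apply: quat_eq => /=; rewrite ?mulNr ?hr -/A -/C; ring.
  by case: (division_ring_mul_eq0 dR xy) => -[_ /eqP]; rewrite oner_eq0.
- have xy : (Quat (- r) 0 1 0 : quat A C) * Quat r 0 1 0 = 0.
    by apply: quat_eq => /=; rewrite ?mulNr ?hr -/A -/C; ring.
  by case: (division_ring_mul_eq0 dR xy) => -[_ /eqP]; rewrite oner_eq0.
Qed.

(** * Norms and traces over a completion of the rationals *)

Section Padic.
Context {l : nat} (lP : prime l).

Lemma coprime_num_denN (q : rat) : (l %| `|denq q|)%N -> (l %| `|numq q|)%N -> False.
Proof.
move=> h1 h2; have : (l %| gcdn `|numq q| `|denq q|)%N by rewrite dvdn_gcd h2.
by rewrite (eqP (coprime_num_den q)) dvdn1 => /eqP l1; move: lP; rewrite l1.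
Qed.

Lemma loc_isintE (q : rat) : loc l isint q <-> ~~ (l %| `|denq q|)%N.
Proof.
split=> [[m mP /intrP[z ez]]|h]; last first.
  exists `|denq q|%N => //.
  rewrite -mulr_natr natr_absz gtr0_norm ?denq_gt0 // -numqE.
  exact: rpred_int.
apply: contra mP => h.
have e : numq q * m%:Z = z * denq q.
  apply/eqP; rewrite -(eqr_int rat) !rmorphM /= -ez -mulr_natr numqE.
  by rewrite mulrAC.
have : (l %| `|numq q| * m)%N.
  by rewrite -[m]/(`|m%:Z|%N) -abszM e abszM dvdn_mull.
by rewrite Euclid_dvdM // => /orP[/(coprime_num_denN h)|].
Qed.

Lemma padic_norm_le1 (q : rat) : loc l isint q -> padic_norm l q <= 1.
Proof.
move=> /loc_isintE h; rewrite /padic_norm; case: eqP => // _.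
have l_gt0 := prime_gt0 lP.
rewrite ler_pdivrMr ?mul1r ?exprn_gt0 ?ltr0n //.
rewrite (_ : logn l _ = 0); first by rewrite expr0 exprn_ege1 // ler1n.
by apply/eqP; rewrite lognE lP absz_gt0 denq_neq0 (negbTE h).
Qed.

(** The values of the norm are powers of [l], so none lies strictly between 1 and 2. This gap
    provides the contraction in [padic_root]. *)
Lemma padic_norm_ge2 (q : rat) : ~ loc l isint q -> 2 <= padic_norm l q.
Proof.
move=> nl; have h : (l %| `|denq q|)%N by apply: contra_notT nl => /loc_isintE.
rewrite /padic_norm; case: eqP => [q0|_].
  by case: nl; rewrite q0; apply: loc_sub => //; exact: zs0 isint_zmod.
have -> : logn l `|numq q| = 0.
  apply/eqP; rewrite lognE lP; case: ifP => // /and3P[_ _ h2].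
  by case: (coprime_num_denN h h2).
rewrite expr0 divr1; have: (0 < logn l `|denq q|)%N.
  by rewrite logn_gt0 mem_primes lP h absz_gt0 denq_neq0.
case: (logn _ _) => // n _; rewrite -natrX ler_nat.
by apply: leq_trans (prime_gt1 lP) _; rewrite expnS leq_pmulr ?expn_gt0 ?prime_gt0.
Qed.

Context {K : fieldType} {v : K -> rat} (vK : padic_completion l v).
Implicit Types x y s : K.

Let v0 : v 0 = 0. Proof. by apply/(padic_eq0 vK). Qed.
Let vM x y : v (x * y) = v x * v y. Proof. exact: (padicM vK). Qed.
Let vD x y : v (x + y) <= Num.max (v x) (v y). Proof. exact: (padicD vK). Qed.

Lemma padic_norm1 (q : rat) : `|numq q|%N = 1%N -> denq q = 1 -> padic_norm l q = 1.
Proof.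
move=> h1 h2; rewrite /padic_norm h1 h2 !logn1 expr0 divr1; case: eqP => // q0.
by move: h1; rewrite q0.
Qed.

Let v1 : v 1 = 1.
Proof. by rewrite -[1]/(1%:R) -ratr_nat (padic_rat vK) padic_norm1. Qed.

Let vN x : v (- x) = v x.
Proof.
rewrite -mulN1r vM; have -> : v (-1) = 1; last by rewrite mul1r.
rewrite (_ : -1 = ratr (-1)); first by rewrite (padic_rat vK) padic_norm1.
by rewrite -[-1 in RHS]/((-1)%:~R) ratr_int.
Qed.

Let v_ge0 x : 0 <= v x.
Proof. by have := vD x (- x); rewrite subrr v0 vN maxxx. Qed.

Let v_eq0 x : (v x == 0) = (x == 0).
Proof. by apply/eqP/eqP => /(padic_eq0 vK). Qed.

Let v_small x y e : v x < e -> v y < e -> v (x + y) < e.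
Proof. by move=> hx hy; apply: le_lt_trans (vD x y) _; rewrite gt_max hx. Qed.

Let v_dom x y : v y < v x -> v (x + y) = v x.
Proof.
move=> h; apply: le_anti; apply/andP; split.
  by have := vD x y; rewrite (max_idPl (ltW h)).
by have := vD (x + y) (- y); rewrite addrK vN le_max leNgt [v x <= v y]leNgt h orbF -leNgt.
Qed.

Let vV x : x != 0 -> v x^-1 = (v x)^-1.
Proof.
move=> xn0; apply: (@mulfI _ (v x)); first by rewrite v_eq0.
by rewrite -vM !divff ?v1 // v_eq0.
Qed.

Lemma padic_natr_neq0 n : (0 < n)%N -> n%:R != 0 :> K.
Proof.
move=> n_gt0; rewrite -v_eq0 -ratr_nat (padic_rat vK) /padic_norm.
rewrite pnatr_eq0 eqn0Ngt n_gt0 /= mulf_neq0 // ?invr_eq0 expf_neq0 //.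
  by rewrite pnatr_eq0 -lt0n prime_gt0.
by rewrite pnatr_eq0 -lt0n prime_gt0.
Qed.

Let intr_neq0 (z : int) : z != 0 -> z%:~R != 0 :> K.
Proof.
case: z => n; first by move=> h; apply: padic_natr_neq0; rewrite lt0n.
by move=> _; rewrite NegzE mulrNz oppr_eq0; exact: (@padic_natr_neq0 n.+1 isT).
Qed.

(** [K] carries no order, so that [ratr] respects sums and products is derived from the nonvanishing
    of nonzero integers in [K], itself read off from [v]. *)
Let ratr_div (m d : int) : d != 0 -> ratr (m%:~R / d%:~R) = m%:~R / d%:~R :> K.
Proof.
move=> dn0; rewrite /ratr; set q := _ / _.
apply/eqP; rewrite eqr_div ?intr_neq0 ?denq_neq0 // -!rmorphM /=.
apply/eqP; congr (_%:~R); apply/eqP; rewrite -(eqr_int rat) !rmorphM /= numqE.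
by rewrite /q mulrAC divfK // intr_eq0.
Qed.

Let ratr_add (q r : rat) : ratr (q + r) = ratr q + ratr r :> K.
Proof.
have h (x : rat) : (denq x)%:~R != 0 :> rat by rewrite intr_eq0 denq_neq0.
rewrite -{1}[q]divq_num_den -{1}[r]divq_num_den addf_div //.
rewrite -!rmorphM -rmorphD ratr_div ?mulf_neq0 ?denq_neq0 //.
by rewrite rmorphD !rmorphM /= -addf_div // intr_neq0 ?denq_neq0.
Qed.

Let ratr_mul (q r : rat) : ratr (q * r) = ratr q * ratr r :> K.
Proof.
rewrite -{1}[q]divq_num_den -{1}[r]divq_num_den mulf_div.
rewrite -!rmorphM ratr_div ?mulf_neq0 ?denq_neq0 //.
by rewrite !rmorphM /= -mulf_div.
Qed.

Let ratr_opp (q : rat) : ratr (- q) = - ratr q :> K.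
Proof. by rewrite /ratr numqN denqN rmorphN mulNr. Qed.

(* The root of larger norm is the limit of the iterates of s |-> T - N / s. *)
Lemma padic_root (T N : K) : 2 <= v T -> v N <= 1 ->
  exists s, s ^+ 2 - T * s + N = 0.
Proof.
move=> vT vN1; pose u k := iter k (fun s => T - N / s) T.
have vT0 : 0 < v T by apply: lt_le_trans vT.
have neq0 s : v s = v T -> s != 0 by move=> h; rewrite -v_eq0 h gt_eqF.
(* The correction [N / s] is smaller than [T], so the ultrametric inequality keeps all iterates at
   norm [v T]. *)
have vquo s : v s = v T -> v (N / s) <= 2^-1.
  move=> h; rewrite vM vV ?neq0 // h -[leRHS]mul1r.
  apply: ler_pM => //; first by rewrite invr_ge0 ltW.
  by rewrite lef_pV2 // posrE.
have vu k : v (u k) = v T.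
  elim: k => // k IHk; rewrite /u iterS -/(u k) v_dom // vN.
  by apply: le_lt_trans (vquo _ IHk) _; apply: lt_le_trans vT.
have un0 k : u k != 0 by exact: neq0.
have uS k : u k.+1 = T - N / u k by [].
have du k : v (u k.+1 - u k) <= 2^-1 ^+ k.
  elim: k => [|k IHk].
    rewrite uS [u 0]/u /= addrAC subrr add0r vN expr0.
    by apply: le_trans (vquo T erefl) _.
  (* Consecutive differences shrink by a factor [N / (u k * u k.+1)], whose norm is at most 1/2. *)
  have -> : u k.+2 - u k.+1 = (u k.+1 - u k) * (N / u k) / u k.+1.
    rewrite (uS k.+1) {2}(uS k); have := un0 k; have := un0 k.+1.
    by move: (u k) (u k.+1) => x y hy hx; field; rewrite hx hy.
  have -> : v ((u k.+1 - u k) * (N / u k) / u k.+1) =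
      v (u k.+1 - u k) * (v (N / u k) / v T).
    by rewrite [LHS]vM vV // vu [in LHS]vM mulrA.
  rewrite exprSr; apply: ler_pM => //; first by rewrite divr_ge0 // ltW.
  by rewrite ler_pdivrMr //; have := vquo _ (vu k); lra.
have small (e : rat) : 0 < e -> exists n0, forall n, (n0 <= n)%N -> 2^-1 ^+ n < e.
  move=> e_gt0; exists (Num.bound e^-1) => n hn; rewrite exprVn.
  rewrite invf_plt ?posrE ?exprn_gt0 //; exact: upper_nthrootP.
have [s hs] : exists s, forall e : rat, 0 < e ->
      exists n0, forall n, (n0 <= n)%N -> v (u n - s) < e.
  apply: (padic_complete vK) => e /small[n0 hn0]; exists n0 => n hn.
  by apply: le_lt_trans (du n) _; exact: hn0.
exists s; apply/eqP; rewrite -v_eq0 eq_le v_ge0 andbT leNgt; apply/negP => e_gt0.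
set e := v _ in e_gt0.
have [n0 h0] := hs _ (divr_gt0 e_gt0 vT0).
have [n1 h1] := hs _ vT0.
pose n := maxn n0 n1.
have hn k : (n <= k)%N -> v (s - u k) < e / v T.
  by move=> hk; rewrite -vN opprB h0 //; move: hk; rewrite /n geq_max => /andP[].
have vs : v s <= v T.
  rewrite -[s](subrK (u n)); apply: le_trans (vD _ _) _; rewrite ge_max vu lexx.
  by rewrite andbT -vN opprB ltW // h1 // leq_maxr.
have big x y : v x <= v T -> v y < e / v T -> v (x * y) < e.
  move=> hx hy; rewrite vM; apply: le_lt_trans (_ : v T * v y < e).
    by rewrite ler_wpM2r.
  by rewrite mulrC -ltr_pdivlMr.
have : e < e; last by rewrite ltxx.
(* By [u n.+1 * u n = T * u n - N], the value of the polynomial at [s] is a sum of products of a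
   factor of norm at most [v T] with a difference between [s] and an iterate. *)
rewrite {1}/e (_ : s ^+ 2 - T * s + N =
  s * (s - u n.+1) + (u n.+1 * (s - u n) + - T * (s - u n))).
  apply: v_small; first by apply: big => //; exact/hn/leqnSn.
  by apply: v_small; apply: big; rewrite ?vN ?vu // hn.
rewrite uS; have := un0 n; move: (u n) => x hx; field.
by rewrite hx.
Qed.

(** A trace that is not integral beside an integral norm would give a root as in [padic_root], so
    [x] would be scalar by [quat_factor]. A rational scalar whose square is integral at [l] is
    itself integral there, and so is its trace. *)
Lemma padic_loc_trd (a b : rat) (x : quat a b) :
    division_ring (quat (ratr a : K) (ratr b)) ->
  loc l isint (nrd x) -> loc l isint (trd x).
Proof.
move=> dK hn; case: (pselect (loc l isint (trd x))) => // ht; exfalso.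
pose X : quat (ratr a : K) (ratr b) :=
  Quat (ratr (qre x)) (ratr (qi x)) (ratr (qj x)) (ratr (qk x)).
have nX : nrd X = ratr (nrd x).
  by rewrite /nrd /= !expr2 !(ratr_add, ratr_mul, ratr_opp).
have tX : trd X = ratr (trd x).
  by rewrite /trd !mulr2n ratr_add.
have [s hs] : exists s, s ^+ 2 - ratr (trd x) * s + ratr (nrd x) = 0.
  by apply: padic_root; rewrite (padic_rat vK); [exact: padic_norm_ge2|exact: padic_norm_le1].
have XX : (X - sc s) * (X - sc (ratr (trd x) - s)) = 0.
  by rewrite -tX; apply: quat_factor; rewrite tX nX.
have ratr_inj (q : rat) : ratr q = 0 :> K -> q = 0.
  move=> /eqP; rewrite /ratr mulf_eq0 invr_eq0 => /orP[] h.
    by apply/eqP; rewrite -numq_eq0; apply: contraLR h => /intr_neq0.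
  by case/negP: (intr_neq0 (denq_neq0 q)).
have [r hr] : exists r, X = sc r.
  by case: (division_ring_mul_eq0 dK XX) => /eqP; rewrite subr_eq0 => /eqP ->; eexists.
have xE : x = sc (qre x).
  by apply: quat_eq => //=; apply: ratr_inj; move: hr; case.
apply: ht; rewrite /trd mulr2n; have hq : loc l isint (qre x).
  by apply: loc_isint_sqr => //; move: hn; rewrite xE nrd_sc.
by apply: (zsD (loc_zmod isint_zmod lP)).
Qed.

End Padic.

Lemma ramified_loc_trd (a b : rat) (l : nat) (x : quat a b) : prime l ->
  ramified_at a b l -> loc l isint (nrd x) -> loc l isint (trd x).
Proof. by move=> lP [K [v [vK dK]]]; exact: (padic_loc_trd lP vK). Qed.
End Ramification.

(** * Lattices over a maximal order *)

Section MaximalOrder.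
Context {a b : rat} (an : a < 0) (bn : b < 0).
Notation B := (quat a b).
Context {O : set B} (O_max : maximal_order O).
Implicit Types (x y z c : B) (J : set B).

Let hO : is_order O := proj1 O_max.
Let Oz : zmod_set O := order_zmod hO.

(** The multiplier is the prime-to-[l] part of [N]: the local hypotheses take care of the remaining
    power of [l]. It depends on [N] alone, so that it serves a whole lattice at once. *)
Lemma maximal_order_loc l N : prime l -> (0 < N)%N ->
  exists2 m, ~~ (l %| m)%N & forall y, O (y *+ N) -> loc l isint (nrd y) ->
    (forall c, O c -> loc l isint (trd (y * c))) -> O (y *+ m).
Proof.
move=> lP /(split_multiple lP)[m mP ->]; move: (logn l N) => k.
exists m => // y hy ny ty.
have hy' : O (y *+ m *+ l ^ k) by rewrite -mulrnA.
apply: maximal_order_mem => //.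
- apply: (loc_both (l := l) (k := k * 2) isint_zmod) => //.
    have := order_nrd hO hy'; rewrite nrdMn -natrX -expnM mulr_natl.
    by [].
  rewrite nrdMn -natrX; apply: loc_isintM => //.
  by apply: loc_sub => //; exact: isint_natr.
- move=> c Oc; apply: (loc_both (l := l) (k := k) isint_zmod) => //.
    by rewrite -trdMn -mulrnAl; apply: (order_trd hO) => //; exact: (orderM hO).
  by rewrite mulrnAl trdMn; apply: (zsMn (loc_zmod isint_zmod lP)); exact: ty.
Qed.

(** A bounded denominator replaces finite generation. These turn out to be exactly the invertible
    fractional right ideals, by [right_lattice_invertible] and [invertible_right_lattice]. *)
Definition right_lattice J := [/\ right_ideal O J, exists2 x, J x & x != 0 &
  exists2 N : nat, (0 < N)%N & forall x, J x -> O (x *+ N)].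

Lemma right_ideal_zmod J : right_ideal O J -> zmod_set J.
Proof.
case=> J0 JD JM; split=> // x y Jx Jy; apply: JD => //.
by rewrite -[y]mulr1 -mulrN; apply: JM => //; apply: (zsN Oz); exact: (order1 hO).
Qed.

(** Minimality of the norm at [l] stands for generation, which [local_generator_div] deduces from
    it. *)
Definition local_generator l J x := [/\ J x, x != 0 &
  forall z, J z -> loc l isint (nrd z / nrd x)].

Lemma local_generator_exists l J : prime l -> right_lattice J ->
  exists x, local_generator l J x.
Proof.
move=> lP [hJ [x0 Jx0 x0n0] [N N_gt0 hN]].
have nJ z : J z -> exists n : nat, N%:R ^+ 2 * nrd z = n%:R.
  move=> /hN h; rewrite -nrdMn; apply: isint_nat; first exact: (order_nrd hO).
  exact: nrd_ge0.
have N2 : N%:R ^+ 2 != 0 :> rat by rewrite expf_neq0 // pnatr_eq0 -lt0n.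
pose P k := `[< exists x n, [/\ J x, x != 0, N%:R ^+ 2 * nrd x = n%:R & logn l n = k] >].
have exP : exists k, P k.
  have [n en] := nJ _ Jx0; exists (logn l n); apply/asboolP.
  by exists x0, n.
case: (ex_minnP exP) => k /asboolP[x [n [Jx xn0 en kn]]] kmin; exists x; split=> // z Jz.
have nx : nrd x != 0 by rewrite nrd_eq0.
have [->|zn0] := eqVneq z 0.
  by rewrite nrd0 mul0r; apply: loc_sub => //; exact: zs0 isint_zmod.
have n_gt0 : (0 < n)%N.
  by rewrite -(ltr0n rat) -en mulr_gt0 ?nrd_gt0 // exprn_gt0 // ltr0n.
have [m mP nE] := split_multiple lP n_gt0; exists m => //.
have [nz ez] := nJ _ Jz.
have nz_gt0 : (0 < nz)%N.
  by rewrite -(ltr0n rat) -ez mulr_gt0 ?nrd_gt0 // exprn_gt0 // ltr0n.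
have /dvdnP[w wE] : (l ^ k %| nz)%N.
  rewrite pfactor_dvdn //; apply: kmin; apply/asboolP.
  by exists z, nz.
rewrite (_ : _ *+ m = w%:R); first exact: isint_natr.
rewrite -mulr_natr mulrAC; apply: (mulIf nx); rewrite divfK //.
apply: (mulfI N2); rewrite mulrA ez mulrCA en wE nE kn -!natrM.
by congr (_%:R); lia.
Qed.

(** Minimality makes the norms of [qinv x * z * c] and of [qinv x * (z * c + x)] integral at [l].
    Their difference, minus 1, is the trace that [maximal_order_loc] asks for. *)
Lemma local_generator_div l J x : prime l -> right_lattice J ->
    local_generator l J x ->
  exists2 m, ~~ (l %| m)%N & forall z, J z -> O (qinv x * z *+ m).
Proof.
move=> lP [hJ _ [N N_gt0 hN]] [Jx xn0 minx].
have [M M_gt0 hM] := order_multiple hO (qinv x).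
have MN_gt0 : (0 < M * N)%N by rewrite muln_gt0 M_gt0.
have [m mP hm] := maximal_order_loc lP MN_gt0; exists m => // z Jz.
have ny w : J w -> loc l isint (nrd (qinv x * w)).
  by move=> Jw; rewrite nrdM nrdV // mulrC; exact: minx.
apply: hm; last 2 first.
- exact: ny.
- move=> c Oc; rewrite -mulrA.
  have Jzc : J (z * c) by case: hJ => _ _; apply.
  have Jzcx : J (z * c + x) by case: hJ => _ hD _; exact: hD.
  have := ny _ Jzcx; have := ny _ Jzc.
  rewrite mulrDr qmulVr // nrdD nrd1 qconj1 mulr1; set n := nrd _; set t := trd _.
  move=> h1 h2; rewrite (_ : t = n + 1 + t - n - 1); last by ring.
  apply: (zsB (loc_zmod isint_zmod lP)); last first.
    by apply: loc_sub => //; exact: (isint_natr 1).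
  exact: (zsB (loc_zmod isint_zmod lP)).
- by rewrite mulrnA -mulrnAl -mulrnAr; apply: (orderM hO) => //; exact: hN.
Qed.

Definition left_dual J : set B := [set y | forall x, J x -> O (y * x)]%classic.

Lemma set_prod_zmod (I J : set B) : (forall x, I x -> I (- x)) ->
  zmod_set (set_prod I J).
Proof.
move=> IN; split.
  by exists 0, (fun=> 0); split=> [[]|] //; rewrite big_ord0.
move=> x y [n [u [hu ->]]] [m [w [hw ->]]].
exists (n + m), (fun i => match fintype.split i with inl j => u j | inr j => - w j end).
split=> [i|].
  case: (fintype.split i) => j //.
  by have [r [s [Ir Js ->]]] := hw j; exists (- r), s; rewrite mulNr; split=> //; exact: IN.
rewrite big_split_ord /= -sumrN; congr (_ + _); apply: eq_bigr => i _.
  by rewrite (unsplitK (inl i)).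
by rewrite (unsplitK (inr i)).
Qed.

Lemma set_prodI (I J : set B) x y : I x -> J y -> set_prod I J (x * y).
Proof.
move=> Ix Jy; exists 1%N, (fun=> x * y); split=> [_|]; first by exists x, y.
by rewrite big_ord1.
Qed.

Lemma right_lattice_invertible J : right_lattice J -> invertible_ideal O J.
Proof.
move=> lJ; have hJ : right_ideal O J by case: lJ.
have Jz := right_ideal_zmod hJ; have [_ _ JM] := hJ.
(* Take [y = m x^-1] for a local generator [x]. The products [m] obtained at all primes then glue to
   1 in both products of ideals. *)
have one l : prime l -> exists m x y, [/\ ~~ (l %| m)%N, J x, left_dual J y,
    y * x = m%:R & x * y = m%:R].
  move=> lP; have [x gx] := local_generator_exists lP lJ.
  have [m mP hm] := local_generator_div lP lJ gx; have [Jx xn0 _] := gx.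
  exists m, x, (qinv x *+ m); split=> //.
  - by move=> z Jz'; rewrite mulrnAl; exact: hm.
  - by rewrite mulrnAl qmulVr.
  - by rewrite mulrnAr qmulV.
have zp1 := @set_prod_zmod J (left_dual J) (fun x => @zsN _ _ Jz x).
have zp2 : zmod_set (set_prod (left_dual J) J).
  by apply: set_prod_zmod => x hx y Jy; rewrite mulNr; apply: (zsN Oz); exact: hx.
have one1 : set_prod J (left_dual J) 1.
  apply: (loc_global zp1) => l /one[m [x [y [mP Jx Jy _ e]]]].
  by exists m => //; rewrite -e; exact: set_prodI.
have one2 : set_prod (left_dual J) J 1.
  apply: (loc_global zp2) => l /one[m [x [y [mP Jx Jy e _]]]].
  by exists m => //; rewrite -e; exact: set_prodI.
split=> //; exists (left_dual J); split; apply/seteqP; split=> w.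
- move=> [n [u [hu ->]]] y Jy; rewrite mulr_suml; apply: (zs_sum Jz) => i _.
  by have [r [s [Jr Js ->]]] := hu i; rewrite -mulrA; apply: JM => //; exact: Js.
- move=> hw; have [n [u [hu e]]] := one1; exists n, (fun i => w * u i).
  split=> [i|]; last by rewrite -mulr_sumr -e mulr1.
  by have [r [s [Jr Js ->]]] := hu i; exists (w * r), s; rewrite mulrA; split=> //; exact: hw.
- move=> [n [u [hu ->]]]; apply: (zs_sum Oz) => i _.
  by have [r [s [Jr Js ->]]] := hu i; exact: Jr.
- move=> Ow; have [n [u [hu e]]] := one2; exists n, (fun i => u i * w).
  split=> [i|]; last by rewrite -mulr_suml -e mul1r.
  have [r [s [Jr Js ->]]] := hu i; exists r, (s * w); rewrite mulrA; split=> //.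
  exact: JM.
Qed.

(** A nonzero [y] of the inverse ideal satisfies [y J] inside [O], so a denominator of [qinv y]
    serves all of [J]. *)
Lemma invertible_right_lattice J : invertible_ideal O J -> right_lattice J.
Proof.
move=> [hJ [J' [_ JJ]]]; split=> //.
  have : set_prod J' J 1 by rewrite JJ; exact: (order1 hO).
  move=> [n [u [hu e]]]; apply: contrapT => h.
  have : (1 : B) = 0; last by move/eqP; rewrite oner_eq0.
  rewrite e big1 // => i _; have [r [s [_ Js ->]]] := hu i.
  by have [->|sn0] := eqVneq s 0; [rewrite mulr0 | case: h; exists s].
have [y J'y yn0] : exists2 y, J' y & y != 0.
  have : set_prod J' J 1 by rewrite JJ; exact: (order1 hO).
  move=> [n [u [hu e]]]; apply: contrapT => h.
  have : (1 : B) = 0; last by move/eqP; rewrite oner_eq0.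
  rewrite e big1 // => i _; have [r [s [Jr _ ->]]] := hu i.
  by have [->|sn0] := eqVneq r 0; [rewrite mul0r | case: h; exists r].
have [M M_gt0 hM] := order_multiple hO (qinv y); exists M => // x Jx.
have Oyx : O (y * x) by rewrite -JJ; exact: set_prodI.
by rewrite -[x](@qmulVK _ _ an bn y) // -mulrnAl; exact: (orderM hO).
Qed.

End MaximalOrder.

Arguments right_lattice {a b} O J.
Arguments left_dual {a b} O J _.

(** * The two-sided ideal [F O] at the ramified prime *)

Section FrobeniusElement.
Context {a b : rat} (an : a < 0) (bn : b < 0).
Notation B := (quat a b).
Context {O : set B} (O_max : maximal_order O).
Context {p : nat} (p_prime : prime p) (p_ram : ramified_at a b p).
Context {F : B} (F_O : O F) (F_sq : F ^+ 2 + p%:R = 0).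
Implicit Types (x y z c : B).

Let hO : is_order O := proj1 O_max.
Let Oz : zmod_set O := order_zmod hO.
Let p_gt0 : (0 < p)%N. Proof. exact: prime_gt0. Qed.
Let pn0 : p%:R != 0 :> rat. Proof. by rewrite pnatr_eq0 -lt0n. Qed.

Lemma frob_sqr : F * F = - sc p%:R.
Proof. by apply/eqP; rewrite -addr_eq0 scn -expr2 F_sq. Qed.

Lemma frob_neq0 : F != 0.
Proof.
apply/eqP => F0; have /eqP := frob_sqr.
by rewrite F0 mul0r eq_sym oppr_eq0 sc_eq0 (negbTE pn0).
Qed.

(** With nonzero trace, [F] would be a rational scalar, whose square cannot be [-p]. *)
Lemma frob_trd : trd F = 0.
Proof.
apply/eqP; apply: contraT => tn0; exfalso.
have e : sc (trd F) * F = sc (nrd F - p%:R).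
  by rewrite scD scN -frob_sqr quat_sqr addrC subrK.
have FE : F = sc ((trd F)^-1 * (nrd F - p%:R)).
  by rewrite scM -e mulrA -scM mulVf // sc1 mul1r.
move: frob_sqr; rewrite FE -scM -scN => /sc_inj; rewrite -expr2 => h.
have := sqr_ge0 ((trd F)^-1 * (nrd F - p%:R)).
by rewrite h oppr_ge0 lern0 => /eqP p0; move: p_gt0; rewrite p0.
Qed.

Lemma frob_conj : qconj F = - F.
Proof. by rewrite qconjE frob_trd sc0 sub0r. Qed.

Lemma frob_nrd : nrd F = p%:R.
Proof. by apply: (@sc_inj _ a b); rewrite -mul_conj frob_conj mulrN frob_sqr opprK. Qed.

Lemma frob_inv : qinv F = - (sc p%:R^-1 * F).
Proof. by rewrite qinvE frob_nrd frob_conj mulrN. Qed.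

Lemma frob_inv_mulp x : qinv F * x *+ p = - (F * x).
Proof.
rewrite frob_inv -scMn mulNr mulrN; congr (- _).
by rewrite !mulrA -scM mulfV // sc1 mul1r.
Qed.

(** At a ramified prime an integral norm forces integral traces, so the local maximal order is the
    whole valuation ring. *)
Lemma nrd_loc_order x : loc p isint (nrd x) -> loc p O x.
Proof.
move=> hx; have [N N_gt0 hN] := order_multiple hO x.
have [m mP hm] := maximal_order_loc O_max p_prime N_gt0; exists m => //.
apply: hm => // c Oc; apply: ramified_loc_trd => //.
rewrite nrdM; apply: loc_isintM => //; apply: loc_sub => //.
exact: (order_nrd hO).
Qed.

(** Since [qinv F] has denominator [p], only the prime [p] matters; there membership depends on the
    norm, which conjugation preserves. *)
Lemma frob_conjugate x : O x -> O (qinv F * x * F).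
Proof.
move=> Ox; apply: (loc_both (l := p) (k := 1) Oz) => //.
  rewrite expn1 -mulrnAl frob_inv_mulp mulNr; apply: (zsN Oz).
  by do 2![apply: (orderM hO) => //].
apply: nrd_loc_order; rewrite nrdM (nrdM (qinv F)) nrdV // mulrAC mulVf ?mul1r.
  by apply: loc_sub => //; exact: (order_nrd hO).
by rewrite frob_nrd.
Qed.

Lemma frob_conjugateE x : F * x * qinv F = qinv F * x * F.
Proof. by rewrite frob_inv mulrN !mulNr; congr (- _); rewrite mulrA -[in LHS]scC !mulrA. Qed.

Lemma frob_conjugateV x : O x -> O (F * x * qinv F).
Proof. by move=> Ox; rewrite frob_conjugateE; exact: frob_conjugate. Qed.

Lemma frob_dvd x : O x -> isint (nrd x / p%:R) -> O (qinv F * x).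
Proof.
move=> Ox hx; apply: (loc_both (l := p) (k := 1) Oz) => //.
  by rewrite expn1 frob_inv_mulp; apply: (zsN Oz); exact: (orderM hO).
apply: nrd_loc_order; rewrite nrdM nrdV // frob_nrd mulrC.
exact: loc_sub.
Qed.

Lemma frob_nrd_dvd x : O (qinv F * x) -> isint (nrd x / p%:R).
Proof. by move=> /(order_nrd hO); rewrite nrdM nrdV // frob_nrd mulrC. Qed.

(** [O / F O] is a division ring: outside [F O] the norm [n] of [x] is prime to [p], and [qconj x]
    times an inverse [u] of [n] modulo [p] inverts [x] modulo [F]. *)
Lemma frob_quotient_div x z : O x -> ~ O (qinv F * x) -> O z ->
  exists2 c, O c & O (qinv F * (z - x * c)).
Proof.
move=> Ox nx Oz'; have [n en] := isint_nat (order_nrd hO Ox) (nrd_ge0 an bn x).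
have nP : ~~ (p %| n)%N.
  apply/negP => /dvdnP[k kE]; apply: nx; apply: frob_dvd => //.
  rewrite en kE natrM mulfK //; exact: isint_natr.
have cop : coprime n p by rewrite coprime_sym prime_coprime.
have n_gt0 : (0 < n)%N by rewrite lt0n; apply: contra nP => /eqP ->; rewrite dvdn0.
case: (egcdnP p n_gt0) => u v; rewrite (eqP cop) => e _.
exists (qconj x * z *+ u).
  by apply: (zsMn Oz); apply: (orderM hO) => //; exact: (order_conj hO).
rewrite mulrnAr mulrA mul_conj en scMn -mulrnA mulnC e mulrnDr mulr1n opprD addrC subrK.
rewrite mulrnA mulrN mulrnAr frob_inv_mulp opprK.
by apply: (orderM hO) => //; exact: (zsMn Oz).
Qed.

End FrobeniusElement.

(** * Indices *)

Section Index.
Context {V : zmodType}.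
Implicit Types (X Y Z : V -> Prop).

(** This is [quotient_card] in an arbitrary abelian group, so that indices in [B] and in [B^2] can
    be compared. *)
Definition has_index X Y (N : nat) := exists t : 'I_N -> V, (forall i, X (t i)) /\
  forall v, X v -> exists! i, Y (v - t i).

Lemma has_index_card X Y (T : finType) (t : T -> V) : (forall i, X (t i)) ->
  (forall v, X v -> exists! i, Y (v - t i)) -> has_index X Y #|T|.
Proof.
move=> Xt ht; exists (t \o enum_val); split=> [i|v /ht[a [Ya ua]]]; first exact: Xt.
exists (enum_rank a); split=> [|j Yj]; first by rewrite /= enum_rankK.
by rewrite (ua _ Yj) enum_valK.
Qed.

(** The [t a] may lie outside [X] and repeat classes. They are first replaced by elements of [X],
    then only the index of least rank in each class is kept. *)
Lemma has_index_exists X Y (T : finType) (t : T -> V) : zmod_set Y -> X 0 ->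
  (forall v, X v -> exists a, Y (v - t a)) -> exists N, has_index X Y N.
Proof.
move=> Yz X0 ht.
have /choice[u hu] a : exists v, X v /\ ((exists2 w, X w & Y (w - t a)) -> Y (v - t a)).
  case: (pselect (exists2 w, X w & Y (w - t a))) => [[w Xw Yw]|h].
    by exists w.
  (* A class that misses [X] receives the dummy representative 0. *)
  by exists 0; split=> // /h.
have Xu a : X (u a) by case: (hu a).
have cov v : X v -> exists a, Y (v - u a).
  move=> Xv; have [a Ya] := ht v Xv; exists a; have [_ h] := hu a.
  have := zsB Yz Ya (h (ex_intro2 _ _ v Xv Ya)).
  by rewrite opprB addrA subrK.
pose leader (i : T) := [forall j, `[< Y (u i - u j) >] ==> (enum_rank i <= enum_rank j)%N].
have Ysym v w : Y (v - w) -> Y (w - v) by move=> /(zsN Yz); rewrite opprB.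
have Ytr v w z : Y (v - w) -> Y (w - z) -> Y (v - z).
  by move=> h1 h2; have := zsD Yz h1 h2; rewrite addrA subrK.
exists #|{: {i : T | leader i}}|; apply: (has_index_card (t := fun i => u (val i))) => // v Xv.
have [a0 Ya0] := cov v Xv.
have [a /asboolP Ya amin] := @arg_minnP T a0 (fun a => `[< Y (v - u a) >])
  (fun a => enum_rank a) (introT (asboolP _) Ya0).
have la : leader a.
  apply/forallP => j; apply/implyP => /asboolP h; apply: amin; apply/asboolP.
  exact: Ytr Ya h.
exists (exist _ a la); split=> // -[c lc] /= Yc; apply: val_inj => /=.
have h1 := Ytr _ _ _ (Ysym _ _ Ya) Yc; have h2 := Ysym _ _ h1.
apply: enum_rank_inj; apply: val_inj; apply: anti_leq; apply/andP; split.
  by have /forallP/(_ c)/implyP := la; apply; exact/asboolP.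
by have /forallP/(_ a)/implyP := lc; apply; exact/asboolP.
Qed.

Lemma has_index_leq X Y N M : zmod_set Y -> has_index X Y N -> has_index X Y M -> (N <= M)%N.
Proof.
move=> Yz [t [Xt ht]] [s [Xs hs]].
have /choice[f hf] i : exists j, Y (t i - s j).
  by have [j [Yj _]] := hs _ (Xt i); exists j.
have finj : injective f.
  move=> i j e; have [k [_ uk]] := ht _ (Xt i).
  have := zsB Yz (hf i) (hf j); rewrite e opprB addrA subrK => /uk <-.
  by apply/esym/uk; rewrite subrr; exact: zs0.
by have := leq_card f finj; rewrite !card_ord.
Qed.

Lemma has_index_unique X Y N M : zmod_set Y -> has_index X Y N -> has_index X Y M -> N = M.
Proof. by move=> Yz h1 h2; apply: anti_leq; rewrite !(has_index_leq Yz (X := X)). Qed.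

Lemma has_index_gt0 X Y N : X 0 -> has_index X Y N -> (0 < N)%N.
Proof. by move=> X0 [t [_ ht]]; have [i _] := ht _ X0; exact: leq_trans (ltn_ord i). Qed.

Lemma has_index_tower X Y Z N M : zmod_set X -> zmod_set Y -> zmod_set Z ->
    (forall v, Y v -> X v) -> (forall v, Z v -> Y v) ->
  has_index X Y N -> has_index Y Z M -> has_index X Z (N * M).
Proof.
move=> Xz Yz Zz YX ZY [t [Xt ht]] [s [Ys hs]].
have -> : (N * M)%N = #|{: 'I_N * 'I_M}| by rewrite card_prod !card_ord.
apply: (has_index_card (t := fun ij => t ij.1 + s ij.2)) => [[i j]|v Xv] /=.
  by apply: (zsD Xz) => //; exact: YX.
have [i [Yi ui]] := ht _ Xv; have [j [Zj uj]] := hs _ Yi.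
exists (i, j); split=> [|[i' j'] /= h] /=; first by rewrite opprD addrA.
have ei : i = i'.
  by apply: ui; have := zsD Yz (ZY _ h) (Ys j'); rewrite opprD addrA subrK.
congr (_, _) => //; apply: uj; by rewrite ei -addrA -opprD.
Qed.

End Index.

Lemma has_index_map (V W : zmodType) (f : V -> W) (X Y : V -> Prop) (X' Y' : W -> Prop) N :
    (forall v w, f (v - w) = f v - f w) -> zmod_set X ->
    (forall v, X v -> X' (f v)) -> (forall w, X' w -> exists2 v, X v & w = f v) ->
    (forall v, X v -> (Y v <-> Y' (f v))) ->
  has_index X Y N -> has_index X' Y' N.
Proof.
move=> fB Xz XX' X'X YY' [t [Xt ht]]; exists (f \o t); split=> [i|w /X'X[v Xv ->]].
  exact: XX'.
have [i [Yi ui]] := ht _ Xv; exists i; split=> [|j].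
  by rewrite /= -fB; apply/YY' => //; exact: (zsB Xz).
by rewrite /= -fB => h; apply: ui; apply/YY' => //; exact: (zsB Xz).
Qed.

(** * Indices of principal right ideals *)

Section LatticeIndex.
Context {a b : rat} (an : a < 0) (bn : b < 0).
Notation B := (quat a b).
Context {O : set B} (O_max : maximal_order O).
Implicit Types (x y z c : B) (J : set B).

Let hO : is_order O := proj1 O_max.
Let Oz : zmod_set O := order_zmod hO.

Definition mulset (X : B -> Prop) (k : nat) : B -> Prop := fun x => exists2 y, X y & x = y *+ k.
Definition rprinc x : B -> Prop := fun w => exists2 c, O c & w = x * c.

Lemma quatMn x k : x *+ k = Quat (qre x *+ k) (qi x *+ k) (qj x *+ k) (qk x *+ k).
Proof. by elim: k => [|k IHk]; rewrite ?mulrSr ?IHk. Qed.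

Lemma mulset_zmod (X : B -> Prop) k : zmod_set X -> zmod_set (mulset X k).
Proof.
move=> Xz; split=> [|_ _ [x Xx ->] [y Xy ->]].
  by exists 0; [exact: zs0 | rewrite mul0rn].
by exists (x - y); [exact: zsB | rewrite mulrnBl].
Qed.

Lemma rprinc_zmod x : zmod_set (rprinc x).
Proof.
split=> [|_ _ [c Oc ->] [d Od ->]]; first by exists 0; [exact: zs0 | rewrite mulr0].
by exists (c - d); [exact: zsB | rewrite mulrBr].
Qed.

Lemma quat_mulrnI k x y : (0 < k)%N -> x *+ k = y *+ k -> x = y.
Proof.
move=> k_gt0 /eqP; rewrite -subr_eq0 -mulrnBl -scMn qmul_eq0 // sc_eq0.
by rewrite pnatr_eq0 eqn0Ngt k_gt0 subr_eq0 => /eqP.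
Qed.

Lemma isint_quo (q : rat) k : (0 < k)%N -> isint q ->
  exists2 r : 'I_k, isint ((q - r%:R) / k%:R) & True.
Proof.
move=> k_gt0 /intrP[z ->]; have kn0 : k%:Z != 0 by case: k k_gt0.
have kn0' : k%:R != 0 :> rat by rewrite pnatr_eq0 -lt0n.
have h0 := modz_ge0 z kn0; have hlt := ltz_pmod z (_ : 0 < k%:Z).
have r_lt : (`|(z %% k)%Z| < k)%N.
  by rewrite -ltz_nat gez0_abs //; apply: hlt.
exists (Ordinal r_lt) => //=; apply/intrP; exists (z %/ k)%Z.
apply: (mulIf kn0'); rewrite divfK //.
rewrite natr_absz ger0_norm // {1}(divz_eq z k) rmorphD rmorphM /= addrK.
by [].
Qed.

Lemma isint_res k (i j : 'I_k) : isint ((i%:R - j%:R : rat) / k%:R) -> i = j.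
Proof.
move=> /intrP[z ez]; apply: val_inj => /=.
have k_gt0 : (0 < k)%N by exact: leq_trans (ltn_ord i).
have kn0' : k%:R != 0 :> rat by rewrite pnatr_eq0 -lt0n.
have e : (i%:Z - j%:Z)%R = z * k%:Z.
  by apply/eqP; rewrite -(eqr_int rat) rmorphB rmorphM /= -ez divfK.
have hi := ltn_ord i; have hj := ltn_ord j.
move: hi hj e; clear; move: (nat_of_ord i) (nat_of_ord j) => m n hm hn e.
suff z0 : z = 0 by move: e; rewrite z0; lia.
have [z1|z1|//] := ltrgtP z 0; exfalso.
  have : z * k%:Z <= - k%:Z by nia.
  by lia.
have : k%:Z <= z * k%:Z by nia.
by lia.
Qed.

Lemma coord_int_index k : (0 < k)%N ->
  has_index coord_int (mulset (@coord_int a b) k) (k ^ 4).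
Proof.
move=> k_gt0; have kn0 : k%:R != 0 :> rat by rewrite pnatr_eq0 -lt0n.
have -> : (k ^ 4)%N = #|{: 'I_k * 'I_k * 'I_k * 'I_k}|.
  by rewrite !card_prod !card_ord; lia.
pose t (i : 'I_k * 'I_k * 'I_k * 'I_k) : B :=
  Quat i.1.1.1%:R i.1.1.2%:R i.1.2%:R i.2%:R.
have mulK (q : rat) : q *+ k / k%:R = q by rewrite -[q *+ k]mulr_natr mulfK.
have divK (q : rat) : (q / k%:R) *+ k = q.
  by rewrite -[(q / _) *+ k]mulr_natr divfK.
have mulP x : mulset coord_int k x <-> [/\ isint (qre x / k%:R), isint (qi x / k%:R),
    isint (qj x / k%:R) & isint (qk x / k%:R)].
  split=> [[y [? ? ? ?] ->]|[h1 h2 h3 h4]].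
    by rewrite quatMn /= !mulK.
  exists (Quat (qre x / k%:R) (qi x / k%:R) (qj x / k%:R) (qk x / k%:R)) => //.
  by rewrite quatMn /= !divK; case: (x).
apply: (has_index_card (t := t)) => [i|v [h1 h2 h3 h4]].
  by split; exact: isint_natr.
have [r1 q1 _] := isint_quo k_gt0 h1; have [r2 q2 _] := isint_quo k_gt0 h2.
have [r3 q3 _] := isint_quo k_gt0 h3; have [r4 q4 _] := isint_quo k_gt0 h4.
exists (r1, r2, r3, r4); split=> [|[[[s1 s2] s3] s4]]; first by apply/mulP.
move=> /mulP[/= p1 p2 p3 p4].
have res (q : rat) (r s : 'I_k) : isint ((q - r%:R) / k%:R) ->
    isint ((q - s%:R) / k%:R) -> r = s.
  move=> hr hs; apply: isint_res; have := zsB isint_zmod hs hr.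
  by rewrite -mulrBl opprB addrC addrA subrK.
by rewrite (res _ _ _ q1 p1) (res _ _ _ q2 p2) (res _ _ _ q3 p3) (res _ _ _ q4 p4).
Qed.

Lemma right_lattice_order : right_lattice O O.
Proof.
split; last by exists 1%N => // x; rewrite mulr1n.
  split; [exact: zs0|by move=> x y; apply: (zsD Oz)|by move=> x c; apply: (orderM hO)].
by exists 1; [exact: (order1 hO) | exact: oner_neq0].
Qed.

Lemma coord_int_basis x : coord_int x -> exists z1 z2 z3 z4 : int,
  x = 1 *~ z1 + (Quat 0 1 0 0) *~ z2 + (Quat 0 0 1 0) *~ z3 + (Quat 0 0 0 1) *~ z4.
Proof.
case=> /intrP[z1 e1] /intrP[z2 e2] /intrP[z3 e3] /intrP[z4 e4].
exists z1, z2, z3, z4.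
have sz y (z : int) : y *~ z = sc z%:~R * y.
  by case: z => n; rewrite ?NegzE ?mulrNz ?scN ?mulNr scMn.
by rewrite !sz; apply: quat_eq; rewrite !qE /= ?e1 ?e2 ?e3 ?e4; ring.
Qed.

Lemma right_lattice_coord J : right_lattice O J ->
  exists2 M : nat, (0 < M)%N & forall x, mulset coord_int M x -> J x.
Proof.
move=> [hJ [x Jx xn0] _]; have Jz := right_ideal_zmod O_max hJ.
have JM c : O c -> J (x * c) by case: hJ => _ _ h; exact: h.
have mult y : exists2 m : nat, (0 < m)%N & J (y *+ m).
  have [m m_gt0 hm] := order_multiple hO (qinv x * y); exists m => //.
  by rewrite -(qmulKV an bn y xn0) -mulrnAr; exact: JM.
have [m1 p1 h1] := mult 1; have [m2 p2 h2] := mult (Quat 0 1 0 0).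
have [m3 p3 h3] := mult (Quat 0 0 1 0); have [m4 p4 h4] := mult (Quat 0 0 0 1).
exists (m1 * m2 * m3 * m4)%N; first by rewrite !muln_gt0 p1 p2 p3.
move=> _ [y /coord_int_basis[z1 [z2 [z3 [z4 ->]]]] ->].
rewrite !mulrnDl; have term u (z : int) m n : J (u *+ m) -> J (u *~ z *+ (m * n)).
  by move=> h; rewrite pmulrn mulrzAC -pmulrn mulrnA; apply: (zsMz Jz); exact: (zsMn Jz).
apply: (zsD Jz); [apply: (zsD Jz); [apply: (zsD Jz)|]|].
- by rewrite -!mulnA; exact: term.
- by rewrite [(m1 * m2)%N]mulnC -!mulnA; exact: term.
- by rewrite [(m1 * m2 * m3)%N]mulnC -!mulnA; exact: term.
- by rewrite [(m1 * m2 * m3 * m4)%N]mulnC; exact: term.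
Qed.

Lemma right_lattice_coord_bounded J : right_lattice O J ->
  exists2 N : nat, (0 < N)%N & forall x, J x -> coord_int (x *+ N).
Proof.
move=> [_ _ [N N_gt0 hN]]; have [M M_gt0 hM] := order_coord_bounded hO.
exists (N * M)%N; first by rewrite muln_gt0 N_gt0.
by move=> x /hN /hM; rewrite mulrnA.
Qed.

(** [J] lies in [1 / N] times the coordinate lattice, and [M * k] times that lattice lies in [k J],
    hence in [Y]. So representatives modulo [N * M * k], divided by [N], cover [J] modulo [Y]. *)
Lemma right_lattice_index J (Y : B -> Prop) k : right_lattice O J -> (0 < k)%N ->
  zmod_set Y -> (forall x, J x -> Y (x *+ k)) -> exists N, has_index J Y N.
Proof.
move=> lJ k_gt0 Yz hY; have hJ : right_ideal O J by case: lJ.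
have Jz := right_ideal_zmod O_max hJ.
have [M M_gt0 hM] := right_lattice_coord lJ.
have [N N_gt0 hN] := right_lattice_coord_bounded lJ.
have NMk : (0 < N * M * k)%N by rewrite !muln_gt0 N_gt0 M_gt0.
have [t [_ ht]] := coord_int_index NMk.
apply: (has_index_exists (t := fun i => sc N%:R^-1 * t i)) => //; first exact: (zs0 Jz).
move=> v /hN/ht[i [[y cy e] _]]; exists i.
have -> : v - sc N%:R^-1 * t i = y *+ M *+ k.
  have Nn0 : N%:R != 0 :> rat by rewrite pnatr_eq0 -lt0n.
  apply: (quat_mulrnI N_gt0); rewrite mulrnBl -[_ * _ *+ N]scMn mulrA -scM.
  by rewrite mulfV // sc1 mul1r e -!mulrnA; congr (_ *+ _); lia.
by apply: hY; apply: hM; exists y.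
Qed.

(** Let [C] be a multiple of the coordinate lattice inside [J]. The index of [k C] in [J], computed
    through [C] and through [k J], contains the factor [A] both times, since [k J / k C] and [J / C]
    have the same size; cancel it. *)
Lemma right_lattice_mul_index J k : right_lattice O J -> (0 < k)%N ->
  has_index J (mulset J k) (k ^ 4).
Proof.
move=> lJ k_gt0; have hJ : right_ideal O J by case: lJ.
have Jz := right_ideal_zmod O_max hJ.
have [M M_gt0 hM] := right_lattice_coord lJ.
have [N N_gt0 hN] := right_lattice_coord_bounded lJ.
pose C := mulset (@coord_int a b) M.
have Cz : zmod_set C by apply: mulset_zmod; exact: coord_int_zmod.
have mJ x n : J x -> J (x *+ n) by exact: (zsMn Jz).
have [A hA] : exists A, has_index J C A.
  apply: (@right_lattice_index J C (N * M)) => //; first by rewrite muln_gt0 N_gt0.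
  by move=> x Jx; rewrite mulrnA; exists (x *+ N) => //; exact: hN.
have [D hD] : exists D, has_index J (mulset J k) D.
  apply: (@right_lattice_index J _ k) => //; first exact: mulset_zmod.
  by move=> x Jx; exists x.
have CJ x : C x -> J x := hM x.
have mulE X Y n : zmod_set X -> forall m, (0 < m)%N ->
    has_index X Y n -> has_index (mulset X m) (mulset Y m) n.
  move=> Xz m m_gt0; apply: (@has_index_map _ _ (fun x : B => x *+ m)) => //.
  - by move=> v w; rewrite mulrnBl.
  - by move=> v Xv; exists v.
  - by move=> v Xv; split=> [Yv|[w Yw /(quat_mulrnI m_gt0) ->]] //; exists v.
have hC : has_index C (mulset C k) (k ^ 4).
  have := mulE _ _ _ (@coord_int_zmod a b) M M_gt0 (coord_int_index k_gt0).
  apply: (has_index_map (f := id)) => // [w|v _]; first by exists w.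
  split=> [[_ [y cy ->] ->]|[_ [y cy ->] ->]].
    by exists (y *+ M); [exists y | rewrite -!mulrnA mulnC].
  by exists (y *+ k); [exists y | rewrite -!mulrnA mulnC].
have CkC x : mulset C k x -> C x.
  by move=> [y Cy ->]; exact: (zsMn Cz).
have CkJ x : mulset C k x -> mulset J k x.
  by move=> [y Cy ->]; exists y => //; exact: CJ.
have kJJ x : mulset J k x -> J x by move=> [y Jy ->]; exact: mJ.
have z1 := mulset_zmod k Cz; have z2 := mulset_zmod k Jz.
have h1 := has_index_tower Jz Cz z1 CJ CkC hA hC.
have h2 := has_index_tower Jz z2 z1 kJJ CkJ hD (mulE _ _ _ Jz k k_gt0 hA).
have := has_index_unique z1 h1 h2; rewrite mulnC => /eqP.
by rewrite eqn_pmul2r ?(has_index_gt0 (zs0 Jz) hA) // => /eqP ->.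
Qed.

Lemma rprinc_sub J x w : right_ideal O J -> J x -> rprinc x w -> J w.
Proof. by case=> _ _ hM Jx [c Oc ->]; exact: hM. Qed.

Lemma rprinc_bounded J x : right_lattice O J -> x != 0 ->
  exists2 k : nat, (0 < k)%N & forall z, J z -> rprinc x (z *+ k).
Proof.
move=> [hJ _ [N N_gt0 hN]] xn0.
have [M M_gt0 hM] := order_multiple hO (qinv x).
exists (M * N)%N; first by rewrite muln_gt0 M_gt0.
move=> z Jz; exists ((qinv x *+ M) * (z *+ N)).
  by apply: (orderM hO) => //; exact: hN.
by rewrite mulrnAl !mulrnAr qmulKV // -mulrnA mulnC.
Qed.

Lemma rprinc_index J x : right_lattice O J -> x != 0 -> exists N, has_index J (rprinc x) N.
Proof.
move=> lJ xn0; have [k k_gt0 hk] := rprinc_bounded lJ xn0.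
by apply: (right_lattice_index lJ k_gt0) => //; exact: rprinc_zmod.
Qed.

(** [x O] sits between [k J] and [J]. For a local generator at [l] one can take [k] prime to [l],
    and then the index is prime to [l]. *)
Lemma rprinc_index_dvd J x k N : right_lattice O J -> J x -> x != 0 -> (0 < k)%N ->
  (forall z, J z -> rprinc x (z *+ k)) -> has_index J (rprinc x) N -> (N %| k ^ 4)%N.
Proof.
move=> lJ Jx xn0 k_gt0 hk hN; have hJ : right_ideal O J by case: lJ.
have Jz := right_ideal_zmod O_max hJ; have xz := rprinc_zmod x.
have hkJ w : mulset J k w -> rprinc x w by move=> [z Jz' ->]; exact: hk.
have xJ w : rprinc x w -> J w by exact: rprinc_sub.
have lx : right_lattice O (rprinc x).
  split; last 2 first.
  - by exists x => //; exists 1; [exact: (order1 hO)|rewrite mulr1].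
  - by case: lJ => _ _ [M M_gt0 hM]; exists M => // z /xJ; exact: hM.
  split; first exact: (zs0 xz).
  - by move=> v w; exact: (zsD xz).
  - by move=> v c [d Od ->] Oc; exists (d * c); rewrite ?mulrA //; exact: (orderM hO).
have kz := mulset_zmod k Jz.
have [M hM] : exists M, has_index (rprinc x) (mulset J k) M.
  apply: (right_lattice_index lx k_gt0) => // z hz; exists z => //; exact: xJ.
have := has_index_tower Jz xz kz xJ hkJ hN hM.
by move=> /(has_index_unique kz (right_lattice_mul_index lJ k_gt0)) ->; exact: dvdn_mulr.
Qed.

Lemma rprinc_mul_index x z N : x != 0 ->
  has_index O (rprinc z) N -> has_index (rprinc x) (rprinc (x * z)) N.
Proof.
move=> xn0; apply: (@has_index_map _ _ (fun w => x * w)) => //.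
- by move=> v w; rewrite mulrBr.
- by move=> v Ov; exists v.
- move=> v Ov; split=> [[c Oc ->]|[c Oc e]]; first by exists c; rewrite ?mulrA.
  by exists c => //; apply: (qmulI an bn xn0); rewrite e mulrA.
Qed.

Lemma order_rprinc x w : O x -> rprinc x w -> O w.
Proof. by move=> Ox [c Oc ->]; exact: (orderM hO). Qed.

Lemma rprincM_sub x z w : O z -> rprinc (x * z) w -> rprinc x w.
Proof. by move=> Oz' [c Oc ->]; exists (z * c); rewrite ?mulrA //; exact: (orderM hO). Qed.

Lemma order_indexM x z N M : O x -> x != 0 -> O z ->
  has_index O (rprinc x) N -> has_index O (rprinc z) M -> has_index O (rprinc (x * z)) (N * M).
Proof.
move=> Ox xn0 Oz' hN hM.
apply: (has_index_tower Oz (rprinc_zmod x) (rprinc_zmod (x * z))) => //.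
- by move=> v; exact: order_rprinc.
- by move=> v; exact: rprincM_sub.
- exact: rprinc_mul_index.
Qed.

Lemma rprinc_nat_index J y k : right_lattice O J -> y != 0 -> (0 < k)%N ->
  has_index (rprinc y) (rprinc (y *+ k)) (k ^ 4).
Proof.
move=> lJ yn0 k_gt0; rewrite -scMn scC; apply: rprinc_mul_index => //.
apply: (has_index_map (f := id)) (right_lattice_mul_index right_lattice_order k_gt0) => //.
  by move=> w Ow; exists w.
by move=> v Ov; split=> -[c Oc ->]; exists c => //; rewrite scMn.
Qed.

(** From [u * z = qconj z * u] and multiplicativity, [z] and [qconj z] have the same index [N].
    Their product is the integer [n = nrd z], of index [n ^ 4], so [N ^ 2 = n ^ 4]. *)
Lemma order_norm_index z N : O z -> z != 0 -> has_index O (rprinc z) N ->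
  N%:R = nrd z ^+ 2 :> rat.
Proof.
move=> Oz' zn0 hN.
have Ocz := order_conj hO Oz'; have czn0 : qconj z != 0 by rewrite qconj_eq0.
have [M hM] := rprinc_index right_lattice_order czn0.
have [u0 u0n0 eu0] := conj_conjugate an bn z.
have [m m_gt0 Ou] := order_multiple hO u0.
have un0 : u0 *+ m != 0.
  by rewrite -scMn qmul_eq0 // sc_eq0 pnatr_eq0 eqn0Ngt m_gt0.
have eu : (u0 *+ m) * z = qconj z * (u0 *+ m) by rewrite mulrnAl eu0 mulrnAr.
have [U hU] := rprinc_index right_lattice_order un0.
have h1 := order_indexM Ou un0 Oz' hU hN.
have h2 := order_indexM Ocz czn0 Ou hM hU.
rewrite eu in h1; have := has_index_unique (rprinc_zmod _) h1 h2.
rewrite mulnC => /eqP; rewrite eqn_pmul2r ?(has_index_gt0 (zs0 Oz) hU) // => /eqP NM.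
have [n en] := isint_nat (order_nrd hO Oz') (nrd_ge0 an bn z).
have n_gt0 : (0 < n)%N by rewrite -(ltr0n rat) -en nrd_gt0.
have := order_indexM Oz' zn0 Ocz hN hM; rewrite mul_conj en -NM => h3.
have h4 := right_lattice_mul_index right_lattice_order n_gt0.
have h5 : has_index O (rprinc (sc n%:R)) (n ^ 4).
  apply: (has_index_map (f := id)) h4 => // [w|v _]; first by exists w.
  by split=> -[c Oc ->]; exists c => //; rewrite scMn.
have /eqP := has_index_unique (rprinc_zmod _) h3 h5.
rewrite (_ : 4%N = (2 * 2)%N) // expnM mulnn eqn_exp2r // => /eqP ->.
by rewrite natrX.
Qed.

(* Both sides compute the index of x z O = m y O in J, where z = m x^-1 y. *)
Lemma rprinc_index_ratio J x y N M : right_lattice O J ->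
    J x -> x != 0 -> J y -> y != 0 ->
    has_index J (rprinc x) N -> has_index J (rprinc y) M ->
  N%:R * nrd y ^+ 2 = M%:R * nrd x ^+ 2 :> rat.
Proof.
move=> lJ Jx xn0 Jy yn0 hN hM; have hJ : right_ideal O J by case: lJ.
have Jz := right_ideal_zmod O_max hJ.
have [m m_gt0 Oz'] := order_multiple hO (qinv x * y).
set z := qinv x * y *+ m in Oz'.
have xz : x * z = y *+ m by rewrite /z mulrnAr qmulKV.
have zn0 : z != 0.
  rewrite /z -scMn !qmul_eq0 // sc_eq0 qinv_eq0 // pnatr_eq0 eqn0Ngt m_gt0.
  by rewrite (negbTE xn0) (negbTE yn0).
have [Z hZ] := rprinc_index right_lattice_order zn0.
have h1 := has_index_tower Jz (rprinc_zmod x) (rprinc_zmod (x * z))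
  (fun w => rprinc_sub hJ Jx) (fun w => rprincM_sub Oz') hN (rprinc_mul_index xn0 hZ).
have Om : O m%:R by exact: order_nat.
have ym : y *+ m = y * m%:R by rewrite mulr_natr.
have h2 := has_index_tower Jz (rprinc_zmod y) (rprinc_zmod (y *+ m)) (fun w => rprinc_sub hJ Jy).
have {}h2 := h2 _ _ _ hM (rprinc_nat_index lJ yn0 m_gt0).
rewrite xz in h1; have := has_index_unique (rprinc_zmod _) h1 (h2 _).
move=> /(_ (fun w => _))/(congr1 (fun n => n%:R : rat)) e.
have {e} e : N%:R * Z%:R = M%:R * m%:R ^+ 4 :> rat.
  rewrite -natrX -!natrM; apply: e => w; rewrite ym; exact: rprincM_sub.
have nx0 : nrd x != 0 by rewrite nrd_eq0.
have mn0 : m%:R != 0 :> rat by rewrite pnatr_eq0 -lt0n.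
move: e; rewrite (order_norm_index Oz' zn0 hZ) /z nrdMn nrdM nrdV // => e.
have m4 : m%:R ^+ 4 != 0 :> rat by rewrite expf_neq0.
apply: (mulfI m4); transitivity (nrd x ^+ 2 * (M%:R * m%:R ^+ 4)); last by ring.
by rewrite -e; field.
Qed.

Lemma order_index_norm J (q : rat) (r : B -> nat) x : right_lattice O J ->
    (forall x, J x -> x != 0 -> q * nrd x = (r x)%:R) ->
    (forall l, prime l -> exists2 y, local_generator l J y & ~~ (l %| r y)%N) ->
  J x -> x != 0 -> has_index J (rprinc x) (r x ^ 2).
Proof.
move=> lJ hr hl Jx xn0; have hJ : right_ideal O J by case: lJ.
have Jz := right_ideal_zmod O_max hJ.
have [N hN] := rprinc_index lJ xn0.
suff -> : (r x ^ 2 = N)%N by [].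
have N_gt0 := has_index_gt0 (zs0 Jz) hN.
have qn0 : q != 0.
  (* Any prime would do: [q = 0] would make [r y] vanish, hence divisible by it. *)
  have [y [Jy yn0 _] ry] := hl 2 isT; apply: contra ry => /eqP q0.
  by move: (hr y Jy yn0); rewrite q0 mul0r => /esym/eqP; rewrite pnatr_eq0 => /eqP ->.
have r_gt0 y : J y -> y != 0 -> (0 < r y)%N.
  move=> Jy yn0; rewrite lt0n; apply: contraNneq qn0 => ry0.
  have := hr y Jy yn0; rewrite ry0 => /eqP; rewrite mulf_eq0 nrd_eq0 // (negbTE yn0) orbF.
  by [].
have rx_gt0 := r_gt0 x Jx xn0.
have rx2 : (0 < r x ^ 2)%N by rewrite expn_gt0 rx_gt0.
apply: (eqn_from_log rx2 N_gt0) => l.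
case: (boolP (prime l)) => [lP|/negbTE nl]; last by rewrite (lognE l N) lognE nl.
have [y gy ly] := hl l lP; have [Jy yn0 _] := gy.
have [M hM] := rprinc_index lJ yn0; have M_gt0 := has_index_gt0 (zs0 Jz) hM.
(* [M] divides [m ^ 4], where [m] is prime to [l] and [m J] lies in [y O]. *)
have lM : ~~ (l %| M)%N.
  have [m mP hm] := local_generator_div an bn O_max lP lJ gy.
  have m_gt0 : (0 < m)%N by rewrite lt0n; apply: contraNneq mP => ->; rewrite dvdn0.
  apply: contra mP => lM; have : (M %| m ^ 4)%N.
    apply: (rprinc_index_dvd lJ Jy yn0 m_gt0 _ hM) => z Jz'.
    by exists (qinv y * z *+ m); [exact: hm | rewrite mulrnAr qmulKV].
  by move=> /(dvdn_trans lM); rewrite Euclid_dvdX // => /andP[].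
have e := rprinc_index_ratio lJ Jx xn0 Jy yn0 hN hM; have ry_gt0 := r_gt0 y Jy yn0.
have {e} : (N * r y ^ 2 = M * r x ^ 2)%N.
  apply/eqP; rewrite -(eqr_nat rat) [(N * _)%:R]natrM [(M * _)%:R]natrM !natrX -!hr // !exprMn.
  by rewrite mulrCA e mulrCA.
move=> /(congr1 (logn l)); rewrite !lognM ?expn_gt0 ?muln_gt0 ?rx_gt0 ?ry_gt0 //.
have l0 n : ~~ (l %| n)%N -> logn l n = 0%N.
  by move=> h; rewrite lognE (negbTE h) !andbF.
by rewrite (l0 _ lM) (l0 _ ly); lia.
Qed.

End LatticeIndex.

Arguments rprinc {a b} O x _.

(** * Endomorphisms of powers of an elliptic curve *)

Section GroupFunctorFacts.
Context {k : fieldType}.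
Implicit Types G H : groupFunctor k.

Section Group.
Context {G : groupFunctor k} (hG : commutative_group G).

Lemma gadd0r (R : localAlg k) (P : G R) : gadd P (gzero G R) = P.
Proof. by rewrite (gaddC hG) (gadd0 hG). Qed.

Lemma gadd_idem (R : localAlg k) (P : G R) : gadd P P = P -> P = gzero G R.
Proof.
move=> h; rewrite -{1}[P](gadd0 hG) -(gaddN hG P) -(gaddA hG) h.
by rewrite (gaddN hG).
Qed.

Lemma gmap0 (R S : localAlg k) (h : {lrmorphism R -> S}) :
  gmap h (gzero G R) = gzero G S.
Proof. by apply: gadd_idem; rewrite -(gmapD hG) (gadd0 hG). Qed.

Lemma hom0 H (u : gtrans H G) (R : localAlg k) : is_hom u -> commutative_group H ->
  u R (gzero H R) = gzero G R.
Proof. by move=> [uD _] hH; apply: gadd_idem; rewrite -uD (gadd0 hH). Qed.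

Definition axis n (j : 'I_n) : gtrans G (power G n) :=
  fun R Q i => if i == j then Q else gzero G R.

Lemma axis_hom n (j : 'I_n) : is_hom (axis j).
Proof.
split=> [R P Q|R S h P]; apply/funext => i; rewrite /axis /=; case: ifP => //.
  by rewrite (gadd0 hG).
by rewrite gmap0.
Qed.

Lemma hom_matrix n (t : gtrans (power G n) (power G n)) (i j : 'I_n) : is_hom t ->
  is_hom (fun R (Q : G R) => t R (axis j Q) i).
Proof.
move=> [tD tN]; have [aD aN] := axis_hom j; split=> [R P Q|R S h P].
  by rewrite aD tD.
by rewrite aN tN.
Qed.

Lemma power2E (R : localAlg k) (P : power G 2 R) :
  P = gadd (axis 0 (P 0)) (axis 1 (P 1)).
Proof.
apply/funext => i; rewrite /= /axis.
have [->|->] : i = 0 \/ i = 1.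
  by case: i => -[|[|//]] h; [left | right]; apply: val_inj.
- by rewrite /= gadd0r.
- by rewrite /= (gadd0 hG).
Qed.

End Group.
End GroupFunctorFacts.

(** * Dual numbers as a local algebra *)

Section DualNumbers.
Context {k : fieldType}.

Definition dual_numbers := {poly %/ ('X^2 : {poly k})}.

Lemma dual_mk_monic : mk_monic ('X^2 : {poly k}) = 'X^2.
Proof. by rewrite /mk_monic size_polyXn monicXn. Qed.

Lemma dual_local (x : dual_numbers) :
  x \is a GRing.unit \/ 1 - x \is a GRing.unit.
Proof.
have unitE (y : dual_numbers) : (y \is a GRing.unit) = coprimep 'X^2 (y : {poly k}).
  have -> : (y \is a GRing.unit) = coprimep (mk_monic 'X^2) (y : {poly k}) by [].
  by move: (y : {poly k}) => q; rewrite dual_mk_monic.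
have coX (q : {poly k}) : coprimep 'X^2 q = (q.[0] != 0).
  rewrite coprimep_pexpl // coprimep_sym.
  by rewrite -['X]subr0 coprimep_XsubC.
rewrite !unitE !coX; case: eqP => [x0|_]; [right | by left].
rewrite /= hornerD hornerN x0 subr0.
by rewrite hornerC oner_neq0.
Qed.

Definition dual_alg : localAlg k := @LocalAlg k dual_numbers dual_local.

Definition dual_eps : dual_alg := in_qpoly 'X^2 'X.

Lemma dual_eps_neq0 : dual_eps != 0.
Proof.
apply/eqP => /(congr1 (@polyn _ _)) /=; rewrite dual_mk_monic.
rewrite Pdiv.CommonRing.rmodp_small ?size_polyXn ?size_polyX //.
by move/eqP; rewrite polyX_eq0.
Qed.

Lemma dual_epsX n : (1 < n)%N -> dual_eps ^+ n = 0.
Proof.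
case: n => [|[|n _]] //.
rewrite /dual_eps -(rmorphXn (in_qpoly _)) /=; apply: val_inj => /=.
rewrite dual_mk_monic -addn2 exprD.
by rewrite Pdiv.RingMonic.rmodp_mull ?monicXn.
Qed.

End DualNumbers.

(** * Matrices of endomorphisms, and the tangent vector at the origin *)

Section EllipticEndomorphisms.
Context {k : fieldType} {E : ellCurve k} {a b : rat}.
Notation B := (quat a b).
Context {O : set B} {act : B -> gtrans E E} (O_End : endomorphism_ring O act).
Arguments act _ _ _ : clear implicits.
Implicit Types (x y : B) (f T : 'M[B]_2).

Let hE : commutative_group E := ell_group E.

Lemma actH x : O x -> is_hom (act x). Proof. exact: (act_hom O_End). Qed.

Lemma act_zero x (R : localAlg k) : O x -> act x R (gzero E R) = gzero E R.
Proof. by move=> /actH h; have := @hom0 k E hE E (act x) R h hE. Qed.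

Lemma act0 (R : localAlg k) (P : E R) : O 0 -> act 0 R P = gzero E R.
Proof.
by move=> O0; apply: (gadd_idem hE); rewrite -(actD O_End) // addr0.
Qed.

Lemma gamma_axis f (R : localAlg k) (Q : E R) (i j : 'I_2) : integral_mx O f ->
  gamma act f (axis j Q) i = act (f i j) R Q.
Proof.
move=> hf; rewrite /gamma /axis.
have [->|->] : j = 0 \/ j = 1.
  by case: j => -[|[|//]] h; [left | right]; apply: val_inj.
- by rewrite eqxx (_ : (1 == 0 :> 'I_2) = false) // (act_zero R (hf i 1)) (gadd0r hE).
- by rewrite eqxx (_ : (0 == 1 :> 'I_2) = false) // (act_zero R (hf i 0)) (gadd0 hE).
Qed.

Lemma power_add n (R : localAlg k) (P Q : power E n R) i :
  gadd P Q i = gadd (P i) (Q i).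
Proof. by []. Qed.

Lemma isogeny_factor f F : zmod_set O -> (forall x y, O x -> O y -> O (x * y)) ->
    O F -> integral_mx O f -> isogeny (gamma act f) ->
    (forall (R : localAlg k) (P : power E 2 R),
       in_kernel (gamma act f) P -> in_kernel (frobenius2 (act F)) P) ->
  exists2 T, integral_mx O T & T *m f = F%:M.
Proof.
move=> Oz OM OF hf [_ iso] ker.
have O0 : O 0 := zs0 Oz.
have F2hom : is_hom (frobenius2 (act F)).
  have [FD FN] := actH OF; split=> [R P Q|R S h P]; apply/funext => i.
    exact: FD.
  exact: FN.
have [t [t_hom tE _]] := iso _ F2hom ker.
(* The composite of an axis, [t] and a coordinate is an endomorphism of [E], hence comes from
   [O]. *)
have /choice[T0 hT0] (ij : 'I_2 * 'I_2) : exists x, O x /\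
    forall (R : localAlg k) (P : E R), act x R P = t R (axis ij.2 P) ij.1.
  by have [x Ox hx] := act_surj O_End (hom_matrix hE ij.1 ij.2 t_hom); exists x.
exists (\matrix_(i, j) T0 (i, j)) => [i j|]; first by rewrite mxE; case: (hT0 (i, j)).
apply/matrixP => i j; rewrite !mxE big_ord_recl big_ord1 !mxE.
have OT m : O (T0 (i, m)) by case: (hT0 (i, m)).
have O1 := OM _ _ (OT 0) (hf 0 j); have O2 := OM _ _ (OT 1) (hf 1 j).
rewrite (_ : lift ord0 ord0 = 1); last exact: val_inj.
apply: (act_inj O_End).
- exact: (zsD Oz).
- exact: (zsMn Oz).
move=> R Q; rewrite (actD O_End) // !(actM O_End) //.
have := congr1 (fun P : power E 2 R => P i) (tE R (axis j Q)).
rewrite (power2E hE (gamma act f (axis j Q))).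
have [tD _] := t_hom; rewrite tD power_add !gamma_axis //.
have [_ t0] := hT0 (i, 0); have [_ t1] := hT0 (i, 1); rewrite -t0 -t1 => <-.
rewrite /frobenius2 /axis; case: (i == j); first by rewrite mulr1n.
by rewrite mulr0n act_zero // act0.
Qed.

Lemma wpoint_eq (W : weierstrass k) (R : localAlg k) (P Q : wpoint W R) :
  wcoord P = wcoord Q -> P = Q.
Proof.
case: P Q => [S hS] [S' hS'] /= e; case: _ / e hS' => hS'.
by congr WPoint; exact: Prop_irrelevance.
Qed.

Lemma unit_line_refl (R : localAlg k) (v : 'rV[R]_3) : unit_line v v.
Proof. by exists 1; rewrite ?unitr1 ?scale1r. Qed.

Lemma unit_line_eq (R : localAlg k) (v w : 'rV[R]_3) :
  unit_line w v -> unit_line v = unit_line w.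
Proof.
move=> [c uc ->]; apply/seteqP; split=> z [d ud ->].
  by exists (d * c); rewrite ?unitrM ?ud // scalerA.
by exists (d / c); rewrite ?unitrM ?unitrV ?ud // scalerA divrK.
Qed.

Lemma dual_point_subproof (W : weierstrass k) : exists v : 'rV[dual_alg]_3,
  [/\ unimodular v, on_curve W v & unit_line (row3 dual_eps 1 0) = unit_line v].
Proof.
exists (row3 dual_eps 1 0); split=> //.
  by apply/existsP; exists 1; rewrite mxE /= unitr1.
rewrite /on_curve !mxE /= !expr0n /= !mulr0 !scaler0 !addr0.
by rewrite dual_epsX.
Qed.

(** A nonzero tangent vector at the neutral element: both sides of the equation vanish because
    [z = 0] and [eps ^ 3 = 0]. *)
Definition dual_point (W : weierstrass k) : wpoint W dual_alg :=
  WPoint (dual_point_subproof W).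

Lemma dual_point_neq0 (W : weierstrass k) : dual_point W <> wzero W dual_alg.
Proof.
move=> /(congr1 (@wcoord _ _ _)) /= e.
have := @unit_line_refl dual_alg (row3 dual_eps 1 0).
rewrite e => -[c _ /(congr1 (fun v : 'rV[dual_alg]_3 => v 0 0))].
by rewrite !mxE /= mulr0 => /eqP; rewrite (negbTE dual_eps_neq0).
Qed.

(** Frobenius raises coordinates to the power [p], and [eps ^ p = 0]. *)
Lemma frobenius_dual_point p (u : gtrans E E) : (1 < p)%N -> is_frobenius p u ->
  u dual_alg (dual_point (ell_weierstrass E)) = gzero E dual_alg.
Proof.
move=> p_gt1 hu; apply: wpoint_eq => /=.
have h1 : wcoord (dual_point (ell_weierstrass E)) (row3 dual_eps 1 0).
  exact: (@unit_line_refl dual_alg).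
have := hu _ _ _ h1; have [w [_ _ ->]] := wpointP (u _ (dual_point (ell_weierstrass E))).
move=> /unit_line_eq <-. apply: (congr1 (@unit_line k dual_alg)); apply/rowP => i; rewrite !mxE.
by case: i => -[|[|[|//]]] ? /=; rewrite ?dual_epsX ?expr1n // expr0n gtn_eqF // ltnW.
Qed.

End EllipticEndomorphisms.

(** * Divisibility by [F] of matrices that kill [E^2[F]] *)

Section KernelOfFrobenius.
Context {k : fieldType} {E : ellCurve k} {a b : rat} (an : a < 0) (bn : b < 0).
Notation B := (quat a b).
Context {O : set B} (O_max : maximal_order O).
Context {p : nat} (p_prime : prime p) (p_ram : ramified_at a b p).
Context {F : B} (F_O : O F) (F_sq : F ^+ 2 + p%:R = 0).
Context {act : B -> gtrans E E} (O_End : endomorphism_ring O act).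
Context (F_frob : is_frobenius p (act F)).
Arguments act _ _ _ : clear implicits.

Let hE : commutative_group E := ell_group E.
Let hO : is_order O := proj1 O_max.

(** An entry [x] outside [F O] would be invertible modulo [F], so that 1 would lie in [O x + O F].
    But [x] and [F] both kill [dual_point], which is not zero. *)
Lemma kernel_divisible (f : 'M[B]_2) : integral_mx O f ->
    (forall (R : localAlg k) (P : power E 2 R),
       in_kernel (frobenius2 (act F)) P -> in_kernel (gamma act f) P) ->
  forall i j, O (qinv F * f i j).
Proof.
move=> hf ker i j; apply: contrapT => nx.
set x := f i j in nx; have Ox : O x by exact: hf.
pose Q : E dual_alg := dual_point (ell_weierstrass E).
have FQ : act F dual_alg Q = gzero E dual_alg.
  by apply: frobenius_dual_point F_frob; exact: prime_gt1.
have xQ : act x dual_alg Q = gzero E dual_alg.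
  rewrite -(gamma_axis O_End) //.
  have K : in_kernel (frobenius2 (act F)) (axis j Q).
    apply/funext => m; rewrite /frobenius2 /axis /=; case: ifP => // _.
    exact: (act_zero O_End).
  by rewrite (ker _ _ K).
(* A combination with [x] and [F] on the right is needed, since [act] composes. [frob_quotient_div]
   multiplies [x] on its right, so it is applied to [qconj x] and the result conjugated. *)
have Ocx : O (qconj x) by exact: (order_conj hO).
have ncx : ~ O (qinv F * qconj x).
  move=> /(frob_nrd_dvd an bn O_max p_prime F_sq); rewrite nrd_conj => h; apply: nx.
  exact: (frob_dvd an bn O_max p_prime p_ram F_O F_sq).
have [c Oc Od] := frob_quotient_div an bn O_max p_prime p_ram F_O F_sq Ocx ncx (order1 hO).
set d := qinv F * _ in Od.
have Fd : F * d = 1 - qconj x * c.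
  by rewrite qmulKV //; exact: (frob_neq0 p_prime F_sq).
move: d Od Fd => d Od Fd.
have e : 1 = qconj c * x + qconj (- d) * F.
  move: Fd => /(congr1 qconj); rewrite qconjB qconj1 !qconjM qconjK.
  rewrite (frob_conj p_prime F_sq) qconjN mulNr -mulrN => ->.
  by rewrite addrC subrK.
apply: (dual_point_neq0 (W := ell_weierstrass E)); rewrite -/Q -[LHS](act1 O_End) e.
have Od' : O (qconj (- d)) by apply: (order_conj hO); apply: (zsN (order_zmod hO)).
have Oc' : O (qconj c) by exact: (order_conj hO).
rewrite (actD O_End); try exact: (orderM hO).
rewrite !(actM O_End) // FQ xQ !(act_zero O_End) //.
exact: (gadd0 hE).
Qed.

End KernelOfFrobenius.

(** * Hermitian lattices *)

Section HermitianForm.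
Context {a b : rat}.
Notation B := (quat a b).
Implicit Types (x y : B) (u v w c : 'cV[B]_2) (M P f : 'M[B]_2).

Lemma colZE n (v : 'cV[B]_n) x : colZ v x = v *m x%:M.
Proof. by apply/colP => i; rewrite !mxE big_ord1 mxE mulr1n. Qed.
Lemma mul_colZ m n (M : 'M[B]_(m, n)) (v : 'cV[B]_n) x : M *m colZ v x = colZ (M *m v) x.
Proof. by rewrite !colZE mulmxA. Qed.
Lemma colZA n (v : 'cV[B]_n) x y : colZ (colZ v x) y = colZ v (x * y).
Proof. by apply/colP => i; rewrite !mxE mulrA. Qed.
Lemma colZ1 n (v : 'cV[B]_n) : colZ v 1 = v.
Proof. by apply/colP => i; rewrite !mxE mulr1. Qed.
Lemma colZ0 n (v : 'cV[B]_n) : colZ v 0 = 0.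
Proof. by apply/colP => i; rewrite !mxE mulr0. Qed.
Lemma colZDr n (v : 'cV[B]_n) x y : colZ v (x + y) = colZ v x + colZ v y.
Proof. by apply/colP => i; rewrite !mxE mulrDr. Qed.
Lemma colZBr n (v : 'cV[B]_n) x y : colZ v (x - y) = colZ v x - colZ v y.
Proof. by apply/colP => i; rewrite !mxE mulrBr. Qed.

Lemma adjmxM m n q (M : 'M[B]_(m, n)) (N : 'M[B]_(n, q)) :
  adjmx (M *m N) = adjmx N *m adjmx M.
Proof.
apply/matrixP => i j; rewrite !mxE qconj_sum; apply: eq_bigr => l _.
by rewrite !mxE qconjM.
Qed.
Lemma adjmxK m n (M : 'M[B]_(m, n)) : adjmx (adjmx M) = M.
Proof. by apply/matrixP => i j; rewrite !mxE qconjK. Qed.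
Lemma adjmxD m n (M N : 'M[B]_(m, n)) : adjmx (M + N) = adjmx M + adjmx N.
Proof. by apply/matrixP => i j; rewrite !mxE qconjD. Qed.

Lemma hformDr f v w u : hform f v (w + u) = hform f v w + hform f v u.
Proof. by rewrite /hform mulmxDr mxE. Qed.
Lemma hformDl f v w u : hform f (v + w) u = hform f v u + hform f w u.
Proof. by rewrite /hform adjmxD !mulmxDl mxE. Qed.
Lemma hformZr f v w x : hform f v (colZ w x) = hform f v w * x.
Proof. by rewrite /hform colZE mulmxA mxE big_ord1 [(_%:M) _ _]mxE mulr1n. Qed.
Lemma hformZl f v w x : hform f (colZ v x) w = qconj x * hform f v w.
Proof.
rewrite /hform colZE adjmxM -!mulmxA [LHS]mxE big_ord1.
by congr (_ * _); rewrite !mxE mulr1n.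
Qed.
Lemma hform_mul f P v w : hform (adjmx P *m f *m P) v w = hform f (P *m v) (P *m w).
Proof. by rewrite /hform adjmxM !mulmxA. Qed.
Lemma hform_mulr f P v w : hform (f *m P) v w = hform f v (P *m w).
Proof. by rewrite /hform !mulmxA. Qed.
Lemma hform_add f P v w : hform (f + P) v w = hform f v w + hform P v w.
Proof. by rewrite /hform mulmxDr mulmxDl mxE. Qed.
Lemma hform_sum f v w :
  hform f v w = \sum_i \sum_j qconj (v i 0) * f i j * w j 0.
Proof.
rewrite /hform mxE exchange_big /=; apply: eq_bigr => j _.
by rewrite !mxE mulr_suml; apply: eq_bigr => i _; rewrite !mxE.
Qed.
Lemma hform_delta f i j : hform f (delta_mx i 0) (delta_mx j 0) = f i j.
Proof.
rewrite hform_sum (bigD1 i) //= [X in _ + X]big1 ?addr0 => [|i' ni]; last first.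
  by apply: big1 => j' _; rewrite !mxE (negbTE ni) /= qconj0 !mul0r.
rewrite (bigD1 j) //= big1 ?addr0 => [|j' nj]; last first.
  by rewrite !mxE (negbTE nj) /= mulr0.
by rewrite !mxE !eqxx /= qconj1 mul1r mulr1.
Qed.
Lemma hform_ext f P : (forall v w, hform f v w = hform P v w) -> f = P.
Proof. by move=> h; apply/matrixP => i j; rewrite -!hform_delta h. Qed.
Lemma hformC f v w : hermitian_mx f -> hform f w v = qconj (hform f v w).
Proof.
move=> hf; rewrite -[in LHS]hf /hform -[in LHS](adjmxK v) -!adjmxM mxE.
by rewrite mulmxA.
Qed.
Lemma hermitian_form f : (forall v w, hform f w v = qconj (hform f v w)) -> hermitian_mx f.
Proof. by move=> h; apply/matrixP => i j; rewrite mxE -!hform_delta -h. Qed.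

Lemma ord2P (i : 'I_2) : i = 0 \/ i = 1.
Proof. by case: i => -[|[|//]] h; [left | right]; apply: val_inj. Qed.

Lemma sum2E (G : 'I_2 -> B) : \sum_i G i = G 0 + G 1.
Proof. by rewrite big_ord_recl big_ord1; congr (_ + G _); apply: val_inj. Qed.

Lemma col2_eq v w : v 0 0 = w 0 0 -> v 1 0 = w 1 0 -> v = w.
Proof. by move=> h0 h1; apply/colP => i; case: (ord2P i) => ->. Qed.

(** * Right lines in [B^2] *)

Section Lines.
Context (an : a < 0) (bn : b < 0).

Lemma row_kernel_line (g : 'rV[B]_2) c w : g != 0 -> c != 0 ->
  g *m c = 0 -> g *m w = 0 -> exists x, w = colZ c x.
Proof.
move=> gn0 cn0 /rowP/(_ 0) gc /rowP/(_ 0) gw; move: gc gw; rewrite !mxE !sum2E => gc gw.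
have solve (r s y z : B) : r != 0 -> r * y + s * z = 0 -> y = - (qinv r * s * z).
  move=> rn0 /eqP; rewrite addr_eq0 => /eqP h.
  by rewrite -(qmulVK an bn y rn0) h mulrN mulrA.
have [g0|g0] := eqVneq (g 0 0) 0.
  have g1 : g 0 1 != 0.
    apply: contraNneq gn0 => g1; apply/eqP/rowP => i.
    by rewrite mxE; case: (ord2P i) => ->.
  have s1 := solve _ _ _ _ g1; move: gc gw; rewrite addrC => /s1 c1; rewrite addrC => /s1 w1.
  have c0 : c 0 0 != 0.
    by apply: contraNneq cn0 => c0; apply/eqP/col2_eq; rewrite !mxE // c1 c0 mulr0 oppr0.
  exists (qinv (c 0 0) * w 0 0); apply: col2_eq; rewrite mxE; first by rewrite qmulKV.
  by rewrite w1 c1 mulNr -!mulrA qmulKV.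
have c0 := solve _ _ _ _ g0 gc; have w0 := solve _ _ _ _ g0 gw.
have c1 : c 1 0 != 0.
  by apply: contraNneq cn0 => c1; apply/eqP/col2_eq; rewrite !mxE // c0 c1 mulr0 oppr0.
exists (qinv (c 1 0) * w 1 0); apply: col2_eq; rewrite mxE; last by rewrite qmulKV.
by rewrite w0 c0 mulNr -!mulrA qmulKV.
Qed.

Lemma row_kernel_neq0 (g : 'rV[B]_2) : exists2 c : 'cV[B]_2, c != 0 & g *m c = 0.
Proof.
have [g0|g0] := eqVneq (g 0 0) 0.
  exists (delta_mx 0 0).
    by apply/eqP => /colP/(_ 0)/eqP; rewrite !mxE /= oner_eq0.
  by apply/rowP => j; rewrite !mxE sum2E !mxE /= !ord1 g0 !mul0r mulr0 addr0.
exists (\col_(i < 2) (if i == 0 then - (qinv (g 0 0) * g 0 1) else 1)).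
  by apply/eqP => /colP/(_ 1)/eqP; rewrite !mxE /= oner_eq0.
apply/rowP => j; rewrite !mxE sum2E !mxE /= mulrN qmulKV // mulr1.
by rewrite addNr.
Qed.

(** A matrix of rank 1 is an injective column [C] times a nonzero row [g], so its kernel is the line
    killed by [g]. *)
Lemma rank1_kernel f : has_rank f 1 ->
  exists2 c : 'cV[B]_2, c != 0 & forall w, f *m w = 0 <-> exists x, w = colZ c x.
Proof.
move=> [C [Cinj Cim]].
have /choice[X hX] (j : 'I_2) : exists x : 'cV_1, f *m delta_mx j 0 = C *m x.
  by apply/Cim; exists (delta_mx j 0).
pose g : 'rV[B]_2 := \row_j X j 0 0.
have fE : f = C *m g.
  apply/matrixP => i j; have /colP/(_ i) := hX j; rewrite -colE !mxE => ->.
  by rewrite !big_ord1 !mxE.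
have gn0 : g != 0.
  apply/eqP => g0; have [v hv] : exists v, C *m 1%:M = f *m v.
    by apply/Cim; exists 1%:M.
  have := Cinj 1%:M; rewrite hv fE g0 mulmx0 mul0mx => /(_ erefl)/colP/(_ 0)/eqP.
  by rewrite !mxE /= oner_eq0.
have [c cn0 gc] := row_kernel_neq0 g; exists c => // w; split=> [fw|[x ->]].
  apply: (row_kernel_line gn0 cn0 gc).
  have /Cinj : C *m (g *m w) = 0 by rewrite mulmxA -fE.
  by [].
by rewrite mul_colZ fE -mulmxA gc mulmx0; apply/colP => i; rewrite !mxE mul0r.
Qed.

Lemma colZ_eq0 c x : c != 0 -> colZ c x = 0 -> x = 0.
Proof.
move=> cn0 /colP h; apply/eqP; apply: contraT => xn0.
case/eqP: cn0; apply/colP => i; have := h i; rewrite !mxE => /eqP.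
by rewrite qmul_eq0 // (negbTE xn0) orbF => /eqP.
Qed.

End Lines.
End HermitianForm.

(** * The hermitian lattice and its orthogonal lines *)

Section Splitting.
Context {a b : rat} (an : a < 0) (bn : b < 0).
Notation B := (quat a b).
Context {O : set B} (O_max : maximal_order O).
Context {p : nat} (p_prime : prime p) (p_ram : ramified_at a b p).
Context {F : B} (F_O : O F) (F_sq : F ^+ 2 + p%:R = 0).
Context {f : 'M[B]_2} (f_herm : hermitian_mx f) (f_pos : positive_definite f).
Context {T : 'M[B]_2} (T_O : integral_mx O T) (T_f : T *m f = F%:M).
Context (f_F : forall i j, O (qinv F * f i j)).
Implicit Types (x y z : B) (u v w c : 'cV[B]_2) (J : set B).

Let hO : is_order O := proj1 O_max.
Let Oz : zmod_set O := order_zmod hO.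
Let p_gt0 : (0 < p)%N. Proof. exact: prime_gt0. Qed.
Let Fn0 : F != 0. Proof. exact: (frob_neq0 p_prime F_sq). Qed.
Let FJ x : O x -> O (qinv F * x * F).
Proof. exact: (frob_conjugate an bn O_max p_prime p_ram F_O F_sq). Qed.
Let FJV x : O x -> O (F * x * qinv F).
Proof. exact: (frob_conjugateV an bn O_max p_prime p_ram F_O F_sq). Qed.

Notation L := (std_lattice O : set 'cV[B]_2).

Definition cset c J : set 'cV[B]_2 := [set w | exists2 x, J x & w = colZ c x]%classic.
(** [colZ c (coef c w)] is the orthogonal projection of [w] to the line of [c]. *)
Definition coef c w : B := qinv (hform f c c) * hform f c w.

Lemma lattice_zmod : zmod_set L.
Proof.
split=> [i j|v w Lv Lw i j]; first by rewrite mxE; exact: (zs0 Oz).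
by rewrite !mxE; exact: (zsB Oz).
Qed.

Lemma lattice_colZ v x : L v -> O x -> L (colZ v x).
Proof. by move=> Lv Ox i j; rewrite mxE; exact: (orderM hO). Qed.

Lemma lattice_delta j : L (delta_mx j 0).
Proof. by move=> i j'; rewrite mxE; exact: order_nat. Qed.

Lemma hform_gt0 c : c != 0 -> exists2 r : rat, 0 < r & hform f c c = sc r.
Proof. exact: f_pos. Qed.

Lemma hform_neq0 c : c != 0 -> hform f c c != 0.
Proof. by move=> /hform_gt0[r r_gt0 ->]; rewrite sc_eq0 gt_eqF. Qed.

Lemma coefD c v w : coef c (v + w) = coef c v + coef c w.
Proof. by rewrite /coef hformDr mulrDr. Qed.
Lemma coefZ c w x : coef c (colZ w x) = coef c w * x.
Proof. by rewrite /coef hformZr mulrA. Qed.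
Lemma coef_id c x : c != 0 -> coef c (colZ c x) = x.
Proof. by move=> cn0; rewrite /coef hformZr qmulVK // hform_neq0. Qed.
Lemma coefK c w : c != 0 -> hform f c c * coef c w = hform f c w.
Proof. by move=> cn0; rewrite qmulKV // hform_neq0. Qed.
Lemma coefB c v w : coef c (v - w) = coef c v - coef c w.
Proof. by apply/eqP; rewrite eq_sym subr_eq -coefD subrK. Qed.
Lemma coef_orth c1 c2 x : hform f c1 c2 = 0 -> coef c1 (colZ c2 x) = 0.
Proof. by move=> h; rewrite /coef hformZr h mul0r mulr0. Qed.
Lemma hform_sym0 c1 c2 : hform f c1 c2 = 0 -> hform f c2 c1 = 0.
Proof. by move=> h; rewrite (hformC _ _ f_herm) h qconj0. Qed.

(** The row [adjmx c1 *m f] is nonzero, so its kernel is a line. It contains [c2] as well as [w]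
    minus its projection to [c1]. *)
Lemma decomposition c1 c2 w : c1 != 0 -> c2 != 0 -> hform f c1 c2 = 0 ->
  w = colZ c1 (coef c1 w) + colZ c2 (coef c2 w).
Proof.
move=> c1n0 c2n0 c12; have c21 := hform_sym0 c12.
have gE v : (adjmx c1 *m f *m v = 0) <-> (hform f c1 v = 0).
  split=> h; first by rewrite /hform h mxE.
  by apply/matrixP => i j; rewrite (ord1 i) (ord1 j) [RHS]mxE; exact: h.
have gn0 : adjmx c1 *m f != 0.
  apply/eqP => g0; have := hform_neq0 c1n0; rewrite /hform g0 mul0mx mxE eqxx.
  by [].
have [x hx] : exists x, w - colZ c1 (coef c1 w) = colZ c2 x.
  apply: (row_kernel_line an bn gn0 c2n0); first exact/gE.
  apply/gE; rewrite -[- _]scaleN1r; have -> : -1 *: colZ c1 (coef c1 w) = colZ c1 (- coef c1 w).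
    by apply/colP => i; rewrite !mxE mulN1r mulrN.
  by rewrite hformDr hformZr mulrN coefK // subrr.
have wE : w = colZ c1 (coef c1 w) + colZ c2 x by rewrite -hx addrC subrK.
have <- : x = coef c2 w; last exact: wE.
by rewrite wE coefD coef_orth // add0r coef_id.
Qed.

(** The entries of [f] lie in [F O], and this ideal is two-sided. *)
Lemma hform_frob v u : L v -> L u -> O (qinv F * hform f v u).
Proof.
move=> Lv Lu; rewrite hform_sum mulr_sumr; apply: (zs_sum Oz) => i _.
rewrite mulr_sumr; apply: (zs_sum Oz) => j _.
have -> : qinv F * (qconj (v i 0) * f i j * u j 0) =
    (qinv F * qconj (v i 0) * F) * (qinv F * f i j) * u j 0.
  by rewrite -!mulrA qmulKV // !mulrA.
apply: (orderM hO); last exact: Lu.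
by apply: (orderM hO) => //; apply: FJ; exact: order_conj.
Qed.

(* This is F v = T f v. *)
Lemma col_form v i :
  v i 0 = qinv F * \sum_j T i j * qconj (hform f v (delta_mx j 0)).
Proof.
have fE j : qconj (hform f v (delta_mx j 0)) = (f *m v) j 0.
  rewrite -hformC // hform_sum (bigD1 j) //= [X in _ + X]big1 ?addr0 => [|i' ni]; last first.
    by apply: big1 => j' _; rewrite !mxE (negbTE ni) /= qconj0 !mul0r.
  by rewrite [RHS]mxE; apply: eq_bigr => l _; rewrite !mxE eqxx /= qconj1 mul1r.
rewrite (eq_bigr (fun j => T i j * (f *m v) j 0)) => [|j _]; last by rewrite fE.
have -> : \sum_j T i j * (f *m v) j 0 = (T *m (f *m v)) i 0 by rewrite [RHS]mxE.
by rewrite mulmxA T_f mul_scalar_mx mxE qmulVK.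
Qed.

(** An integer lying in [F O] has square divisible by [p], hence is itself divisible by [p]. *)
Lemma hform_dvd v : L v -> v != 0 ->
  exists2 h : nat, (0 < h)%N & hform f v v = (p * h)%:R.
Proof.
move=> Lv vn0; have [r r_gt0 hr] := hform_gt0 vn0.
have Or : O (qinv F * sc r) by rewrite -hr; exact: hform_frob.
have : O (sc r) by rewrite -(qmulKV an bn (sc r) Fn0); exact: (orderM hO).
move=> /(order_sc hO)/isint_nat/(_ (ltW r_gt0))[n rn].
have := frob_nrd_dvd an bn O_max p_prime F_sq Or; rewrite nrd_sc rn => hn.
have : (p %| n ^ 2)%N.
  apply: (isint_dvd p_prime hn); rewrite natrX divfK // pnatr_eq0 -lt0n.
  by [].
rewrite Euclid_dvdX // andbT => /dvdnP[h nE]; exists h.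
  by move: r_gt0; rewrite rn nE ltr0n muln_gt0 => /andP[].
by rewrite hr rn scn nE mulnC.
Qed.

(** Only the projection of [u] to the line counts, and this is [colZ c x] times
    [qinv x * coef c u]. *)
Lemma hform_line c x u : c != 0 -> x != 0 ->
  hform f (colZ c x) u = hform f (colZ c x) (colZ c x) * (qinv x * coef c u).
Proof.
by move=> cn0 xn0; rewrite hformZr !hformZl -!mulrA qmulKV // coefK.
Qed.

Lemma loc_sqr_div l m : prime l -> loc l isint (m%:R ^+ 2 / l%:R) -> (l %| m)%N.
Proof.
move=> lP [n nP h]; have ln0 : l%:R != 0 :> rat by rewrite pnatr_eq0 -lt0n prime_gt0.
have : (l %| m ^ 2 * n)%N.
  apply: (isint_dvd lP h).
  by rewrite -[_ *+ n]mulr_natr mulrAC divfK // natrM natrX.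
by rewrite Euclid_dvdM // (negbTE nP) orbF Euclid_dvdX // andbT.
Qed.

(** * A single line in the lattice *)

Section Line.
Context {c : 'cV[B]_2} {J : set B} (c_neq0 : c != 0) (J_lat : right_lattice O J).
Context (J_sub : forall x, J x -> L (colZ c x)).

Let Jz : zmod_set J. Proof. by case: J_lat => hJ _ _; exact: (right_ideal_zmod O_max hJ). Qed.
Let JM x y : J x -> O y -> J (x * y).
Proof. by case: J_lat => -[_ _ h] _ _; exact: h. Qed.

(* Otherwise p divides f (c x, -) on L for a local generator x at p, forcing
   x F^-1 into J locally. *)
Lemma coef_not_integral : exists2 u, L u & ~ J (coef c u).
Proof.
apply: contrapT => hn; have hJ u : L u -> J (coef c u).
  by move=> Lu; apply: contrapT => h; apply: hn; exists u.
have [x gx] := local_generator_exists an bn O_max p_prime J_lat.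
have [m mP hm] := local_generator_div an bn O_max p_prime J_lat gx.
have [Jx xn0 minx] := gx; set v := colZ c x.
have vn0 : v != 0 by apply: contraNneq xn0 => /(colZ_eq0 an bn c_neq0) ->.
have [h _ hh] := hform_dvd (J_sub Jx) vn0.
pose s i := \sum_j T i j * qconj (qinv x * coef c (delta_mx j 0) *+ m) *+ h.
have Os i : O (s i).
  apply: (zs_sum Oz) => j _; apply: (zsMn Oz); apply: (orderM hO) => //.
  by apply: (order_conj hO); apply: hm; apply: hJ; exact: lattice_delta.
(* By [hform_line] every value [hform f v _] carries the factor [p * h]; in [col_form] the [p] meets
   [qinv F] and leaves [- F]. *)
have vE i : v i 0 *+ m = - (F * s i).
  rewrite -(frob_inv_mulp p_prime F_sq) col_form -!mulrnAr -!sumrMnl; congr (_ * _).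
  apply: eq_bigr => j _; rewrite hform_line // hh qconjM -scn qconj_sc scn.
  rewrite qconjMn mulr_natr mulrnAr !mulrnAr -!mulrnA; congr (_ *+ _).
  by lia.
have Lx : L (colZ c (x * qinv F *+ m)).
  move=> i j; rewrite ord1 !mxE mulrnAr mulrA -mulrnAl.
  have := vE i; rewrite mxE => ->; rewrite mulNr; apply: (zsN Oz); exact: FJV.
(* The norm of [x * qinv F *+ m] is [m ^ 2 / p] times that of [x], against minimality since [p] does
   not divide [m]. *)
have := minx _ (hJ _ Lx); rewrite coef_id // nrdMn nrdM nrdV // (frob_nrd p_prime F_sq).
have nx : nrd x != 0 by rewrite nrd_eq0.
have pn0 : p%:R != 0 :> rat by rewrite pnatr_eq0 -lt0n.
rewrite (_ : _ / _ = m%:R ^+ 2 / p%:R); last by field; rewrite nx pn0.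
by move=> /(loc_sqr_div p_prime); rewrite (negbTE mP).
Qed.

(* Otherwise l p divides f (c x, -) F on L, forcing x / l into J locally. *)
Lemma local_generator_unit l x h : prime l -> (forall y, L (colZ c y) -> J y) ->
    (forall u, L u -> J (coef c u * F)) -> local_generator l J x ->
    hform f (colZ c x) (colZ c x) = (p * h)%:R ->
  ~~ (l %| h)%N.
Proof.
move=> lP J_prim hF gx hh; apply/negP => /dvdnP[k hE].
have [m mP hm] := local_generator_div an bn O_max lP J_lat gx.
have [Jx xn0 minx] := gx; set v := colZ c x.
pose s j := qinv x * (coef c (delta_mx j 0) * F) *+ m.
have Os j : O (s j) by apply: hm; apply: hF; exact: lattice_delta.
pose t i := \sum_j (qinv F * T i j * F) * qconj (s j) *+ k.
have Ot i : O (t i).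
  apply: (zs_sum Oz) => j _; apply: (zsMn Oz); apply: (orderM hO).
    exact: FJ.
  exact: order_conj.
have cF : qconj (qinv F) = - qinv F.
  by rewrite (frob_inv p_prime F_sq) qconjN qconjM (frob_conj p_prime F_sq) qconj_sc
             mulNr -scC.
(* Passing to [s j] costs a factor [qinv F], conjugated to [- qinv F]. The [p] of [p * h] turns it
   into [F], which together with the [qinv F] of [col_form] conjugates [T i j] inside [O]; the
   factor [l] of [h] remains. *)
have vE i : v i 0 *+ m = t i *+ l.
  rewrite col_form mulr_sumr -!sumrMnl; apply: eq_bigr => j _.
  rewrite hform_line // hh qconjM -scn qconj_sc scn.
  have -> : qinv x * coef c (delta_mx j 0) = qinv x * (coef c (delta_mx j 0) * F) * qinv F.
    by rewrite -!mulrA qmulV // mulr1.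
  rewrite qconjM cF /s qconjMn hE mulr_natr.
  set S := qconj (qinv x * _).
  have -> : T i j * (- qinv F * S *+ (p * (k * l))) = T i j * (F * S) *+ (k * l).
    rewrite mulrnA (_ : - qinv F * S *+ p = F * S) ?mulrnAr //.
    by rewrite mulNr mulNrn (frob_inv_mulp p_prime F_sq) opprK.
  by rewrite mulrnAr -!mulrnA !mulrA mulrnAr -!mulrnA; congr (_ *+ _); lia.
have ln0 : l%:R != 0 :> rat by rewrite pnatr_eq0 -lt0n prime_gt0.
have Lx : L (colZ c (x * sc (m%:R / l%:R))).
  move=> i j; rewrite ord1 mxE.
  have -> : c i 0 * (x * sc (m%:R / l%:R)) = t i; last exact: Ot.
  apply: (quat_mulrnI an bn (prime_gt0 lP)); rewrite -vE /v mxE.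
  have e : sc (m%:R / l%:R) *+ l = sc m%:R :> B by rewrite -scMn -scM mulrC divfK.
  by rewrite -!mulrnAr e -scC scMn.
have := minx _ (J_prim _ Lx); rewrite nrdM nrd_sc.
have nx : nrd x != 0 by rewrite nrd_eq0.
rewrite mulrAC mulfV // mul1r.
move=> [n nP hn]; have : loc l isint (m%:R ^+ 2 / l%:R).
  exists n => //; rewrite (_ : _ *+ n = l%:R * ((m%:R / l%:R) ^+ 2 *+ n)).
    by rewrite mulr_natl; exact: (zsMn isint_zmod).
  by rewrite mulrnAr; congr (_ *+ _); field.
by move=> /(loc_sqr_div lP); rewrite (negbTE mP).
Qed.

End Line.

(** * Two orthogonal lines and the quotient by their sum *)

Section Pair.
Context {c1 c2 : 'cV[B]_2} {J1 J2 : set B}.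
Context (c1_neq0 : c1 != 0) (c2_neq0 : c2 != 0) (c12 : hform f c1 c2 = 0).
Context (J1_lat : right_lattice O J1) (J2_lat : right_lattice O J2).
Context (J1_sub : forall x, J1 x -> L (colZ c1 x)) (J2_sub : forall x, J2 x -> L (colZ c2 x)).

Let J1z : zmod_set J1. Proof. by case: J1_lat => hJ _ _; exact: (right_ideal_zmod O_max hJ). Qed.
Let J1M x y : J1 x -> O y -> J1 (x * y).
Proof. by case: J1_lat => -[_ _ h] _ _; exact: h. Qed.

Lemma add_csetE u : add_set (cset c1 J1) (cset c2 J2) u <-> J1 (coef c1 u) /\ J2 (coef c2 u).
Proof.
split=> [[_ [_ [[x Jx ->] [y Jy ->] ->]]]|[h1 h2]].
  rewrite !coefD !coef_id // !coef_orth ?addr0 ?add0r //; exact: hform_sym0.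
exists (colZ c1 (coef c1 u)), (colZ c2 (coef c2 u)); split; last exact: decomposition.
  by exists (coef c1 u).
by exists (coef c2 u).
Qed.

Lemma frob_image x : (exists2 y, O y & x = F * y) <-> O (qinv F * x).
Proof.
split=> [[y Oy ->]|h]; first by rewrite qmulVK.
by exists (qinv F * x); rewrite ?qmulKV.
Qed.

(** Through [coef c1] the quotient embeds into [J1 F^-1 / J1]. For a local generator [x] at [p],
    left multiplication by [F x^-1] carries this to [O / F O], with [m] clearing denominators away
    from [p]. The image is nonzero by [coef_not_integral], and a nonzero submodule of [O / F O] is
    everything. *)
Lemma quotient_condition_of_primitive :
    (forall x, L (colZ c1 x) -> J1 x) -> (forall x, L (colZ c2 x) -> J2 x) ->
    (forall u, L u -> J1 (coef c1 u * F)) ->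
  quotient_condition O F (cset c1 J1) (cset c2 J2).
Proof.
move=> prim1 prim2 hF.
have [x gx] := local_generator_exists an bn O_max p_prime J1_lat.
have [m mP hm] := local_generator_div an bn O_max p_prime J1_lat gx.
have [Jx xn0 minx] := gx.
pose phi u := F * (qinv x * coef c1 u *+ m).
have phiD v w : phi (v + w) = phi v + phi w.
  by rewrite /phi coefD mulrDr mulrnDl mulrDr.
have phiZ v y : phi (colZ v y) = phi v * y.
  by rewrite /phi coefZ mulrA -mulrnAl mulrA.
have addE u : L u -> add_set (cset c1 J1) (cset c2 J2) u <-> J1 (coef c1 u).
  move=> Lu; split=> [/add_csetE[]|h] //; apply/add_csetE; split=> //; apply: prim2.
  have -> : colZ c2 (coef c2 u) = u - colZ c1 (coef c1 u).
    by apply/eqP; rewrite eq_sym subr_eq addrC; apply/eqP; exact: decomposition.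
  by apply: (zsB lattice_zmod) => //; exact: J1_sub.
have phiO u : L u -> O (phi u).
  move=> Lu; have := FJV (hm _ (hF _ Lu)); congr O.
  by rewrite /phi mulrA mulrnAr mulrnAl mulrnAr -!mulrA qmulV // mulr1.
have phi_ker u : L u -> (O (qinv F * phi u) <-> add_set (cset c1 J1) (cset c2 J2) u).
  move=> Lu; rewrite addE // /phi qmulVK //; split; last exact: hm.
  move=> h; apply: (loc_both (l := p) (k := 1) J1z) => //.
    (* Away from [p], multiply [coef c1 u * F] once more by [F] and use [F ^ 2 = - p]. *)
    have := zsN J1z (J1M (hF _ Lu) F_O); congr J1.
    by rewrite -mulrA (frob_sqr F_sq) mulrN opprK -scC scMn expn1.
  exists m => //; have := J1M Jx h; congr J1.
  by rewrite mulrnAr qmulKV.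
exists phi; split.
- exact: phiO.
- by move=> v w _ _; apply/frob_image; rewrite phiD subrr mulr0; exact: (zs0 Oz).
- by move=> v y _ _; apply/frob_image; rewrite phiZ subrr mulr0; exact: (zs0 Oz).
- by move=> v Lv; split=> [/frob_image/phi_ker|/phi_ker h]; [apply | apply/frob_image; exact: h].
- move=> t Ot; have [u Lu nu] := coef_not_integral c1_neq0 J1_lat J1_sub.
  have nphi : ~ O (qinv F * phi u) by move=> /phi_ker -/(_ Lu)/addE -/(_ Lu).
  have [y Oy hy] := frob_quotient_div an bn O_max p_prime p_ram F_O F_sq (phiO _ Lu) nphi Ot.
  exists (colZ u y); first exact: lattice_colZ.
  by apply/frob_image; rewrite phiZ.
Qed.

(** A vector [w] of the second line outside the sublattice would have nonzero class, hence generate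
    [O / F O]. Every [u] in [L] would then differ from some multiple of [w] by an element of the
    sum, so all [coef c1 u] would lie in [J1], against [coef_not_integral]. *)
Lemma quotient_condition_primitive :
    quotient_condition O F (cset c1 J1) (cset c2 J2) ->
  forall x, L (colZ c2 x) -> J2 x.
Proof.
move=> [phi [phiO phiD phiZ phi_ker _]] x Lw; set w := colZ c2 x in Lw.
apply: contrapT => nx.
have nphi : ~ O (qinv F * phi w).
  move=> /frob_image/(phi_ker _ Lw)/add_csetE[_]; rewrite coef_id //.
have [u Lu] := coef_not_integral c1_neq0 J1_lat J1_sub; apply.
have [y Oy hy] := frob_quotient_div an bn O_max p_prime p_ram F_O F_sq
  (phiO _ Lw) nphi (phiO _ Lu).
have Lwy : L (colZ w y) by exact: lattice_colZ.
have Luw : L (u - colZ w y) by exact: (zsB lattice_zmod).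
have /add_csetE[] : add_set (cset c1 J1) (cset c2 J2) (u - colZ w y).
  apply/(phi_ker _ Luw)/frob_image.
  have /frob_image h1 := phiD _ _ Luw Lwy; rewrite subrK in h1.
  have /frob_image h2 := phiZ _ _ Lw Oy.
  have := zsB Oz (zsB Oz hy h1) h2; congr O.
  rewrite -!mulrBr; congr (_ * _).
  move: (phi u) (phi (u - _)) (phi (colZ w y)) (phi w * y) => A X Y Z.
  by apply: quat_eq; rewrite !qE; ring.
by rewrite coefB /w colZA coef_orth // subr0.
Qed.

(** Right multiplication by [F] kills [O / F O], because [F] normalizes [O]. *)
Lemma frob_colZ_mem : quotient_condition O F (cset c1 J1) (cset c2 J2) ->
  forall u, L u -> J1 (coef c1 u * F).
Proof.
move=> [phi [phiO _ phiZ phi_ker _]] u Lu; rewrite -coefZ.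
have LuF : L (colZ u F) by exact: lattice_colZ.
have /add_csetE[] // : add_set (cset c1 J1) (cset c2 J2) (colZ u F).
apply/(phi_ker _ LuF)/frob_image.
have /frob_image h := phiZ _ _ Lu F_O.
rewrite -[phi _](subrK (phi u * F)) mulrDr; apply: (zsD Oz) => //.
by rewrite mulrA; apply: FJ; exact: phiO.
Qed.

End Pair.

Lemma spanB_cset c J w : right_lattice O J ->
  spanB (cset c J) w <-> exists x, w = colZ c x.
Proof.
move=> [_ [x0 Jx0 x0n0] _]; split=> [[m [v [y [hv ->]]]]|[x ->]].
  elim/big_rec: _ => [|i u _ [x ->]]; first by exists 0; rewrite colZ0.
  by have [z _ ->] := hv i; exists (z * y i + x); rewrite colZA colZDr.
exists 1%N, (fun=> colZ c x0), (fun=> qinv x0 * x); split=> [_|]; first by exists x0.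
by rewrite big_ord1 colZA qmulKV.
Qed.

(** * Orthogonal projections and spans *)

Section Projections.
Context {c1 c2 : 'cV[B]_2} {J1 J2 : set B}.
Context (c1_neq0 : c1 != 0) (c2_neq0 : c2 != 0) (c12 : hform f c1 c2 = 0).
Context (J1_lat : right_lattice O J1) (J2_lat : right_lattice O J2).

Lemma projections_coef P1 P2 :
    projections (spanB (cset c1 J1)) (spanB (cset c2 J2)) P1 P2 ->
  forall w, P1 *m w = colZ c1 (coef c1 w) /\ P2 *m w = colZ c2 (coef c2 w).
Proof.
move=> [h1 h2] w.
have [e1 e2] : P1 *m c1 = c1 /\ P2 *m c1 = 0.
  by apply: h1; apply/spanB_cset => //; exists 1; rewrite colZ1.
have [e3 e4] : P1 *m c2 = 0 /\ P2 *m c2 = c2.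
  by apply: h2; apply/spanB_cset => //; exists 1; rewrite colZ1.
have z y : colZ (0 : 'cV[B]_2) y = 0 by apply/colP => i; rewrite !mxE mul0r.
have wE := decomposition w c1_neq0 c2_neq0 c12.
have E1 x : P1 *m colZ c1 x = colZ c1 x by rewrite mul_colZ e1.
have E2 x : P2 *m colZ c1 x = 0 by rewrite mul_colZ e2.
have E3 x : P1 *m colZ c2 x = 0 by rewrite mul_colZ e3.
have E4 x : P2 *m colZ c2 x = colZ c2 x by rewrite mul_colZ e4.
move: (coef c1 w) (coef c2 w) wE => x y ->.
by rewrite !mulmxDr E1 E2 E3 E4 addr0 add0r.
Qed.

(** The Gram formula for the orthogonal projection to the line of [c]. *)
Definition coef_proj c : 'M[B]_2 := c *m ((qinv (hform f c c))%:M *m (adjmx c *m f)).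

Lemma coef_projE c w : coef_proj c *m w = colZ c (coef c w).
Proof.
rewrite /coef_proj colZE -!mulmxA; congr (_ *m _); apply/matrixP => i j.
rewrite (ord1 i) (ord1 j) mxE big_ord1 !mxE eqxx !mulr1n; congr (_ * _).
by rewrite /hform -mulmxA mxE.
Qed.

Lemma projections_exists : exists P1 P2,
  projections (spanB (cset c1 J1)) (spanB (cset c2 J2)) P1 P2.
Proof.
have c21 := hform_sym0 c12.
exists (coef_proj c1), (coef_proj c2).
by split=> v /spanB_cset -/(_ _)[//|x ->]; rewrite !coef_projE coef_id // coef_orth // colZ0.
Qed.

Lemma direct_sum_span : direct_sum (spanB (cset c1 J1)) (spanB (cset c2 J2)).
Proof.
split=> [w|w].
  exists (colZ c1 (coef c1 w)), (colZ c2 (coef c2 w)); split; last exact: decomposition.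
    by apply/spanB_cset => //; exists (coef c1 w).
  by apply/spanB_cset => //; exists (coef c2 w).
move=> /spanB_cset -/(_ J1_lat)[x ->] /spanB_cset -/(_ J2_lat)[y e].
have := congr1 (coef c1) e; rewrite coef_id // coef_orth // => ->.
by rewrite colZ0.
Qed.

End Projections.

(** Orthogonality lets the left projection be dropped, giving [f *m P2], whose kernel is the line of
    [c1] because [f] is definite. *)
Lemma projected_form c1 c2 J1 J2 P1 P2 : c1 != 0 -> c2 != 0 -> hform f c1 c2 = 0 ->
    right_lattice O J1 -> right_lattice O J2 ->
    (forall x, J1 x -> L (colZ c1 x)) -> (forall x, J2 x -> L (colZ c2 x)) ->
    (forall x, L (colZ c1 x) -> J1 x) -> (forall u, L u -> J2 (coef c2 u * F)) ->
    (forall w, P1 *m w = colZ c1 (coef c1 w)) ->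
    (forall w, P2 *m w = colZ c2 (coef c2 w)) ->
  let f1 := adjmx P2 *m f *m P2 in
  [/\ f1 = f *m P2, integral_mx O f1, hermitian_mx f1, has_rank f1 1
    & ker_lattice O f1 = cset c1 J1].
Proof.
move=> n1 n2 c12 lJ1 lJ2 s1 s2 prim1 hF2 hP1 hP2 f1.
have c21 := hform_sym0 c12.
have f1E : f1 = f *m P2.
  apply: hform_ext => v w; rewrite hform_mul hform_mulr !hP2.
  move: (coef c1 v) (coef c2 v) (coef c2 w) (decomposition v n1 n2 c12) => x y z ->.
  have e : hform f (colZ c1 x) (colZ c2 z) = 0.
    by rewrite hformZl hformZr c12 mul0r mulr0.
  by rewrite [RHS]hformDl e add0r.
split=> //.
- rewrite f1E => i j; rewrite -hform_delta hform_mulr hP2.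
  (* The projection becomes a lattice vector after multiplication by [F], and [f] takes values in
     [F O] on [L]; conjugation by [F] cancels the two factors. *)
  set y := coef c2 _; have Lt : L (colZ c2 (y * F)) by apply/s2/hF2; exact: lattice_delta.
  have := FJV (hform_frob (lattice_delta i) Lt); congr O.
  by rewrite !hformZr qmulKV // !mulrA -mulrA qmulV // mulr1.
- by apply: hermitian_form => v w; rewrite !hform_mul (hformC _ _ f_herm).
- exists (f *m c2); split=> [x h|w].
    have : hform f c2 (c2 *m x) = 0 by rewrite /hform -mulmxA [f *m _]mulmxA h mulmx0 mxE.
    have -> : c2 *m x = colZ c2 (x 0 0).
      by rewrite colZE; congr (_ *m _); apply/colP => i; rewrite (ord1 i) mxE.
    rewrite hformZr => /eqP; rewrite qmul_eq0 // (negbTE (hform_neq0 n2)) /= => /eqP x0.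
    by apply/colP => i; rewrite (ord1 i) x0 mxE.
  split=> [[v ->]|[x ->]].
    by exists (coef c2 v)%:M; rewrite f1E -mulmxA hP2 colZE mulmxA.
  exists (c2 *m x); rewrite f1E -!mulmxA; congr (_ *m _); rewrite hP2.
  have -> : c2 *m x = colZ c2 (x 0 0).
    by rewrite colZE; congr (_ *m _); apply/colP => i; rewrite (ord1 i) mxE.
  by rewrite coef_id.
- apply/seteqP; split=> w.
    move=> [Lw]; rewrite f1E -mulmxA hP2 => h.
    have y0 : coef c2 w = 0.
      have : hform f c2 (colZ c2 (coef c2 w)) = 0 by rewrite /hform -mulmxA h mulmx0 mxE.
      rewrite hformZr => /eqP; rewrite qmul_eq0 // (negbTE (hform_neq0 n2)) /=.
      by move=> /eqP.
    move: (decomposition w n1 n2 c12); rewrite y0 colZ0 addr0 => wE.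
    by exists (coef c1 w) => //; apply: prim1; rewrite -wE.
  move=> [x Jx ->]; split; first exact: s1.
  by rewrite f1E -mulmxA hP2 coef_orth // colZ0 mulmx0.
Qed.

(** The largest [J] with [c J] inside [L]: the coefficients of the saturated line. *)
Definition line_ideal c : set B := [set x | L (colZ c x)]%classic.

Lemma line_ideal_lattice c : c != 0 -> right_lattice O (line_ideal c).
Proof.
move=> cn0; split.
- split.
  + by rewrite /line_ideal /= colZ0; exact: (zs0 lattice_zmod).
  + by move=> x y; rewrite /line_ideal /= colZDr; exact: (zsD lattice_zmod).
  + by move=> x y; rewrite /line_ideal /= -colZA; exact: lattice_colZ.
- have [m m_gt0 hm] := common_multiple Oz (fun i => order_multiple hO (c i 0)).
  exists m%:R; last by rewrite -scn sc_eq0 pnatr_eq0 -lt0n.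
  by move=> i j; rewrite ord1 mxE mulr_natr.
- have [i cin0] : exists i, c i 0 != 0.
    apply: contrapT => h; case/eqP: cn0; apply/colP => i; rewrite mxE.
    by apply: contrapT => /eqP ci; apply: h; exists i.
  have [m m_gt0 hm] := order_multiple hO (qinv (c i 0)); exists m => // x Lx.
  have := Lx i 0; rewrite mxE => h.
  by rewrite -(qmulVK an bn x cin0) -mulrnAl; exact: (orderM hO).
Qed.

Lemma ker_lattice_line g c : (forall w, g *m w = 0 <-> exists x, w = colZ c x) ->
  ker_lattice O g = cset c (line_ideal c).
Proof.
move=> hg; apply/seteqP; split=> w.
  by move=> [Lw /hg[x wE]]; exists x => //; rewrite /line_ideal /= -wE.
by move=> [x Lx ->]; split=> //; apply/hg; exists x.
Qed.

Lemma cset_sublattice c J : right_lattice O J -> (forall x, J x -> L (colZ c x)) ->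
  sublattice O (cset c J).
Proof.
move=> [[J0 JD JM] _ _] hJ; split=> [_ [x Jx ->]|]; first exact: hJ.
split.
- by exists 0; rewrite ?colZ0.
- by move=> _ _ [x Jx ->] [y Jy ->]; exists (x + y); [exact: JD | rewrite colZDr].
- by move=> _ y [x Jx ->] Oy; exists (x * y); [exact: JM | rewrite colZA].
Qed.

Lemma invertible_cset X : sublattice O X -> invertible O X ->
  exists c J, [/\ c != 0, right_lattice O J, X = cset c J & forall x, J x -> L (colZ c x)].
Proof.
move=> [XL _] [c cn0 [J hJ XE]]; exists c, J; split=> //.
  exact: (invertible_right_lattice an bn O_max hJ).
by move=> x Jx; apply: XL; rewrite XE; exists x.
Qed.

Lemma cset_orthogonal c1 c2 J1 J2 : right_lattice O J1 -> right_lattice O J2 ->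
  Defs.orthogonal f (cset c1 J1) (cset c2 J2) <-> hform f c1 c2 = 0.
Proof.
move=> [_ [x Jx xn0] _] [_ [y Jy yn0] _]; split=> [h|h _ _ [z _ ->] [t _ ->]]; last first.
  by rewrite hformZl hformZr h mul0r mulr0.
have : hform f (colZ c1 x) (colZ c2 y) = 0 by apply: h; [exists x | exists y].
rewrite hformZl hformZr => /eqP; rewrite !qmul_eq0 // qconj_eq0.
by rewrite (negbTE xn0) (negbTE yn0) orbF => /eqP.
Qed.

Lemma ker_lattice_of_splitting f1 f2 : rank1_splitting O f f1 f2 ->
  let I1 := ker_lattice O f1 in let I2 := ker_lattice O f2 in
  [/\ orthogonal_pair O f I1 I2, quotient_condition O F I1 I2 &
      forall P1 P2, projections (spanB I1) (spanB I2) P1 P2 ->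
        adjmx P2 *m f *m P2 = f1 /\ adjmx P1 *m f *m P1 = f2].
Proof.
move=> [[f1O f2O] [f1H f2H] [r1 r2] fE] I1 I2.
have [c1 n1 k1] := rank1_kernel an bn r1; have [c2 n2 k2] := rank1_kernel an bn r2.
have lJ1 := line_ideal_lattice n1; have lJ2 := line_ideal_lattice n2.
have e1 : I1 = cset c1 (line_ideal c1) := ker_lattice_line k1.
have e2 : I2 = cset c2 (line_ideal c2) := ker_lattice_line k2.
have f1c1 x : f1 *m colZ c1 x = 0 by apply/k1; exists x.
have f2c2 x : f2 *m colZ c2 x = 0 by apply/k2; exists x.
have fc1 x : f *m colZ c1 x = f2 *m colZ c1 x by rewrite fE mulmxDl f1c1 add0r.
have fc2 x : f *m colZ c2 x = f1 *m colZ c2 x by rewrite fE mulmxDl f2c2 addr0.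
(* [f2] kills [c2] on the right, and [f1], being hermitian, kills [c1] on the left. *)
have c12 : hform f c1 c2 = 0.
  rewrite fE hform_add {2}/hform -mulmxA -{2}(colZ1 c2) f2c2 mulmx0 [X in _ + X]mxE addr0.
  by rewrite (hformC _ _ f1H) /hform -mulmxA -(colZ1 c1) f1c1 mulmx0 mxE qconj0.
have c21 := hform_sym0 c12.
(* f P1 = f2 is integral and T f = F, so u |-> P1 u F maps L to itself. *)
have mem c c' g : c != 0 -> c' != 0 -> hform f c c' = 0 -> integral_mx O g ->
    (forall x, g *m colZ c' x = 0) -> (forall x, f *m colZ c x = g *m colZ c x) ->
    forall u, L u -> line_ideal c (coef c u * F).
  move=> n n' cc' gO gc' fc u Lu i j; rewrite ord1 -colZA mxE.
  have -> : colZ c (coef c u) i 0 = qinv F * (T *m (g *m u)) i 0.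
    have gu : g *m u = f *m colZ c (coef c u).
      move: (coef c u) (coef c' u) (decomposition u n n' cc') => x y ->.
      by rewrite mulmxDr gc' addr0 fc.
    by rewrite gu mulmxA T_f mul_scalar_mx [X in _ = qinv F * X]mxE qmulVK.
  apply: FJ; rewrite mxE; apply: (zs_sum Oz) => k _; apply: (orderM hO) => //.
  by rewrite mxE; apply: (zs_sum Oz) => k' _; apply: (orderM hO).
split.
- split; rewrite e1 e2.
  + by split; apply: cset_sublattice.
  + by split; [exists c1 | exists c2] => //;
      [exists (line_ideal c1) | exists (line_ideal c2)] => //;
      exact: right_lattice_invertible.
  + by apply/cset_orthogonal.
- rewrite e1 e2; apply: quotient_condition_of_primitive => //.
  exact: (mem c1 c2 f2).
- move=> P1 P2; rewrite e1 e2 => hP.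
  have hP1 w := (projections_coef n1 n2 c12 lJ1 lJ2 hP w).1.
  have hP2 w := (projections_coef n1 n2 c12 lJ1 lJ2 hP w).2.
  have m1 := mem c1 c2 f2 n1 n2 c12 f2O f2c2 fc1.
  have m2 := mem c2 c1 f1 n2 n1 c21 f1O f1c1 fc2.
  have := @projected_form c1 c2 _ _ P1 P2 n1 n2 c12 lJ1 lJ2.
  move=> /(_ (fun _ => id) (fun _ => id) (fun _ => id) m2 hP1 hP2)[-> _ _ _ _].
  have := @projected_form c2 c1 _ _ P2 P1 n2 n1 c21 lJ2 lJ1.
  move=> /(_ (fun _ => id) (fun _ => id) (fun _ => id) m1 hP2 hP1)[-> _ _ _ _].
  have colext (M N : 'M[B]_2) : (forall w : 'cV_2, M *m w = N *m w) -> M = N.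
    by move=> h; apply: hform_ext => v w; rewrite /hform -!mulmxA h.
  split; apply: colext => w; rewrite -mulmxA ?hP1 ?hP2.
    move: (coef c1 w) (coef c2 w) (decomposition w n1 n2 c12) => x y ->.
    by rewrite fc2 mulmxDr f1c1 add0r.
  move: (coef c1 w) (coef c2 w) (decomposition w n1 n2 c12) => x y ->.
  by rewrite fc1 mulmxDr f2c2 addr0.
Qed.

Lemma add_setC (X Y : set 'cV[B]_2) : add_set X Y = add_set Y X.
Proof.
by apply/seteqP; split=> w [v1 [v2 [h1 h2 ->]]]; exists v2, v1; rewrite addrC.
Qed.

Lemma quotient_conditionC I1 I2 :
  quotient_condition O F I1 I2 -> quotient_condition O F I2 I1.
Proof. by rewrite /quotient_condition add_setC. Qed.

Lemma splitting_of_pair I1 I2 : orthogonal_pair O f I1 I2 -> quotient_condition O F I1 I2 ->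
  [/\ direct_sum (spanB I1) (spanB I2),
      exists P1 P2, projections (spanB I1) (spanB I2) P1 P2 &
      forall P1 P2, projections (spanB I1) (spanB I2) P1 P2 ->
        let f1 := adjmx P2 *m f *m P2 in
        let f2 := adjmx P1 *m f *m P1 in
        [/\ rank1_splitting O f f1 f2,
            ker_lattice O f1 = I1 & ker_lattice O f2 = I2]].
Proof.
move=> [[sI1 sI2] [iI1 iI2] orth] quo.
have [c1 [J1 [n1 lJ1 e1 s1]]] := invertible_cset sI1 iI1.
have [c2 [J2 [n2 lJ2 e2 s2]]] := invertible_cset sI2 iI2.
rewrite e1 e2 in orth quo *; move/(cset_orthogonal c1 c2 lJ1 lJ2): orth => c12.
(* The lemmas on pairs treat the two lines differently; as (iii) is symmetric, each is applied in
   both orders. *)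
have c21 := hform_sym0 c12; have quo' := quotient_conditionC quo.
split; [exact: direct_sum_span | exact: projections_exists | move=> P1 P2 hP].
have hP1 w := (projections_coef n1 n2 c12 lJ1 lJ2 hP w).1.
have hP2 w := (projections_coef n1 n2 c12 lJ1 lJ2 hP w).2.
have prim2 := quotient_condition_primitive n1 n2 c12 lJ1 s1 quo.
have prim1 := quotient_condition_primitive n2 n1 c21 lJ2 s2 quo'.
have m1 := frob_colZ_mem n1 n2 c12 quo.
have m2 := frob_colZ_mem n2 n1 c21 quo'.
have [f1E ? ? ? ?] := projected_form n1 n2 c12 lJ1 lJ2 s1 s2 prim1 m2 hP1 hP2.
have [f2E ? ? ? ?] := projected_form n2 n1 c21 lJ2 lJ1 s2 s1 prim2 m1 hP2 hP1.
split=> //; split=> //; rewrite f1E f2E -mulmxDr.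
apply: hform_ext => v w; rewrite hform_mulr mulmxDl hP1 hP2 addrC.
by rewrite -(decomposition w n1 n2 c12).
Qed.

(** * The norm condition *)

Section NormCondition.
Context {c1 c2 : 'cV[B]_2} {J1 J2 : set B}.
Context (n1 : c1 != 0) (n2 : c2 != 0) (c12 : hform f c1 c2 = 0).
Context (lJ1 : right_lattice O J1) (lJ2 : right_lattice O J2).
Context (s1 : forall x, J1 x -> L (colZ c1 x)) (s2 : forall x, J2 x -> L (colZ c2 x)).

Let J1z : zmod_set J1. Proof. by case: lJ1 => hJ _ _; exact: (right_ideal_zmod O_max hJ). Qed.
Let J1M x y : J1 x -> O y -> J1 (x * y).
Proof. by case: lJ1 => -[_ _ h] _ _; exact: h. Qed.

Lemma cset_index x r : reduced_index (cset c1 J1) (principal O (colZ c1 x)) r <->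
  has_index J1 (rprinc O x) (r ^ 2).
Proof.
have inj y z : colZ c1 y = colZ c1 z -> y = z.
  by move=> e; rewrite -(coef_id y n1) e coef_id.
split.
  apply: (has_index_map (f := coef c1)).
  - by move=> v w; rewrite coefB.
  - split; first by exists 0; [exact: (zs0 J1z) | rewrite colZ0].
    move=> _ _ [y Jy ->] [z Jz' ->]; exists (y - z); last by rewrite colZBr.
    exact: (zsB J1z).
  - by move=> _ [y Jy ->]; rewrite coef_id.
  - by move=> y Jy; exists (colZ c1 y); [exists y | rewrite coef_id].
  - move=> _ [y Jy ->]; rewrite coef_id //; split=> [[z Oz' /(_ =P _)]|[z Oz' ->]].
      by rewrite colZA => /eqP/inj ->; exists z.
    by exists z; rewrite ?colZA.
apply: (has_index_map (f := colZ c1)) => //.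
- by move=> v w; rewrite colZBr.
- by move=> y Jy; exists y.
- move=> y Jy; split=> [[z Oz' ->]|[z Oz']]; first by exists z; rewrite ?colZA.
  by rewrite colZA => /inj ->; exists z.
Qed.

Lemma hform_line_nrd : exists r : rat,
  forall x, hform f (colZ c1 x) (colZ c1 x) = sc (r * nrd x).
Proof.
have [r r_gt0 hr] := hform_gt0 n1; exists r.
by move=> x; rewrite hformZl hformZr hr (scC r) mulrA conj_mul -scM mulrC.
Qed.

Lemma norm_condition_of_primitive : (forall x, L (colZ c1 x) -> J1 x) ->
    (forall u, L u -> J1 (coef c1 u * F)) ->
  forall v, cset c1 J1 v -> v != 0 ->
    exists2 r : nat, reduced_index (cset c1 J1) (principal O v) r &
      hform f v v = (p * r)%:R.
Proof.
move=> prim1 m1 _ [x Jx ->] vn0.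
have xn0 : x != 0 by apply: contraNneq vn0 => ->; rewrite colZ0.
have [q hq] := hform_line_nrd.
have /choice[r hr] y : exists r : nat, J1 y -> y != 0 ->
    hform f (colZ c1 y) (colZ c1 y) = (p * r)%:R.
  (* The value 0 outside the nonzero elements of [J1] is a dummy. *)
  case: (pselect (J1 y /\ y != 0)) => [[Jy yn0]|h]; last by exists 0%N => Jy yn0; case: h.
  have [|h _ hh] := hform_dvd (s1 Jy); last by exists h.
  by apply: contraNneq yn0 => /(colZ_eq0 an bn n1) ->.
exists (r x); last exact: hr.
have pn0 : p%:R != 0 :> rat by rewrite pnatr_eq0 -lt0n.
(* [q] is the value of the form at [c1], so [r y = (q / p) * nrd y]. *)
apply/cset_index; apply: (@order_index_norm _ _ an bn _ O_max J1 (q / p%:R) r x) => //.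
- move=> y Jy yn0; have := hr y Jy yn0; rewrite hq -scn => /sc_inj.
  by rewrite natrM mulrAC => ->; rewrite mulrAC mulfV // mul1r.
- move=> l lP; have [y gy] := local_generator_exists an bn O_max lP lJ1.
  have [Jy yn0 _] := gy; exists y => //.
  exact: (local_generator_unit n1 lJ1 lP prim1 m1 gy (hr y Jy yn0)).
Qed.

(* At a local generator x of J1 at l, the index of x O in J1 is prime to l, so
   that f (c1 x, c1 x) / p is a unit at l. *)
Lemma quotient_condition_of_norm : (forall x, L (colZ c2 x) -> J2 x) ->
    (forall v, cset c1 J1 v -> v != 0 ->
      exists2 r : nat, reduced_index (cset c1 J1) (principal O v) r &
        hform f v v = (p * r)%:R) ->
  quotient_condition O F (cset c1 J1) (cset c2 J2).
Proof.
move=> prim2 norm.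
have unit l : prime l -> exists x r, [/\ J1 x, x != 0, ~~ (l %| r)%N, (0 < r)%N &
    hform f (colZ c1 x) (colZ c1 x) = (p * r)%:R].
  move=> lP; have [x gx] := local_generator_exists an bn O_max lP lJ1.
  have [m mP hm] := local_generator_div an bn O_max lP lJ1 gx; have [Jx xn0 minx] := gx.
  have vn0 : colZ c1 x != 0 by apply: contraNneq xn0 => /(colZ_eq0 an bn n1) ->.
  have [r /cset_index hr hh] : exists2 r : nat,
      reduced_index (cset c1 J1) (principal O (colZ c1 x)) r &
      hform f (colZ c1 x) (colZ c1 x) = (p * r)%:R by apply: norm => //; exists x.
  exists x, r; split=> //.
    have m_gt0 : (0 < m)%N by rewrite lt0n; apply: contraNneq mP => ->; rewrite dvdn0.
    apply: contra mP => lr; have : (r ^ 2 %| m ^ 4)%N.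
      apply: (rprinc_index_dvd an bn O_max lJ1 Jx xn0 m_gt0 _ hr) => z Jz'.
      by exists (qinv x * z *+ m); [exact: hm | rewrite mulrnAr qmulKV].
    have lr2 : (l %| r ^ 2)%N by rewrite Euclid_dvdX // lr.
    by move=> /(dvdn_trans lr2); rewrite Euclid_dvdX // => /andP[].
  rewrite lt0n; apply: contraNneq (hform_neq0 vn0) => r0.
  by rewrite hh r0 muln0.
(* The value [p * r * y] of the form lies in [F O]. Dividing by [F] leaves [F * y *+ r] in [O] up to
   sign, and conjugation by [F] moves [F] to the right. *)
have m1 u : L u -> J1 (coef c1 u * F).
  move=> Lu; apply: (loc_global J1z) => l /unit[x [r [Jx xn0 lr _ hh]]].
  exists r => //; have := hform_frob (s1 Jx) Lu; rewrite hform_line // hh.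
  set y := qinv x * coef c1 u => Oy.
  have {}Oy : O (y * F *+ r).
    have := zsN Oz (FJ Oy); congr O.
    rewrite mulr_natl mulrnAr mulrnA (frob_inv_mulp p_prime F_sq).
    by rewrite mulrnAr mulrnAl mulrN mulNr qmulVK // mulNrn opprK.
  have := J1M Jx Oy; congr J1.
  by rewrite mulrnAr /y !mulrA qmulV // mul1r.
(* Away from [p], [m1] and [F ^ 2 = - p] put [x *+ p] in [J1]. At [p], the norms of [x] and of the
   element [y] from [unit] have ratio [h / r] with [r] prime to [p], so [qinv y * x] is in [O]
   locally. *)
have prim1 x : L (colZ c1 x) -> J1 x.
  move=> Lx; apply: (loc_global J1z) => l lP; have [lp|lp] := eqVneq l p; last first.
    exists p; first by rewrite dvdn_prime2.
    have := zsN J1z (J1M (m1 _ Lx) F_O); congr J1.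
    by rewrite coef_id // -mulrA (frob_sqr F_sq) mulrN opprK -scC scMn.
  rewrite lp; have [y [r [Jy yn0 pr r_gt0 hh]]] := unit _ p_prime.
  have [->|xn0] := eqVneq x 0; first by apply: loc_sub => //; exact: (zs0 J1z).
  have vn0 : colZ c1 x != 0 by apply: contraNneq xn0 => /(colZ_eq0 an bn n1) ->.
  have [h _ hx] := hform_dvd Lx vn0.
  have [q hq] := hform_line_nrd.
  have [m mP hm] : loc p O (qinv y * x).
    apply: (nrd_loc_order O_max p_prime p_ram); exists r => //.
    rewrite nrdM nrdV // (_ : _ *+ r = h%:R); first exact: isint_natr.
    move: hh hx; rewrite !hq -!scn => /sc_inj hy /sc_inj hx.
    have ny : nrd y != 0 by rewrite nrd_eq0.
    have pn0 : p%:R != 0 :> rat by rewrite pnatr_eq0 -lt0n.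
    have rn0 : r%:R != 0 :> rat by rewrite pnatr_eq0 -lt0n.
    have qE : q = p%:R * r%:R / nrd y by rewrite -natrM -hy mulfK.
    rewrite -[_ *+ r]mulr_natr; apply: (mulfI pn0); rewrite -natrM -hx qE.
    by field.
  exists m => //; have := J1M Jy hm; congr J1.
  by rewrite mulrnAr qmulKV.
exact: quotient_condition_of_primitive.
Qed.

End NormCondition.

Lemma quotient_iff_norm I1 I2 : orthogonal_pair O f I1 I2 ->
  quotient_condition O F I1 I2 <-> norm_condition p O f I1 I2.
Proof.
move=> [[sI1 sI2] [iI1 iI2] orth].
have [c1 [J1 [n1 lJ1 e1 s1]]] := invertible_cset sI1 iI1.
have [c2 [J2 [n2 lJ2 e2 s2]]] := invertible_cset sI2 iI2.
rewrite e1 e2 in orth *; move/(cset_orthogonal c1 c2 lJ1 lJ2): orth => c12.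
have c21 := hform_sym0 c12.
(* On a line, a denominator of [qinv x0 * x] is an integer carrying [colZ c2 x] into the sublattice,
   so primitivity means saturation. *)
have primE : primitive O (cset c2 J2) <-> (forall x, L (colZ c2 x) -> J2 x).
  split=> [prim x Lx|prim v y Lv Oy yn0 [z Jz]].
    have [_ [x0 Jx0 x0n0] _] := lJ2; have [[_ _ J2M] _ _] := lJ2.
    have [m m_gt0 hm] := order_multiple hO (qinv x0 * x).
    have : cset c2 J2 (colZ c2 x).
      apply: (prim _ m%:R) => //; first exact: order_nat.
        by rewrite -scn sc_eq0 pnatr_eq0 -lt0n.
      rewrite colZA; exists (x * m%:R) => //.
      have := J2M _ _ Jx0 hm; congr J2.
      by rewrite mulr_natr mulrnAr qmulKV.
    by move=> [y Jy e]; rewrite -(coef_id x n2) e coef_id.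
  move=> e; have vE : v = colZ c2 (z * qinv y).
    by rewrite -colZA -e colZA qmulV // colZ1.
  by exists (z * qinv y) => //; apply: prim; rewrite -vE.
split=> [quo|[/primE prim2 norm]]; last exact: quotient_condition_of_norm.
have quo' := quotient_conditionC quo.
have prim2 := quotient_condition_primitive n1 n2 c12 lJ1 s1 quo.
have prim1 := quotient_condition_primitive n2 n1 c21 lJ2 s2 quo'.
have m1 := frob_colZ_mem n1 n2 c12 quo.
by split; [apply/primE | exact: norm_condition_of_primitive].
Qed.

End Splitting.

Theorem proposition4p7
  (p : nat) (p_prime : prime p) (p_gt2 : (2 < p)%N)
  (k : closedFieldType) (k_char : p \in [pchar k])
  (E : ellCurve k) (E_Fp : defined_over_Fp E p) (E_ss : supersingular E p)
  (a b : rat) (a_neq0 : a != 0) (b_neq0 : b != 0)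
  (B_ram : ramified_exactly_at_p_infinity a b p)
  (O : set (quat a b)) (O_max : maximal_order O)
  (act : quat a b -> gtrans E E) (O_End : endomorphism_ring O act)
  (F : quat a b) (F_O : O F) (F_frob : is_frobenius p (act F))
  (F_sq : F ^+ 2 + p%:R = 0)
  (f : 'M[quat a b]_2) (f_O : integral_mx O f)
  (f_pol : induces_polarization act f)
  (f_ker : polarization_kernel act f (act F)) :
  [/\ forall f1 f2, rank1_splitting O f f1 f2 ->
        let I1 := ker_lattice O f1 in let I2 := ker_lattice O f2 in
        [/\ orthogonal_pair O f I1 I2, quotient_condition O F I1 I2 &
            forall P1 P2, projections (spanB I1) (spanB I2) P1 P2 ->
              adjmx P2 *m f *m P2 = f1 /\ adjmx P1 *m f *m P1 = f2],
      forall I1 I2, orthogonal_pair O f I1 I2 -> quotient_condition O F I1 I2 ->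
        [/\ direct_sum (spanB I1) (spanB I2),
            exists P1 P2, projections (spanB I1) (spanB I2) P1 P2 &
            forall P1 P2, projections (spanB I1) (spanB I2) P1 P2 ->
              let f1 := adjmx P2 *m f *m P2 in
              let f2 := adjmx P1 *m f *m P1 in
              [/\ rank1_splitting O f f1 f2,
                  ker_lattice O f1 = I1 & ker_lattice O f2 = I2]] &
      forall I1 I2, orthogonal_pair O f I1 I2 ->
        (quotient_condition O F I1 I2 <-> norm_condition p O f I1 I2)].
Proof.
have [p_ram inf_ram _] := B_ram; have [an bn] := ramified_at_infinity_neg inf_ram.
have hO := proj1 O_max; have [f_herm f_pos iso] := f_pol.
(* The two inclusions in [f_ker] act separately: the kernel of [f] inside that of Frobenius yields
   [T], the reverse one puts the entries of [f] in [F O]. *)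
have [T T_O T_f] := isogeny_factor O_End (order_zmod hO) (@orderM _ _ _ hO) F_O f_O
  iso (fun R P => proj1 (f_ker R P)).
have f_F := kernel_divisible an bn O_max p_prime p_ram F_O F_sq O_End F_frob f_O
  (fun R P => proj2 (f_ker R P)).
split.
- exact: (ker_lattice_of_splitting an bn O_max p_prime p_ram F_O F_sq f_herm f_pos T_O T_f f_F).
- exact: (splitting_of_pair an bn O_max p_prime p_ram F_O F_sq f_herm f_pos T_O T_f f_F).
- exact: (quotient_iff_norm an bn O_max p_prime p_ram F_O F_sq f_herm f_pos T_O T_f f_F).
Qed.
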